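(* Let $\overleftarrow{\mathcal{X}}=(X_i,f_i,f_{ij})_{i\le j}$ be a projective system of measurable locally convex vector spaces (e.v.l.c.m.), with index set $J$, and let $(X,\mathcal{C}_0,\mathcal{F},\tau)$ be its projective limit. Let $d\ge1$ be an integer, $D$ a convex subset of $X$, $(\mu_\Lambda)_{\Lambda\in\mathbb{B}}$ a compatible translation-invariant system of probabilities (s.c.i.t.) on $X^{\mathbb{Z}^d}$ carried by $D^{\mathbb{Z}^d}$, and $(\mu_n)_{n\ge1}$ the associated Cramér sequence, with entropy $s$ and pressure $p$. Suppose that, for every $i\in J$, the s.c.i.t. $(\mu_\Lambda\circ(f_i^{\mathbb{Z}^d})^{-1})_{\Lambda\in\mathbb{B}}$ on $X_i^{\mathbb{Z}^d}$ is asymptotically decoupled from below (a.d.i.) and locally controlled (c.l.). Then: (1) for every $K\in\mathcal{F}$ such that $K\cap D$ is relatively compact, $$\limsup_{n\to\infty}\frac{1}{|\Lambda(n)|}\log\mu_n(K)\le\sup_{\overline{K}}s ;$$ in particular, $(\mu_n)_{n\ge1}$ and $(\mu_n|_D)_{n\ge1}$ satisfy a weak large deviations principle; (2) for every $\lambda\in X^*$, $$p(\lambda)=\lim_{n\to\infty}\frac{1}{|\Lambda(n)|}\log\int e^{|\Lambda(n)|\langle\lambda|x\rangle}\,d\mu_n(x)$$ (the limit exists in $[-\infty,+\infty]$), and for every $\lambda\in X^*$ and $x\in X$, $p(\lambda)-s(x)\ge\langle\lambda|x\rangle$; (3) if moreover, for every $i\in J$, $(\mu_\Lambda\circ(f_i^{\mathbb{Z}^d})^{-1})_{\Lambda\in\mathbb{B}}$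 is locally convex-tight (c.t.l.) on $f_i(D)$, then $$\forall x\in X\qquad s(x)=\inf_{\lambda\in X^*}\big(p(\lambda)-\langle\lambda|x\rangle\big).$$
   Context: **Internal convex sets.** For a convex subset $C$ of a real vector space $X$, its gauge is $M_C(x)=\inf\{t\ge0: x\in tC\}\in[0,+\infty]$. $C$ is internal if $M_C$ is finite everywhere and $C=\{x: M_C(x)<1\}$. If $\mathcal{F}$ is a $\sigma$-algebra on $X$, $\mathcal{C}_0(\mathcal{F})$ is the set of $\mathcal{F}$-measurable internal convex subsets of $X$. **E.v.l.c.m.** $(X,\mathcal{C}_0,\mathcal{F},\tau)$ is an e.v.l.c.m. if $X$ is a real vector space, $\mathcal{F}$ is a $\sigma$-algebra on $X$ stable under dilations (of nonzero ratio) and translations, $\mathcal{C}_0\subset\mathcal{C}_0(\mathcal{F})$ is a family of symmetric sets, stable under finite intersections and under dilations of nonzero ratio, with intersection of all its elements equal to $\{0\}$, $\tau$ is the (Hausdorff) locally convex topology having $\mathcal{C}_0$ as a fundamental system of neighbourhoods of $0$, and every continuous linear form on $X$ is $\mathcal{F}$-measurable. $X^*$ is the topological dual. For $x\in X$, $\mathcal{C}_x=\{x+C: C\in\mathcal{C}_0\}$. **Projective systems and limits.** Let $X$ be a real vector space and $\mathcal{F}$ a $\sigma$-algebra on $X$ stable under dilations and translations. A projective system of e.v.l.c.m. is a family $(X_i,f_i,f_{ij})_{i\le j}$ where the indices lie in a preordered directed (upwards) set $(J,\le)$; each $(X_i,\mathcal{C}_{0,i},\mathcal{F}_i,\tau_i)$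 is an e.v.l.c.m.; $f_i:X\to X_i$ is linear and measurable; for $i\le j$, $f_{ij}:X_j\to X_i$ is linear, continuous and measurable; and for $i\le j\le k$: $f_{ii}=\mathrm{id}_{X_i}$, $f_i=f_{ij}\circ f_j$, $f_{ik}=f_{ij}\circ f_{jk}$. Its projective limit is $(X,\mathcal{C}_0,\mathcal{F},\tau)$, where $\mathcal{C}_0$ is the family of sets $f_i^{-1}(C_i)$ with $i\in J$ and $C_i\in\mathcal{C}_0(\mathcal{F}_i)$ symmetric and $\tau_i$-open, and $\tau$ is the locally convex topology generated by $\mathcal{C}_0$ (i.e. the initial topology of the $f_i$); the intersection of the elements of $\mathcal{C}_0$ is assumed to be $\{0\}$, so that this is an e.v.l.c.m. For a map $f:X\to E$, $f^{\mathbb{Z}^d}:X^{\mathbb{Z}^d}\to E^{\mathbb{Z}^d}$ is $(\sigma(z))_z\mapsto(f(\sigma(z)))_z$. **Boxes and $\sigma$-algebras.** $\Lambda(n)=[0,n[^d\cap\mathbb{Z}^d$; a box is a translate of some $\Lambda(n)$, $n\ge1$; $\mathbb{B}$ is the set of boxes. For $\Lambda\in\mathbb{B}$ and $\sigma\in X^{\mathbb{Z}^d}$, $\mathfrak{m}_\Lambda(\sigma)=\frac1{|\Lambda|}\sum_{z\in\Lambda}\sigma(z)$. For finite $S\subset\mathbb{Z}^d$, $\mathcal{F}_S$ is the smallest $\sigma$-algebra on $X^{\mathbb{Z}^d}$ making $\mathfrak{m}_\Lambda:X^{\mathbb{Z}^d}\to(X,\mathcal{F})$ measurable for all boxes $\Lambda\subset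 S$. For $A\subset X^{\mathbb{Z}^d}$, $A+z=\{\sigma(\cdot-z):\sigma\in A\}$. The same notions are used on $X_i^{\mathbb{Z}^d}$ with $\mathcal{F}_i$ in place of $\mathcal{F}$. **S.c.i.t.** A family $(\mu_\Lambda)_{\Lambda\in\mathbb{B}}$, $\mu_\Lambda$ a probability on $\mathcal{F}_\Lambda$, such that $\mu_{\Lambda_2}(A)=\mu_{\Lambda_1}(A)$ for boxes $\Lambda_1\subset\Lambda_2$ and $A\in\mathcal{F}_{\Lambda_1}$, and $\mu_{\Lambda+z}(A+z)=\mu_\Lambda(A)$ for $\Lambda\in\mathbb{B}$, $z\in\mathbb{Z}^d$, $A\in\mathcal{F}_\Lambda$. One writes $\mathbb{P}(A)=\mu_\Lambda(A)$ for $A\in\mathcal{F}_\Lambda$ (independent of $\Lambda$), and likewise $\mathbb{P}(A|\mathcal{G})=\mu_\Lambda(A|\mathcal{G})$ for a sub-$\sigma$-algebra $\mathcal{G}\subset\mathcal{F}_\Lambda$; inequalities between conditional probabilities hold a.s. For $E\subset X^{\mathbb{Z}^d}$, the system is carried by $E$ if for all $\Lambda\in\mathbb{B}$ and $A,B\in\mathcal{F}_\Lambda$, $A\cap E=B\cap E$ implies $\mu_\Lambda(A)=\mu_\Lambda(B)$. The Cramér sequence is $\mu_n=\mu_{\Lambda(n)}\circ(\mathfrak{m}_{\Lambda(n)})^{-1}$, a probability on $(X,\mathcal{F})$. **A.d.i.** There exist $g,c:\mathbb{N}^*\to[0,+\infty[$ with $g(m)/m\to0$ and $c(m)/|\Lambda(m)|\to0$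 such that for all $m\ge1$, all finite $S\subset\mathbb{Z}^d$, all $A\in\mathcal{F}_{\Lambda(m)}$, $B\in\mathcal{F}_S$: $\mathrm{dist}(S,\Lambda(m))>g(m)$ implies $\mathbb{P}(A\cap B)\ge e^{-c(m)}\mathbb{P}(A)\mathbb{P}(B)$. Here dist is the $|\cdot|_\infty$ distance on $\mathbb{Z}^d$. **C.l.** There exist $t,\alpha:\mathcal{C}_0(\mathcal{F})\to]0,+\infty[$ such that for all $C\in\mathcal{C}_0(\mathcal{F})$ and $\Lambda\in\mathbb{B}$, $\mathbb{P}(\sigma(0)\in t(C)\cdot C\,|\,\mathcal{F}_{\Lambda\setminus\{0\}})\ge\alpha(C)$. **C.t.l. on $D$.** For every $\gamma>0$ there is $K(\gamma)\in\mathcal{F}$ such that $K(\gamma)\cap D$ is convex and relatively compact and, for every box $\Lambda\ni0$, $\mathbb{P}(\sigma(0)\in K(\gamma)\,|\,\mathcal{F}_{\Lambda\setminus\{0\}})\ge1-\gamma$. (For systems on $X_i^{\mathbb{Z}^d}$, these three notions are understood with $X_i,\mathcal{F}_i,\tau_i$, and $f_i(D)$ in place of $D$.) **Entropy, pressure, weak LDP.** $s(x)=\inf_{C\in\mathcal{C}_x}\liminf_{n\to\infty}\frac1{|\Lambda(n)|}\log\mu_n(C)$; $p(\lambda)=\limsup_{n\to\infty}\frac1{|\Lambda(n)|}\log\int e^{|\Lambda(n)|\langle\lambda|x\rangle}d\mu_n(x)$ for $\lambda\in X^*$. By construction $\liminf_n\frac1{|\Lambda(n)|}\log\mu_n(A)\ge\sup_{\mathrm{int}A}s$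 for all $A\in\mathcal{F}$. $(\mu_n)$ satisfies a weak large deviations principle if $\limsup_n\frac1{|\Lambda(n)|}\log\mu_n(K)\le\sup_{\overline K}s$ for every relatively compact $K\in\mathcal{F}$. $\mu_n|_D$ is the trace of $\mu_n$ on $D$ (with the trace $\sigma$-algebra and induced topology): $\mu_n|_D(A\cap D)=\mu_n(A)$ for $A\in\mathcal{F}$; its entropy and weak LDP are defined by the same formulas inside $D$ (neighbourhoods $C\cap D$ with $C\in\mathcal{C}_x$, $x\in D$; closures and relative compactness in $D$). Conventions: $\log0=-\infty$, $\sup\emptyset=-\infty$; relatively compact means having compact closure. *)

(* Defs.v *)
From HB Require Import structures.
From mathcomp Require Import all_boot all_order all_algebra.
From mathcomp Require Import finmap.
From mathcomp Require Import all_classical all_reals all_analysis.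

Set Implicit Arguments.
Unset Strict Implicit.
Unset Printing Implicit Defensive.

Import Order.TTheory GRing.Theory Num.Theory numFieldNormedType.Exports.

Local Open Scope classical_set_scope.
Local Open Scope ring_scope.

(* A locally convex space with a sigma-algebra F, written [sigalg]; no
   compatibility between the two is built in (see [is_evlcm]). *)
HB.mixin Record hasSigmaAlgebra (R : realType) X & Tvs R X := {
  sigalg : set (set X) ;
  sigalgP : sigma_algebra [set: X] sigalg }.

#[short(type="measTvsType")]
HB.structure Definition MeasTvs (R : realType) :=
  {X of Tvs R X & hasSigmaAlgebra R X}.

Arguments sigalg {R s}.

(* The measurable space (X, F). An alias is needed because a measurableType is
   pointed, and the hierarchy has no join of pointed types and tvs. *)
Definition mspace {R : realType} (X : measTvsType R) : Type := X.

Section mspace_instance.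
Context {R : realType} (X : measTvsType R).

HB.instance Definition _ := Choice.on (mspace X).
HB.instance Definition _ := isPointed.Build (mspace X) (0 : X).

Let sigalg0 : sigalg (set0 : set X).
Proof. by case: (@sigalgP R X). Qed.

Let sigalgC (A : set X) : sigalg A -> sigalg (~` A).
Proof. by case: (@sigalgP R X) => _ + _; rewrite -setTD; exact. Qed.

Let sigalg_bigcup (A : (set X)^nat) :
  (forall k, sigalg (A k)) -> sigalg (\bigcup_k A k).
Proof. by case: (@sigalgP R X) => _ _; exact. Qed.

HB.instance Definition _ :=
  @isMeasurable.Build (sigma_display (@sigalg R X)) (mspace X)
    (@sigalg R X) sigalg0 sigalgC sigalg_bigcup.

End mspace_instance.

Section internal_convex_sets.
Context {R : realType} {X : lmodType R}.
Implicit Types (C : set X) (x : X).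

Definition dilate (t : R) C : set X := [set t *: y | y in C].

Definition translate x C : set X := [set x + y | y in C].

(* Valued in [0, +oo]: the infimum of the empty set is +oo. *)
Definition gauge C x : \bar R :=
  ereal_inf [set t%:E | t in [set t : R | 0 <= t /\ dilate t C x]].

Definition internal C : Prop :=
  [/\ convex_set C,
      forall x, (gauge C x < +oo)%E &
      C = [set x | (gauge C x < 1)%E]].

Definition symmetric_set C : Prop := forall x, C x -> C (- x).

Definition neighborhoods (C0 : set (set X)) x : set (set X) :=
  [set translate x C | C in C0].

End internal_convex_sets.

Section evlcm.
Context {R : realType}.

Definition dil_trans_stable (X : measTvsType R) : Prop :=
  (forall (t : R) (A : set X), t != 0 -> sigalg A ->
     sigalg (dilate t A)) /\
  (forall (x : X) (A : set X), sigalg A -> sigalg (translate x A)).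

Definition meas_internal (X : measTvsType R) : set (set X) :=
  [set C | sigalg C /\ internal C].

(* As the topology of a tvsType is translation invariant, [evlcm_nbhs0]
   determines it. The Hausdorff property follows from [evlcm_sep]. *)
Record is_evlcm (X : measTvsType R) (C0 : set (set X)) : Prop := {
  evlcm_stable : dil_trans_stable X ;
  evlcm_sub : C0 `<=` @meas_internal X ;
  evlcm_sym : forall C, C0 C -> symmetric_set C ;
  evlcm_cap : forall C C', C0 C -> C0 C' -> C0 (C `&` C') ;
  evlcm_dil : forall (t : R) C, t != 0 -> C0 C -> C0 (dilate t C) ;
  evlcm_sep : \bigcap_(C in C0) C = [set 0] ;
  evlcm_nbhs0 : forall A : set X,
    nbhs (0 : X) A <-> exists2 C, C0 C & C `<=` A ;
  evlcm_dual : forall l : {scalar X},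
    continuous (l : X -> R) ->
    measurable_fun [set: mspace X] (l : mspace X -> R) }.

End evlcm.

Section projective_systems.
Context {R : realType} {dJ : Order.disp_t} {J : preorderType dJ}.
Context {X : measTvsType R}.
Context {Xi : J -> measTvsType R}.

(* [fij i j] is the map f_ij : X_j -> X_i; it is constrained (and used) only
   for i <= j. *)
Record is_proj_system (C0i : forall i, set (set (Xi i)))
    (f : forall i, {linear X -> Xi i})
    (fij : forall i j, {linear Xi j -> Xi i}) : Prop := {
  ps_inhabited : exists i : J, True ;
  ps_directed : forall i j : J, exists k : J, (i <= k)%O /\ (j <= k)%O ;
  ps_evlcm : forall i, is_evlcm (C0i i) ;
  ps_stable : dil_trans_stable X ;
  ps_meas : forall i,
    measurable_fun [set: mspace X] (f i : mspace X -> mspace (Xi i)) ;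
  ps_continuous_ij : forall i j, (i <= j)%O -> continuous (fij i j) ;
  ps_meas_ij : forall i j, (i <= j)%O ->
    measurable_fun [set: mspace (Xi j)]
      (fij i j : mspace (Xi j) -> mspace (Xi i)) ;
  ps_id : forall i (x : Xi i), fij i i x = x ;
  ps_comp : forall i j, (i <= j)%O -> forall x : X, f i x = fij i j (f j x) ;
  ps_comp_ij : forall i j k, (i <= j)%O -> (j <= k)%O ->
    forall x : Xi k, fij i k x = fij i j (fij j k x) }.

Definition limit_C0 (f : forall i, {linear X -> Xi i}) : set (set X) :=
  [set A | exists i (C : set (Xi i)),
     [/\ meas_internal C, symmetric_set C, open C & A = f i @^-1` C]].

(* [limit_C0 f] is stable under finite intersections and under dilations, so
   the topology it generates has it as a base of neighbourhoods of 0. *)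
Record is_proj_limit (f : forall i, {linear X -> Xi i}) : Prop := {
  pl_sep : \bigcap_(C in limit_C0 f) C = [set 0] ;
  pl_nbhs0 : forall A : set X,
    nbhs (0 : X) A <-> exists2 C, limit_C0 f C & C `<=` A }.

End projective_systems.

Section lattice.
Context {d : nat}.
Local Notation Zd := 'rV[int]_d.

(* For d >= 1, [cube 0] is empty. *)
Definition cube (n : nat) : set Zd :=
  [set z | forall k, 0 <= z 0 k < n%:Z].

Definition shift_set (a : Zd) (S : set Zd) : set Zd := [set z + a | z in S].

Definition box : set (set Zd) :=
  [set L | exists a n, (0 < n)%N /\ L = shift_set a (cube n)].

Definition vol {R : realType} (S : set Zd) : R := (#|` fset_set S|)%:R.

Definition linf_norm (z : Zd) : nat := \max_(k < d) `|z 0%R k|%N.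

(* The distance to the empty set is +oo. *)
Definition linf_dist {R : realType} (S T : set Zd) : \bar R :=
  ereal_inf [set ((linf_norm (z - y))%:R : R)%:E | z in S & y in T].

End lattice.

Section configurations.
Context {R : realType} {d : nat}.
Local Notation Zd := 'rV[int]_d.

Definition mean {X : lmodType R} (L : set Zd) (w : Zd -> X) : X :=
  (vol L : R)^-1 *: (\sum_(z \in L) w z).

(* The sigma-algebra F_S is [mean_alg X S] (generated by the means over the
   boxes included in S), and [confS X S] is X^(Z^d) equipped with F_S. *)
Definition mean_gen (X : measTvsType R) (S : set Zd) :
    set (set (Zd -> mspace X)) :=
  [set A | exists L (B : set X),
     [/\ box L, L `<=` S, sigalg B & A = mean L @^-1` B]].

Definition mean_alg (X : measTvsType R) (S : set Zd) :
    set (set (Zd -> mspace X)) :=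
  <<s @mean_gen X S >>.

Definition confS (X : measTvsType R) (S : set Zd) :=
  g_sigma_algebraType (@mean_gen X S).

Definition shift_conf {X : Type} (z : Zd) (A : set (Zd -> X)) : set (Zd -> X) :=
  [set (fun y => w (y - z)) | w in A].

Definition conf_map {X E : Type} (f : X -> E) (w : Zd -> X) : Zd -> E :=
  fun z => f (w z).

End configurations.

(* Systems are indexed by all sets of sites, but only their values at boxes
   are ever constrained or used. *)
Section systems.
Context {R : realType} {X : measTvsType R} {d : nat}.
Local Notation Zd := 'rV[int]_d.

Record is_scit (mu : forall L : set Zd, probability (confS X L) R) : Prop := {
  scit_compat : forall (L1 L2 : set Zd) (A : set (Zd -> X)),
    box L1 -> box L2 -> L1 `<=` L2 -> mean_alg L1 A -> mu L2 A = mu L1 A ;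
  scit_shift : forall (L : set Zd) (z : Zd) (A : set (Zd -> X)),
    box L -> mean_alg L A -> mu (shift_set z L) (shift_conf z A) = mu L A }.

Implicit Type nu : forall L : set Zd, set (confS X L) -> \bar R.

Definition carried nu (E : set (Zd -> X)) : Prop :=
  forall (L : set Zd) (A B : set (Zd -> X)), box L ->
    mean_alg L A -> mean_alg L B -> A `&` E = B `&` E -> nu L A = nu L B.

(* Asymptotic decoupling from below; P is read off on any box L containing
   both S and the cube, which is harmless by compatibility. *)
Definition adi nu : Prop :=
  exists g c : nat -> R,
  [/\ forall m, (0 < m)%N -> 0 <= g m /\ 0 <= c m,
      (g m / m%:R) @[m --> \oo] --> (0 : R),
      (c m / vol (cube m : set Zd)) @[m --> \oo] --> (0 : R) &
      forall (m : nat) (S : set Zd) (A B : set (Zd -> X)),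
        (0 < m)%N -> finite_set S ->
        mean_alg (cube m) A -> mean_alg S B ->
        ((g m)%:E < linf_dist S (cube m))%E ->
        forall L, box L -> cube m `<=` L -> S `<=` L ->
        ((expR (- c m))%:E * nu L A * nu L B <= nu L (A `&` B))%E].

(* Y is a version of the conditional probability of A given F_S under nu_L,
   where F_S is contained in F_L. *)
Definition is_cond_prob nu (L S : set Zd) (A : set (Zd -> X))
    (Y : (Zd -> X) -> R) : Prop :=
  [/\ measurable_fun [set: confS X S] (Y : confS X S -> R),
      (nu L).-integrable [set: confS X L] (EFin \o Y) &
      forall B : set (Zd -> X), mean_alg S B ->
        (\int[nu L]_(w in (B : set (confS X L))) (Y w)%:E = nu L (A `&` B))%E].

(* P(A | F_S) >= a almost surely *)
Definition cond_prob_ge nu (S : set Zd) (A : set (Zd -> X)) (a : R) : Prop :=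
  forall L, box L -> S `<=` L -> mean_alg L A ->
  exists2 Y, is_cond_prob nu L S A Y & \forall w \ae nu L, a <= Y w.

(* local control *)
Definition cl nu : Prop :=
  exists t alpha : set X -> R, forall C : set X, meas_internal C ->
  [/\ 0 < t C, 0 < alpha C &
      forall L : set Zd, box L ->
        cond_prob_ge nu (L `\ 0) [set w | dilate (t C) C (w 0)] (alpha C)].

(* local convex tightness on D *)
Definition ctl nu (D : set X) : Prop :=
  forall gamma : R, 0 < gamma ->
  exists K : set X,
  [/\ sigalg K, convex_set (K `&` D), compact (closure (K `&` D)) &
      forall L : set Zd, box L -> L 0 ->
        cond_prob_ge nu (L `\ 0) [set w | K (w 0)] (1 - gamma)].

Definition cramer nu (n : nat) : set (mspace X) -> \bar R :=
  pushforward (nu (cube n)) (mean (cube n) : confS X (cube n) -> mspace X).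

Definition log_laplace nu (l : X -> R) (n : nat) : \bar R :=
  let v : R := vol (cube n : set Zd) in
  ((v^-1)%:E * lne (\int[cramer nu n]_x (expR (v * l x))%:E))%E.

Definition pressure nu (l : X -> R) : \bar R := limn_esup (log_laplace nu l).

End systems.

Definition push_system {R : realType}
    {X : measTvsType R} {E : measTvsType R} {d : nat} (f : X -> E)
    (nu : forall L : set 'rV[int]_d, set (confS X L) -> \bar R)
    (L : set 'rV[int]_d) : set (confS E L) -> \bar R :=
  pushforward (nu L) (conf_map f : confS X L -> confS E L).

Section large_deviations.
Context {R : realType} (d : nat).

Definition log_rate {T : Type} (nu : nat -> set T -> \bar R) (A : set T)
    (n : nat) : \bar R :=
  (((vol (cube n : set 'rV[int]_d))^-1)%:E * lne (nu n A))%E.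

(* N x is the family of neighbourhoods of x over which the infimum is taken. *)
Definition entropy {T : Type} (N : T -> set (set T))
    (nu : nat -> set T -> \bar R) (x : T) : \bar R :=
  ereal_inf [set limn_einf (log_rate nu C) | C in N x].

Definition weak_ldp {T : topologicalType} (F : set (set T))
    (N : T -> set (set T)) (nu : nat -> set T -> \bar R) : Prop :=
  forall K : set T, F K -> compact (closure K) ->
    (limn_esup (log_rate nu K)
       <= ereal_sup [set entropy N nu x | x in closure K])%E.

End large_deviations.

(* Objects on the subset D, seen as the type [set_type D] with its induced
   topology. *)
Section trace.
Context {R : realType} {X : measTvsType R}.
Variable D : set X.

Definition trace_alg : set (set D) :=
  [set (set_val : D -> X) @^-1` A | A in (sigalg : set (set X))].

Definition trace_neighborhoods (N : X -> set (set X)) (x : D) : set (set D) :=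
  [set (set_val : D -> X) @^-1` A | A in N (set_val x)].

(* The infimum only selects the common value of nu A over the A in F
   with the given trace on D: see [trace_measE]. *)
Definition trace_meas (nu : set X -> \bar R) (B : set D) : \bar R :=
  ereal_inf [set nu A | A in
    [set A : set X | sigalg A /\ (set_val : D -> X) @^-1` A = B]].

Lemma trace_measE (nu : set X -> \bar R) :
  (forall A B, sigalg A -> sigalg B -> A `&` D = B `&` D ->
     nu A = nu B) ->
  forall A, sigalg A -> trace_meas nu ((set_val : D -> X) @^-1` A) = nu A.
Proof.
move=> nuD A mA; rewrite /trace_meas.
suff -> : [set nu B | B in [set B | sigalg B /\
    (set_val : D -> X) @^-1` B = (set_val : D -> X) @^-1` A]] = [set nu A].
  by rewrite ereal_inf1.
apply/seteqP; split => [_ [B [mB BA] <-]|_ ->]; last by exists A.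
apply: nuD => //; apply/seteqP; split => x [xA Dx]; split => //.
- have : ((set_val : D -> X) @^-1` B) (exist _ x (mem_set Dx)) by [].
  by rewrite BA.
- have : ((set_val : D -> X) @^-1` A) (exist _ x (mem_set Dx)) by [].
  by rewrite -BA.
Qed.

End trace.

Arguments trace_alg {R X} D.
Arguments trace_neighborhoods {R X} D N x.
Arguments trace_meas {R X} D nu B.

(* Main.v *)
From HB Require Import structures.
Require Import Defs.
From mathcomp Require Import all_boot all_order all_algebra.
From mathcomp Require Import finmap ring lra zify.
From mathcomp Require Import all_classical all_reals all_analysis.
From mathcomp Require Import measurable_realfun.

Set Implicit Arguments.
Unset Strict Implicit.
Unset Printing Implicit Defensive.

Import Order.TTheory GRing.Theory Num.Theory numFieldNormedType.Exports.

Local Open Scope classical_set_scope.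
Local Open Scope ring_scope.

(** The theorem is first proved on one space, then carried to the limit along
    the maps f_i.

    On one space everything rests on an almost supermultiplicativity of the
    Cramer sequence. Pave a large cube by translates of a cube of side m, at
    distances for which decoupling applies. The means over the tiles then behave,
    up to a factor exp (- c m) per tile, like independent variables with the law
    of the mean over the small cube, while each of the few sites left out falls
    with conditional probability bounded below in a fixed convex set, by local
    control. As the mean over the large cube is a barycentre of all these, it
    falls in a prescribed convex neighbourhood with a probability that is almost
    a product (paving_event_bound). The same holds with the exponential of a
    linear form in place of the indicators, by expanding a product of simple
    functions over its level sets (supermult_simple), and with two kinds of tiles
    in prescribed proportions (supermult_asym).

    It follows that the upper rate of a half neighbourhood is at most the lower
    rate of the whole one (limsup_half_le_liminf), that the entropy s is concave
    (entropy_concave), and that the limit p exists (pressure_cvg). The inequality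
    s + l <= p l is Chebyshev's, and the upper bound on compact sets follows from
    a finite covering (compact_rate_bound).

    Duality needs the converse: if s + l <= b everywhere then p l <= b
    (pressure_le_entropy). The covering argument only bounds exponential
    integrals over compact sets. Local tightness, used at one scale, confines
    almost all of the integral to a compact convex set, and supermultiplicativity
    propagates this to all large enough scales. If s x0 < a, the sandwich theorem
    convex_gauge_minorant gives a linear form l with s + l <= a + l x0, whence
    p l - l x0 <= a (exists_dual_form).

    On the projective limit, s x is the infimum over i of the entropies at f_i x
    of the image systems (limit_entropy_le, limit_entropy_lt), and each
    continuous linear form factors through some f_i, with the same pressure
    (dual_factor, pressure_factor). Both inequalities between s and p thus come
    from a single X_i. Compactness is only available in X, and the covering argument takes
    place there, with neighbourhoods coming from the X_i. *)
(** * Separation of convex sets *)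

Section hahn_banach.
Context {R : realType} {E : lmodType R}.
Implicit Types (p q : E -> R) (x y : E).

Definition sublinear p : Prop :=
  (forall x y, p (x + y) <= p x + p y) /\
  (forall (a : R) x, 0 < a -> p (a *: x) <= a * p x).

Lemma sublinear_homog p (a : R) x : sublinear p -> 0 < a ->
  p (a *: x) = a * p x.
Proof.
move=> [_ hp] a0; apply/eqP; rewrite eq_le hp//=.
have := hp a^-1 (a *: x); rewrite invr_gt0 a0 scalerA mulVf ?gt_eqF// scale1r.
by move=> /(_ isT); rewrite mulrC ler_pdivlMr// mulrC.
Qed.

Lemma sublinear0 p : sublinear p -> p 0 = 0.
Proof.
move=> /[dup] sp /(@sublinear_homog p 2 0); rewrite scaler0 ltr0n => /(_ isT).
by move=> ?; lra.
Qed.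

Lemma sublinear_oppr p x : sublinear p -> - p (- x) <= p x.
Proof.
move=> /[dup] sp [/(_ x (- x)) + _]; rewrite subrr (sublinear0 sp).
by move=> ?; lra.
Qed.

(** If p is minimal, then for each y the functional
    x |-> inf over t >= 0 of p (x + t y) - t p y, which is sublinear and at
    most p, must be p: hence p (x + y) - p y >= p x, and p is additive. *)
Lemma minimal_sublinear_additive p : sublinear p ->
  (forall q, sublinear q -> (forall x, q x <= p x) -> q = p) ->
  forall x y, p (x + y) = p x + p y.
Proof.
move=> sp pmin x y; apply/eqP; rewrite eq_le sp.1/=.
pose S x' := [set p (x' + t *: y) - t * p y | t in [set t : R | 0 <= t]].
have S0 x' : S x' !=set0 by exists (p (x' + 0 *: y) - 0 * p y); exists 0 => /=.
have Slb x' : lbound (S x') (- p (- x')).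
  move=> _ [t /= t0 <-].
  have -> : t * p y = p (t *: y).
    move: t0; rewrite le_eqVlt => /predU1P[<-|t0].
      by rewrite mul0r scale0r sublinear0.
    by rewrite sublinear_homog.
  by have := sp.1 (x' + t *: y) (- x'); rewrite addrAC subrr add0r; lra.
have hS x' : has_lbound (S x') by exists (- p (- x')); exact: Slb.
pose q x' := inf (S x').
have qle x' (t : R) : 0 <= t -> q x' <= p (x' + t *: y) - t * p y.
  by move=> t0; apply: ge_inf => //; exists t.
have qp : q = p.
  apply: pmin; last first.
    by move=> x'; have := qle x' 0 (lexx _); rewrite scale0r mul0r addr0 subr0.
  split.
    move=> x1 x2; rewrite -lerBlDr; apply: lb_le_inf => // _ [t /= t0 <-].
    rewrite lerBlDr -lerBlDl; apply: lb_le_inf => // _ [s /= s0 <-].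
    rewrite lerBlDl; apply: (le_trans (qle _ (t + s) (addr_ge0 t0 s0))).
    have := sp.1 (x1 + t *: y) (x2 + s *: y).
    by rewrite addrACA -scalerDl mulrDl; lra.
  move=> a x' a0; rewrite mulrC -ler_pdivrMr//.
  apply: lb_le_inf => // _ [t /= t0 <-]; rewrite ler_pdivrMr//.
  apply: (le_trans (qle _ (a * t) _)); first by rewrite mulr_ge0// ltW.
  by rewrite -scalerA -scalerDr sublinear_homog//; lra.
have := qle x 1 ler01; rewrite qp scale1r mul1r; lra.
Qed.

(** Zorn's lemma on the sublinear functionals below p: the infimum of a chain
    is bounded below by - p (- x). *)
Lemma exists_minimal_sublinear p : sublinear p ->
  exists q, [/\ sublinear q, forall x, q x <= p x &
    forall r, sublinear r -> (forall x, r x <= q x) -> r = q].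
Proof.
move=> sp; pose T := {q : E -> R | sublinear q /\ forall x, q x <= p x}.
pose le (q r : T) := `[< forall x, sval r x <= sval q x >].
have [//|r s t|||[q [sq qp]] qmin] := @Zorn T le.
- by move=> t; apply/asboolP => x.
- move=> /asboolP rs /asboolP st; apply/asboolP => x.
  exact: le_trans (st x) (rs x).
- move=> [q ?] [r ?] /asboolP /= qr /asboolP /= rq.
  by apply: eq_exist; apply/funext => x; apply/eqP; rewrite eq_le qr rq.
- move=> A Atot; have [->|/set0P[q0 Aq0]] := eqVneq A set0.
    by exists (exist _ p (conj sp (fun=> lexx _))).
  pose S x := [set sval q x | q in A].
  have S0 x : S x !=set0 by exists (sval q0 x), q0.
  have hS x : has_lbound (S x).
    exists (- p (- x)) => _ [[q [sq qp]] _ <-] /=.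
    by apply: le_trans (sublinear_oppr x sq); rewrite lerN2.
  pose q x := inf (S x).
  have qle x r : A r -> q x <= sval r x.
    by move=> Ar; apply: ge_inf => //; exists r.
  have sq : sublinear q.
    split=> [x y|a x a0].
      rewrite -lerBlDr; apply: lb_le_inf => // _ [r Ar <-].
      rewrite lerBlDr -lerBlDl; apply: lb_le_inf => // _ [s As <-].
      rewrite lerBlDl; have [/asboolP rs|/asboolP sr] := Atot _ _ Ar As.
        apply: (le_trans (qle _ _ As)).
        by apply: (le_trans ((proj2_sig s).1.1 x y)); rewrite lerD2r.
      apply: (le_trans (qle _ _ Ar)).
      by apply: (le_trans ((proj2_sig r).1.1 x y)); rewrite lerD2l.
    rewrite mulrC -ler_pdivrMr//; apply: lb_le_inf => // _ [r Ar <-].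
    rewrite ler_pdivrMr// mulrC; apply: (le_trans (qle _ _ Ar)).
    exact: (proj2_sig r).1.2.
  have qp x : q x <= p x := le_trans (qle x q0 Aq0) ((proj2_sig q0).2 x).
  by exists (exist _ q (conj sq qp)) => r Ar; apply/asboolP => x /=; exact: qle.
exists q; split => // r sr rq.
have rp x : r x <= p x by exact: le_trans (rq x) (qp x).
have := qmin (exist _ r (conj sr rp)); rewrite /le => h.
by have /(congr1 sval) := h (asboolT rq).
Qed.

Lemma hahn_banach p : sublinear p -> exists l : {scalar E}, forall x, l x <= p x.
Proof.
move=> /exists_minimal_sublinear[q [sq qp qmin]].
have qD := minimal_sublinear_additive sq qmin.
have q0 := sublinear0 sq.
have qN x : q (- x) = - q x.
  by apply/eqP; rewrite -addr_eq0 -qD addNr q0.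
have qZ (a : R) x : q (a *: x) = a * q x.
  have [a0|a0|<-] := ltgtP 0 a; first exact: sublinear_homog.
    rewrite -[a]opprK scaleNr qN sublinear_homog ?oppr_gt0//; lra.
  by rewrite scale0r q0 mul0r.
have lq : linear_for ( *%R ) q by move=> a x y; rewrite qD qZ.
pose M := GRing.isLinear.Build R E R ( *%R ) q lq.
pose l : {scalar E} := HB.pack q M.
by exists l => x; exact: qp.
Qed.

Lemma convex_set_comb (A : set E) : convex_set A ->
  forall x y (s t : R), 0 <= s -> 0 <= t -> s + t = 1 -> A x -> A y ->
  A (s *: x + t *: y).
Proof.
move=> cA x y s t s0 t0 st1 Ax Ay.
have s1 : s <= 1 by rewrite -st1 lerDl.
have := cA x y (Itv01 s0 s1) (mem_set Ax) (mem_set Ay).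
rewrite inE /conv/= /unstable.onem.
by have -> : t = 1 - s by rewrite -st1 addrC addKr.
Qed.

(** Sandwich theorem: the functional
    p x = inf {s b + t r | x = s z + r c, s >= 0, r > 0, (z, b) in G, c in C}
    is finite, sublinear, below G and at most t on C, and any linear form below
    p will do. The convex function to be minorized is given by a convex set G of
    pairs (z, b), read as the points above its graph, so that it may be
    infinite. *)
Lemma convex_gauge_minorant (C : set E) (G : set (E * R)) (t : R) :
  convex_set C -> symmetric_set C ->
  (forall x, exists2 r : R, 0 < r & C (r^-1 *: x)) -> 0 <= t ->
  (forall z b z' b' (s u : R), 0 <= s -> 0 <= u -> s + u = 1 ->
     G (z, b) -> G (z', b') -> G (s *: z + u *: z', s * b + u * b')) ->
  (forall z b r, G (z, b) -> 0 < r -> C (r^-1 *: z) -> 0 <= b + t * r) ->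
  exists l : {scalar E}, (forall x, C x -> l x <= t) /\
    forall z b, G (z, b) -> l z <= b.
Proof.
move=> /convex_set_comb cC symC absC t0 cG hG.
pose S x := [set v : R | exists s z b r c, [/\ 0 <= s, 0 < r, C c,
  0 < s -> G (z, b) & x = s *: z + r *: c /\ v = s * b + t * r]].
have SD x y v w : S x v -> S y w -> S (x + y) (v + w).
  move=> [s [z [b [r [c [s0 r0 Cc Gz [-> ->]]]]]]].
  move=> [s' [z' [b' [r' [c' [s0' r0' Cc' Gz' [-> ->]]]]]]].
  have rr : 0 < r + r' by rewrite addr_gt0.
  have Cc'' : C ((r / (r + r')) *: c + (r' / (r + r')) *: c').
    by apply: cC; rewrite ?divr_ge0 ?ltW// -mulrDl divff// gt_eqF.
  have rE : r *: c + r' *: c' =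
      (r + r') *: ((r / (r + r')) *: c + (r' / (r + r')) *: c').
    rewrite scalerDr !scalerA ![(r + r') * _]mulrC.
    by rewrite !divfK ?gt_eqF.
  have [ss|ss] := ltP 0 (s + s'); last first.
    have /eqP : s + s' = 0 by apply/eqP; rewrite eq_le ss addr_ge0.
    rewrite paddr_eq0// => /andP[/eqP -> /eqP ->].
    exists 0, 0, 0, (r + r'), ((r / (r + r')) *: c + (r' / (r + r')) *: c').
    split => //; first by rewrite ltxx.
    by split; [rewrite !scale0r !add0r|ring].
  exists (s + s'), ((s / (s + s')) *: z + (s' / (s + s')) *: z'),
    ((s / (s + s')) * b + (s' / (s + s')) * b'), (r + r'),
    ((r / (r + r')) *: c + (r' / (r + r')) *: c').
  split => //; first exact: ltW.
    move=> _; have [s_gt0|] := ltP 0 s; last first.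
      move=> ?; have s_eq0 : s = 0 by apply/eqP; rewrite eq_le s0 andbT.
      rewrite s_eq0 add0r in ss *.
      by rewrite !mul0r scale0r divff ?gt_eqF// scale1r mul1r !add0r; exact: Gz'.
    have [s_gt0'|] := ltP 0 s'; last first.
      move=> ?; have s_eq0 : s' = 0 by apply/eqP; rewrite eq_le s0' andbT.
      rewrite s_eq0 addr0 in ss *.
      by rewrite !mul0r scale0r divff ?gt_eqF// scale1r mul1r !addr0; exact: Gz.
    apply: cG; rewrite ?divr_ge0 ?(ltW ss)//; last 2 first.
      exact: Gz.
      exact: Gz'.
    by rewrite -mulrDl divff ?gt_eqF.
  split; last by field; rewrite gt_eqF.
  rewrite addrACA rE; congr (_ + _).
  by rewrite scalerDr !scalerA ![(s + s') * _]mulrC !divfK ?gt_eqF.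
have SZ x v a : 0 < a -> S x v -> S (a *: x) (a * v).
  move=> a0 [s [z [b [r [c [s0 r0 Cc Gz [-> ->]]]]]]].
  exists (a * s), z, b, (a * r), c; split => //.
  - by rewrite mulr_ge0// ltW.
  - by rewrite mulr_gt0.
  - by move=> ?; apply: Gz; rewrite -(pmulr_rgt0 _ a0).
  - by split; [rewrite scalerDr !scalerA|ring].
have S0 v : S 0 v -> 0 <= v.
  move=> [s [z [b [r [c [s0 r0 Cc Gz [zc ->]]]]]]].
  move: s0; rewrite le_eqVlt => /predU1P[s0|s0].
    by rewrite -s0 mul0r add0r mulr_ge0// ltW.
  have zE : (r / s)^-1 *: z = - c.
    apply: (@scalerI _ _ r); first by rewrite gt_eqF.
    rewrite scalerA invf_div mulrC divfK ?gt_eqF//.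
    by rewrite scalerN; apply/eqP; rewrite -addr_eq0 -zc.
  have : 0 <= b + t * (r / s).
    apply: (hG z b _ (Gz s0)); first exact: divr_gt0.
    by rewrite zE; exact: symC.
  rewrite -(pmulr_rge0 _ s0) mulrDr => /le_trans; apply.
  by have -> : s * (t * (r / s)) = t * r by field; rewrite gt_eqF.
have Sne x : S x !=set0.
  have [r r0 Cr] := absC x; exists (t * r), 0, 0, 0, r, (r^-1 *: x).
  split => //; first by rewrite ltxx.
  by rewrite scale0r add0r scalerA divff ?gt_eqF// scale1r mul0r add0r.
have Slb x : has_lbound (S x).
  have [w Sw] := Sne (- x); exists (- w) => v Sv.
  by have := SD _ _ _ _ Sv Sw; rewrite subrr => /S0; lra.
pose p x := inf (S x).
have pS x v : S x v -> p x <= v by move=> ?; exact: ge_inf.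
have sp : sublinear p.
  split=> [x y|a x a0].
    rewrite -lerBlDr; apply: lb_le_inf => // v Sv.
    rewrite lerBlDr -lerBlDl; apply: lb_le_inf => // w Sw.
    by rewrite lerBlDl; apply: pS; exact: SD.
  rewrite mulrC -ler_pdivrMr//; apply: lb_le_inf => // v Sv.
  by rewrite ler_pdivrMr// mulrC; apply: pS; exact: SZ.
have [l lp] := hahn_banach sp; exists l; split => [x Cx|z b Gzb].
  apply: le_trans (lp x) _; apply: pS; exists 0, 0, 0, 1, x.
  split => //; first by rewrite ltxx.
  by rewrite scale0r scale1r mul0r mulr1 !add0r.
have C0 : C 0 by have [r _] := absC 0; rewrite scaler0.
apply: le_trans (lp z) _; apply/ler_addgt0Pr => e e0.
apply: (@le_trans _ _ (b + t * (e / (t + 1)))); last first.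
  rewrite lerD2l mulrA ler_pdivrMr ?ltr_wpDl//; nra.
apply: pS; exists 1, z, b, (e / (t + 1)), 0; split => //.
  by rewrite divr_gt0// ltr_wpDl.
by rewrite scale1r mul1r scaler0 addr0.
Qed.

End hahn_banach.

(** * Boxes of the lattice *)

Section finite_sums.

Lemma vol_sum {R : realType} {d : nat} (S : set 'rV[int]_d) : finite_set S ->
  vol S = \sum_(z \in S) (1 : R).
Proof.
by move=> fS; rewrite fsbig_finite//= big_const_seq count_predT iter_addr_0.
Qed.

Lemma fsbig_disjoint_family {V : nmodType} {T : choiceType} {I : finType}
    (A : set T) (B : I -> set T) (F : T -> V) :
  finite_set A -> (forall i, B i `<=` A) ->
  (forall i j z, B i z -> B j z -> i = j) ->
  \sum_(z \in A) F z =
  \sum_(i : I) \sum_(z \in B i) F z +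
  \sum_(z \in A `\` \bigcup_i B i) F z.
Proof.
move=> fA BA Bdisj.
have cond (S : set T) : S `<=` A ->
    \sum_(z \in S) F z = \sum_(z <- fset_set A) if z \in S then F z else 0.
  move=> /setIidl SA; rewrite -{1}SA fsbig_mkcondl.
  by rewrite (fsbig_finite _ _ fA).
rewrite (cond (A `\` _)); last exact: subDsetl.
under [in RHS]eq_bigr => i _ do rewrite (cond _ (BA i)).
rewrite exchange_big/= -big_split/= fsbig_finite//.
rewrite big_seq [RHS]big_seq; apply: eq_bigr => z; rewrite in_fset_set// inE => Az.
have [[i _ Biz]|nB] := pselect ((\bigcup_i B i) z).
  rewrite (bigD1 i)//= mem_set// big1 => [|j ji].
    by rewrite memNset ?addr0// => -[_]; apply; exists i.
  by rewrite memNset// => Bjz; move: ji; rewrite (Bdisj _ _ _ Bjz Biz) eqxx.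
rewrite big1 => [|i _]; first by rewrite add0r mem_set.
by rewrite memNset// => Biz; apply: nB; exists i.
Qed.

End finite_sums.

Section boxes.
Context {d : nat}.
Local Notation Zd := 'rV[int]_d.

Lemma shift_setE (a : Zd) (S : set Zd) z : shift_set a S z <-> S (z - a).
Proof.
split=> [[y Sy <-]|Sza]; first by rewrite addrK.
by exists (z - a) => //; rewrite subrK.
Qed.

Lemma shift_setK (a : Zd) (S : set Zd) : shift_set (- a) (shift_set a S) = S.
Proof.
by apply/seteqP; split => z; rewrite !shift_setE opprK addrK.
Qed.

Lemma shift_setD1 (a z : Zd) (S : set Zd) :
  shift_set a (S `\ z) = shift_set a S `\ (z + a).
Proof.
apply/seteqP; split => y; rewrite shift_setE /setD /= shift_setE.
  by move=> [Sy yz]; split=> // ya; apply: yz; rewrite ya addrK.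
by move=> [Sy yz]; split=> // ya; apply: yz; rewrite -ya subrK.
Qed.

Lemma shift_set_sub (a : Zd) (S S' : set Zd) : S `<=` S' ->
  shift_set a S `<=` shift_set a S'.
Proof. exact: image_subset. Qed.

Lemma fsbig_shift {V : nmodType} (a : Zd) (S : set Zd) (F : Zd -> V) :
  \sum_(z \in shift_set a S) F z = \sum_(z \in S) F (z + a).
Proof. by rewrite fsbig_image// => x y _ _ /addIr. Qed.

Lemma finite_shift (a : Zd) (S : set Zd) : finite_set S ->
  finite_set (shift_set a S).
Proof. exact: finite_image. Qed.

Definition site (n : nat) (b : {ffun 'I_d -> 'I_n}) : Zd :=
  \row_j (b j : nat)%:Z.

Lemma site_inj n : injective (@site n).
Proof.
move=> b b' /rowP bb'; apply/ffunP => j; apply: val_inj.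
by have := bb' j; rewrite !mxE => -[].
Qed.

Lemma cubeE n : cube n = @site n @` setT.
Proof.
apply/seteqP; split => [z zn|_ [b _ <-] j]; last first.
  by rewrite mxE ltz_nat ltn_ord andbT.
have zj j : (`|z ord0 j|%N < n)%N.
  by have /andP[] := zn j; move: (z _ j) => x; lia.
exists [ffun j => Ordinal (zj j)] => //.
apply/rowP => j; rewrite mxE ffunE /=.
by rewrite gez0_abs//; have /andP[] := zn j.
Qed.

Lemma finite_cube n : finite_set (cube n : set Zd).
Proof. rewrite cubeE; apply: finite_image. exact: finite_finset. Qed.

Lemma vol_cube {R : realType} n : vol (cube n : set Zd) = (n ^ d)%:R :> R.
Proof.
rewrite vol_sum; last exact: finite_cube.
rewrite cubeE fsbig_image; last by move=> x y _ _ /site_inj.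
rewrite (fsbigTE [fset b in {ffun 'I_d -> 'I_n}]%fset) => [|b]; last by rewrite !inE.
rewrite big_const_seq count_predT iter_addr_0; congr (_%:R).
by rewrite card_finset card_ffun !card_ord.
Qed.

Lemma vol_shift {R : realType} (a : Zd) (S : set Zd) : finite_set S ->
  vol (shift_set a S) = vol S :> R.
Proof.
by move=> fS; rewrite !vol_sum//; [rewrite fsbig_shift|exact: finite_shift].
Qed.

Lemma box_shift (a : Zd) (L : set Zd) : box L -> box (shift_set a L).
Proof.
move=> [b [n [n0 ->]]]; exists (b + a), n; split => //.
by apply/seteqP; split => z; rewrite !shift_setE opprD addrA addrAC.
Qed.

Lemma box_cube n : (0 < n)%N -> box (cube n : set Zd).
Proof.
move=> n0; exists 0, n; split => //.
by apply/seteqP; split => z; rewrite shift_setE subr0.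
Qed.

Lemma box_finite (L : set Zd) : box L -> finite_set L.
Proof. by move=> [a [n [_ ->]]]; apply: finite_shift; exact: finite_cube. Qed.

Lemma cube1 : cube 1 = [set 0] :> set Zd.
Proof.
apply/seteqP; split => [z z1|_ -> j]; last by rewrite mxE.
apply/rowP => j; rewrite mxE; have /andP[] := z1 j.
by move: (z _ j) => x; lia.
Qed.

Lemma box_set1 (z : Zd) : box [set z].
Proof. by exists z, 1%N; split => //; rewrite cube1 /shift_set image_set1 add0r. Qed.

Section paving.
Variables m p k n : nat.
Hypotheses (mp : (m <= p)%N) (pkn : (p * k <= n)%N).

(** Cubes of side m placed on a lattice of mesh p; the interstice gathers the
    sites of the cube of side n that they leave out. *)
Definition tile (b : {ffun 'I_d -> 'I_k}) : set Zd :=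
  shift_set (site b *+ p) (cube m).

Definition interstice : set Zd := cube n `\` \bigcup_b tile b.

Lemma tile_coord b z j : tile b z ->
  (p * b j)%:Z <= z 0 j < (p * b j + m)%:Z.
Proof. rewrite /tile shift_setE => /(_ j); rewrite !mxE mulmxnE mxE.
rewrite -mulr_natl natz -PoszM; move: (p * b j)%N (z _ j) => u x; lia. Qed.

Lemma tile_sub b : tile b `<=` cube n.
Proof.
move=> z /tile_coord bz j; have /andP[z1 z2] := bz j; apply/andP; split.
  exact: le_trans z1.
apply: (lt_le_trans z2); rewrite lez_nat (leq_trans _ pkn)//.
have : (p * b j + p <= p * k)%N by rewrite addnC -mulnS leq_mul2l ltn_ord orbT.
by lia.
Qed.

Lemma tile_sep b b' z y : b != b' -> tile b z -> tile b' y ->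
  (p - m < linf_norm (z - y))%N.
Proof.
move=> bb' /tile_coord bz /tile_coord by'.
have [j bj] : exists j, b j != b' j.
  apply/existsP; apply: contra_neqT bb'; rewrite negb_exists => /forallP h.
  by apply/ffunP => j; apply/eqP; have := h j; rewrite negbK.
apply: leq_trans (leq_bigmax j); rewrite !mxE.
have := bz j; have := by' j.
have : (p * b j + p <= p * b' j)%N \/ (p * b' j + p <= p * b j)%N.
  by move: bj; rewrite neq_ltn => /orP[] bj; [left|right];
    rewrite addnC -mulnS leq_mul2l bj orbT.
move: (p * b j)%N (p * b' j)%N (z _ j) (y _ j) => u v x x'; lia.
Qed.

Lemma tile_disjoint b b' z : tile b z -> tile b' z -> b = b'.
Proof.
move=> bz bz'; apply/eqP; rewrite -[_ == _]negbK; apply/negP => bb'.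
have := tile_sep bb' bz bz'; rewrite subrr /linf_norm big1// => j _.
by rewrite mxE.
Qed.

Lemma sum_paving {V : nmodType} (F : Zd -> V) :
  \sum_(z \in cube n) F z =
  \sum_b \sum_(z \in tile b) F z + \sum_(z \in interstice) F z.
Proof.
apply: fsbig_disjoint_family; [exact: finite_cube|exact: tile_sub|].
by move=> b b' z; exact: tile_disjoint.
Qed.

Lemma finite_interstice : finite_set interstice.
Proof. by apply: finite_setD; exact: finite_cube. Qed.

Lemma vol_paving {R : realType} :
  (n ^ d)%:R = (k ^ d * m ^ d)%:R + vol interstice :> R.
Proof.
rewrite -vol_cube vol_sum; last exact: finite_cube.
rewrite sum_paving vol_sum; last exact: finite_interstice.
congr (_ + _); under eq_bigr => b _.
  rewrite -vol_sum; last by apply: finite_shift; exact: finite_cube.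
  rewrite vol_shift; last exact: finite_cube.
  rewrite vol_cube; over.
by rewrite sumr_const card_ffun !card_ord -mulrnA mulnC.
Qed.

End paving.

End boxes.

(** * Configurations and the events seen through box means *)

Section mean_alg.
Context {R : realType} {X : measTvsType R} {d : nat}.
Local Notation Zd := 'rV[int]_d.
Implicit Types (S L : set Zd) (A B : set (Zd -> X)) (z : Zd).

Lemma mean_algE S A : @mean_alg R d X S A = measurable (A : set (confS X S)).
Proof. by []. Qed.

Lemma mean_algI S A B : mean_alg S A -> mean_alg S B -> mean_alg S (A `&` B).
Proof. by rewrite !mean_algE => mA mB; exact: measurableI. Qed.

Lemma mean_algT S : @mean_alg R d X S setT.
Proof. by rewrite mean_algE; exact: measurableT. Qed.

Lemma mean_algC S A : mean_alg S A -> mean_alg S (~` A).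
Proof. by rewrite !mean_algE => mA; exact: measurableC. Qed.

Lemma mean_alg_mean S L (B : set X) : box L -> L `<=` S -> sigalg B ->
  mean_alg S (mean L @^-1` B).
Proof. by move=> bL LS sB; apply: sub_sigma_algebra; exists L, B. Qed.

Lemma mean1 z (w : Zd -> X) : mean [set z] w = w z.
Proof.
rewrite /mean fsbig_set1 vol_sum; last exact: finite_set1.
by rewrite fsbig_set1 invr1 scale1r.
Qed.

Lemma mean_alg_site S z (B : set X) : S z -> sigalg B ->
  mean_alg S [set w | B (w z)].
Proof.
move=> Sz sB; rewrite (_ : [set w | _] = mean [set z] @^-1` B).
  by apply: mean_alg_mean => //; [exact: box_set1|move=> y ->].
by apply/seteqP; split => w /=; rewrite mean1.
Qed.

(** It is enough to check the generators. *)
Lemma mean_alg_preimage {Y : measTvsType R} S (S' : set Zd)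
    (phi : (Zd -> X) -> (Zd -> Y)) (A : set (Zd -> Y)) :
  (forall L (B : set Y), box L -> L `<=` S' -> sigalg B ->
     mean_alg S (phi @^-1` (mean L @^-1` B))) ->
  mean_alg S' A -> mean_alg S (phi @^-1` A).
Proof.
move=> phiG; pose M := [set A : set (Zd -> Y) | mean_alg S (phi @^-1` A)].
suff : mean_alg S' `<=` M by exact.
apply: smallest_sub; last by move=> B [L [C [bL LS sC ->]]]; exact: phiG.
split.
- by rewrite /M /= preimage_set0 mean_algE; exact: measurable0.
- by move=> B mB; rewrite /M /= setTD preimage_setC; exact: mean_algC.
- move=> F mF; rewrite /M /= preimage_bigcup mean_algE.
  by apply: bigcupT_measurable => k; exact: mF.
Qed.

Lemma mean_alg_mono S (S' : set Zd) A : S `<=` S' -> mean_alg S A -> mean_alg S' A.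
Proof.
move=> SS'; apply: (mean_alg_preimage (phi := id)) => L B bL LS sB.
exact: (mean_alg_mean bL (subset_trans LS SS') sB).
Qed.

Lemma shift_confE z A : shift_conf z A = (fun w y => w (y + z)) @^-1` A.
Proof.
apply/seteqP; split => [_ [w Aw <-]|w Aw] /=.
  by congr A: Aw; apply/funext => y; rewrite addrK.
by exists (fun y => w (y + z)) => //; apply/funext => y; rewrite subrK.
Qed.

Lemma mean_shift z L (w : Zd -> X) : finite_set L ->
  mean L (fun y => w (y + z)) = mean (shift_set z L) w.
Proof. by move=> fL; rewrite /mean fsbig_shift vol_shift. Qed.

Lemma mean_alg_shift z S A : mean_alg S A ->
  mean_alg (shift_set z S) (shift_conf z A).
Proof.
rewrite shift_confE; apply: mean_alg_preimage => L B bL LS sB.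
rewrite [X in mean_alg _ X](_ : _ = mean (shift_set z L) @^-1` B).
  by apply: mean_alg_mean => //; [exact: box_shift|exact: shift_set_sub].
by apply/funext => w /=; rewrite /preimage /= mean_shift//; exact: box_finite.
Qed.

Lemma measurable_mean L : box L ->
  measurable_fun [set: confS X L] (mean L : confS X L -> mspace X).
Proof. by move=> bL _ B mB; rewrite setTI; exact: mean_alg_mean. Qed.

End mean_alg.

Lemma ae_le_integral_ge {dT} {T : measurableType dT} {R : realType}
    (m : {measure set T -> \bar R}) (B : set T) (Y : T -> R) (a : R) :
  0 <= a -> measurable B -> m.-integrable setT (EFin \o Y) ->
  (\forall w \ae m, a <= Y w) -> (a%:E * m B <= \int[m]_(w in B) (Y w)%:E)%E.
Proof.
move=> a0 mB iY aY; rewrite -integral_cst//.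
have mY : measurable_fun B (EFin \o Y).
  exact: measurable_funS (measurable_int _ iY).
have mm : measurable_fun B (fun w => maxe (Y w)%:E a%:E).
  by apply: measurable_maxe => //; exact: measurable_cst.
rewrite [leRHS](ae_eq_integral (fun w => maxe (Y w)%:E a%:E))//.
  by apply: ge0_le_integral => //= w _; rewrite ?le_max ?lee_fin ?a0 ?lexx ?orbT.
apply: filterS aY => w /= aYw _.
by apply/esym/max_idPl; rewrite lee_fin.
Qed.

Section probabilities.
Context {R : realType} {X : measTvsType R} {d : nat}.
Local Notation Zd := 'rV[int]_d.
Variable nu : forall L : set Zd, probability (confS X L) R.
Implicit Types (S L : set Zd) (A B : set (Zd -> X)) (z : Zd).

Definition pr L A : R := fine (nu L A).

Lemma prE L A : mean_alg L A -> nu L A = (pr L A)%:E.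
Proof. by move=> mA; rewrite /pr fineK// fin_num_measure. Qed.

Lemma pr_ge0 L A : 0 <= pr L A.
Proof. exact: fine_ge0. Qed.

Lemma pr_le L A B : mean_alg L A -> mean_alg L B -> A `<=` B -> pr L A <= pr L B.
Proof.
by move=> mA mB AB; rewrite -lee_fin -!prE//; apply: le_measure; rewrite ?inE.
Qed.

Lemma prT L : pr L setT = 1.
Proof. by rewrite /pr probability_setT. Qed.

Lemma prC L A : mean_alg L A -> pr L (~` A) = 1 - pr L A.
Proof.
move=> mA; apply: EFin_inj; rewrite -prE; last exact: mean_algC.
by rewrite probability_setC// EFinB prE.
Qed.

Lemma pr_setID L A B : mean_alg L A -> mean_alg L B ->
  pr L B = pr L (A `&` B) + pr L (~` A `&` B).
Proof.
move=> mA mB; apply: EFin_inj; rewrite EFinD -!prE//; last 2 first.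
- by apply: mean_algI => //; exact: mean_algC.
- exact: mean_algI.
rewrite -measureU ?measurableI//.
- by rewrite -setIUl setUv setTI.
- exact: mean_algI.
- by apply: mean_algI => //; exact: mean_algC.
- by rewrite setIACA setICr set0I.
Qed.

Hypothesis nuP : is_scit nu.

Lemma pr_compat L1 L2 A : box L1 -> box L2 -> L1 `<=` L2 -> mean_alg L1 A ->
  pr L2 A = pr L1 A.
Proof. by move=> b1 b2 L12 mA; rewrite /pr (scit_compat nuP b1 b2 L12). Qed.

Lemma pr_shift L z A : box L -> mean_alg L A ->
  pr (shift_set z L) (shift_conf z A) = pr L A.
Proof. by move=> bL mA; rewrite /pr (scit_shift nuP). Qed.

(** The m-th term of the Cramer sequence, with real values. *)
Definition mpr (m : nat) (B : set X) : R := pr (cube m) (mean (cube m) @^-1` B).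

Lemma cramerE m (B : set X) : (0 < m)%N -> sigalg B ->
  cramer (fun L => nu L) m B = (mpr m B)%:E.
Proof.
move=> m0 sB; rewrite /cramer /pushforward prE//.
by apply: mean_alg_mean => //; exact: box_cube.
Qed.

(** The form in which local control and local tightness are used: conditional
    probabilities are replaced by events, and the origin by any site. *)
Definition site_bound (Q : set X) (a : R) : Prop :=
  sigalg Q /\ forall L z B, box L -> L z -> mean_alg (L `\ z) B ->
    a * pr L B <= pr L ([set w | Q (w z)] `&` B).

(** By translation invariance the origin may be moved to any site; integrating
    the conditional bound over B does the rest. *)
Lemma cond_prob_site_bound (Q : set X) (a : R) : sigalg Q -> 0 <= a ->
  (forall L, box L -> L 0 ->
     cond_prob_ge (fun L => nu L) (L `\ 0) [set w | Q (w 0)] a) ->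
  site_bound Q a.
Proof.
move=> sQ a0 hQ; split=> // L z B bL Lz mB.
wlog z0 : L z B bL Lz mB / z = 0 => [h|].
  have L0 : shift_set (- z) L 0 by apply/shift_setE; rewrite sub0r opprK.
  have mB' : mean_alg (shift_set (- z) L `\ 0) (shift_conf (- z) B).
    rewrite -[X in _ `\ X](subrr z) -shift_setD1; exact: mean_alg_shift.
  have := h _ 0 _ (box_shift (- z) bL) L0 mB' erefl.
  have mBL : mean_alg L B by apply: mean_alg_mono mB; exact: subDsetl.
  rewrite pr_shift//; congr (_ <= _).
  rewrite -[RHS](pr_shift (- z))//; last first.
    by apply: mean_algI => //; exact: mean_alg_site.
  by congr pr; rewrite !shift_confE preimage_setI; congr (_ `&` _);
    apply/seteqP; split => w /=; rewrite subrr.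
rewrite {z}z0 in Lz mB *; move: Lz => L0.
have mQ : mean_alg L [set w | Q (w 0)] by exact: mean_alg_site.
have [Y [mY iY YB] aY] := hQ L bL L0 L bL (@subDsetl _ _ _) mQ.
have mBL : mean_alg L B by apply: mean_alg_mono mB; exact: subDsetl.
rewrite -lee_fin EFinM -!prE//; last exact: mean_algI.
rewrite -(YB B mB).
exact: (@ae_le_integral_ge _ (confS X L)).
Qed.

End probabilities.

(** * Decoupling over a paving *)

Section distance.
Context {R : realType} {d : nat}.
Local Notation Zd := 'rV[int]_d.

Lemma linf_dist_shift (a : Zd) (S T : set Zd) :
  linf_dist (shift_set a S) (shift_set a T) = linf_dist S T :> \bar R.
Proof.
rewrite /linf_dist; congr ereal_inf; apply/seteqP; split => x.
  by move=> [_ [z Sz <-] [_ [y Ty <-] <-]]; exists z => //; exists y => //;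
    rewrite opprD addrACA subrr addr0.
move=> [z Sz [y Ty <-]]; exists (z + a); first by exists z.
by exists (y + a); [exists y|rewrite opprD addrACA subrr addr0].
Qed.

Lemma lt_linf_dist (g : R) (r : nat) (S T : set Zd) : g < r%:R ->
  (forall z y, S z -> T y -> (r <= linf_norm (z - y))%N) ->
  (g%:E < linf_dist S T)%E.
Proof.
move=> gr rST; apply: (@lt_le_trans _ _ r%:R%:E); first by rewrite lte_fin.
by apply: le_ereal_inf_tmp => _ [z Sz [y Ty <-]]; rewrite lee_fin ler_nat; exact: rST.
Qed.

End distance.

Section decoupling.
Context {R : realType} {X : measTvsType R} {d : nat}.
Local Notation Zd := 'rV[int]_d.
Variable nu : forall L : set Zd, probability (confS X L) R.
Hypothesis nuP : is_scit nu.
Implicit Types (S L : set Zd) (A B : set (Zd -> X)) (z : Zd) (C Q : set X).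

(** The asymptotic decoupling inequality at the single scale m. *)
Definition decoupled (m : nat) (g kappa : R) : Prop :=
  forall S A B, finite_set S -> mean_alg (cube m) A -> mean_alg S B ->
    (g%:E < linf_dist S (cube m))%E ->
    forall L, box L -> cube m `<=` L -> S `<=` L ->
    (kappa%:E * nu L A * nu L B <= nu L (A `&` B))%E.

Variables (m : nat) (g kappa : R).
Hypotheses (m0 : (0 < m)%N) (dec : decoupled m g kappa).

Lemma decoupled_shift (a : Zd) S L C B : finite_set S -> sigalg C ->
  mean_alg S B -> (g%:E < linf_dist S (shift_set a (cube m)))%E -> box L ->
  shift_set a (cube m) `<=` L -> S `<=` L ->
  kappa * mpr nu m C * pr nu L B <=
  pr nu L (mean (shift_set a (cube m)) @^-1` C `&` B).
Proof.
move=> fS sC mB gS bL aL SL.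
pose A := mean (cube m : set Zd) @^-1` C.
have bm : box (cube m : set Zd) by exact: box_cube.
have mA : mean_alg (cube m) A by exact: mean_alg_mean.
have shL T : T `<=` L -> shift_set (- a) T `<=` shift_set (- a) L.
  exact: shift_set_sub.
have bL' := box_shift (- a) bL.
have mL : cube m `<=` shift_set (- a) L by rewrite -(shift_setK a (cube m)); exact: shL.
have gS' : (g%:E < linf_dist (shift_set (- a) S) (cube m))%E.
  by rewrite -(shift_setK a (cube m)) linf_dist_shift.
have mB' := @mean_alg_shift _ _ _ (- a) _ _ mB.
have := dec (finite_shift (- a) fS) mA mB' gS' bL' mL (shL _ SL).
have mAL := mean_alg_mono mL mA.
have mBL := mean_alg_mono (shL _ SL) mB'.
rewrite !prE//; last exact: mean_algI.
rewrite -!EFinM lee_fin (pr_compat nuP bm bL' mL mA).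
rewrite (pr_shift nuP (- a) bL (mean_alg_mono SL mB)).
move=> /le_trans; apply.
have mAa : mean_alg L (mean (shift_set a (cube m)) @^-1` C).
  by apply: mean_alg_mean => //; exact: box_shift.
rewrite -[leRHS](pr_shift nuP (- a))//; last first.
  by apply: mean_algI => //; exact: mean_alg_mono mB.
rewrite le_eqVlt; apply/orP; left; apply/eqP; congr pr.
rewrite !shift_confE preimage_setI; congr (_ `&` _).
apply/funext => w; rewrite /A /preimage /= mean_shift ?shift_setK//.
by apply: finite_shift; exact: finite_cube.
Qed.

Variables (p k n : nat).
Hypotheses (mp : (m <= p)%N) (pkn : (p * k <= n)%N) (n0 : (0 < n)%N).
Hypothesis gp : g < (p - m).+1%:R.

Local Notation tile := (@tile d m p k).
Local Notation interstice := (@interstice d m p k n).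

Lemma box_tile b : box (tile b).
Proof. by apply: box_shift; exact: box_cube. Qed.

(** Indexed by a list of tiles, for the induction that adds one tile at a
    time. *)
Definition tiles_event (A : {ffun 'I_d -> 'I_k} -> set X)
    (s : seq {ffun 'I_d -> 'I_k}) : set (Zd -> X) :=
  [set w | forall b, b \in s -> A b (mean (tile b) w)].

Lemma mean_alg_tiles_event (A : {ffun 'I_d -> 'I_k} -> set X) s : (forall b, sigalg (A b)) ->
  mean_alg (\bigcup_(b in [set` s]) tile b) (tiles_event A s).
Proof.
move=> sA; elim: s => [|b s IH].
  rewrite (_ : tiles_event _ _ = setT); first exact: mean_algT.
  by apply/seteqP; split => w.
rewrite (_ : tiles_event _ _ = mean (tile b) @^-1` A b `&` tiles_event A s).
  apply: mean_algI; last first.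
    apply: mean_alg_mono IH; apply: bigcup_subset => b' /= b's.
    by rewrite inE b's orbT.
  apply: mean_alg_mean => //; first exact: box_tile.
  by move=> z bz; exists b; rewrite //= mem_head.
apply/seteqP; split => w /=.
  move=> h; split; first by apply: h; rewrite mem_head.
  by move=> b' b's; apply: h; rewrite inE b's orbT.
by move=> [Ab h] b'; rewrite inE => /predU1P[->//|]; exact: h.
Qed.

Lemma prod_le_tiles_event (A : {ffun 'I_d -> 'I_k} -> set X) s : (forall b, sigalg (A b)) -> 0 <= kappa ->
  uniq s ->
  \prod_(b <- s) (kappa * mpr nu m (A b)) <= pr nu (cube n) (tiles_event A s).
Proof.
move=> sA k0; elim: s => [_|b s IH /= /andP[bs us]].
  rewrite big_nil (_ : tiles_event _ _ = setT) ?prT//.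
  by apply/seteqP; split => w.
rewrite big_cons.
rewrite (_ : tiles_event _ _ = mean (tile b) @^-1` A b `&` tiles_event A s); last first.
  apply/seteqP; split => w /=.
    move=> h; split; first by apply: h; rewrite mem_head.
    by move=> b' b's; apply: h; rewrite inE b's orbT.
  by move=> [Ab h] b'; rewrite inE => /predU1P[->//|]; exact: h.
have sub : \bigcup_(b in [set` s]) tile b `<=` cube n.
  by apply: bigcup_sub => b' _; exact: tile_sub.
have fU : finite_set (\bigcup_(b in [set` s]) tile b).
  by apply: sub_finite_set sub _; exact: finite_cube.
have dU : (g%:E < linf_dist (\bigcup_(b in [set` s]) tile b) (tile b))%E.
  apply: (lt_linf_dist gp) => z y [b' b's b'z] by'.
  have bb' : b' != b.
    by apply/eqP => bb; move: bs; rewrite -bb (b's : b' \in s).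
  exact: tile_sep bb' b'z by'.
apply: (le_trans _ (decoupled_shift fU (sA b) (mean_alg_tiles_event (s := s) sA) dU
  (box_cube n0) _ sub)); last exact: tile_sub.
by rewrite ler_wpM2l ?mulr_ge0 ?pr_ge0//; exact: IH.
Qed.

Lemma site_bound_seq Q (a : R) S (r : seq Zd) A : site_bound nu Q a -> 0 <= a ->
  uniq r -> S `<=` cube n -> [set` r] `<=` cube n `\` S -> mean_alg S A ->
  a ^+ size r * pr nu (cube n) A <=
  pr nu (cube n) (A `&` [set w | forall z, z \in r -> Q (w z)]) /\
  mean_alg (S `|` [set` r]) (A `&` [set w | forall z, z \in r -> Q (w z)]).
Proof.
move=> [sQ hQ] a0 + Sn + mA; elim: r => [_ _|z r IH /= /andP[zr ur] rS].
  rewrite expr0 mul1r (_ : [set w | _] = setT); last by apply/seteqP; split.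
  by rewrite setIT (_ : [set` _] = set0) ?setU0//; apply/seteqP; split.
have [|IH1 IH2] := IH ur; first by move=> y yr; apply: rS; rewrite /= inE yr orbT.
set F := A `&` _ in IH1 IH2.
have -> : A `&` [set w | forall y, y \in z :: r -> Q (w y)] =
    [set w | Q (w z)] `&` F.
  apply/seteqP; split => w /=.
    move=> [Aw h]; split; first by apply: h; rewrite mem_head.
    by split=> // y yr; apply: h; rewrite inE yr orbT.
  move=> [Qz [Aw h]]; split=> // y; rewrite inE => /predU1P[->//|]; exact: h.
have [zn zS] : (cube n `\` S) z by apply: rS; rewrite /= mem_head.
split; last first.
  apply: mean_algI; first by apply: mean_alg_site => //; right; rewrite /= mem_head.
  apply: mean_alg_mono IH2; apply: setUS => y /= yr; by rewrite inE yr orbT.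
rewrite exprS -mulrA; apply: (le_trans (ler_wpM2l a0 IH1)).
apply: hQ => //; first exact: box_cube.
apply: mean_alg_mono IH2 => y [Sy|/= yr].
  by split; [exact: Sn|move=> yz; apply: zS; rewrite -yz].
split; last by move=> yz; move: zr; rewrite -yz yr.
by have [] : (cube n `\` S) y by apply: rS; rewrite /= inE yr orbT.
Qed.

Definition paving_event (A : {ffun 'I_d -> 'I_k} -> set X) Q : set (Zd -> X) :=
  [set w | (forall b, A b (mean (tile b) w)) /\
           forall z, interstice z -> Q (w z)].

(** The tiles are decoupled from one another one at a time, then the remaining
    sites are controlled one at a time. *)
Lemma paving_event_bound (A : {ffun 'I_d -> 'I_k} -> set X) Q (a : R) : (forall b, sigalg (A b)) ->
  0 <= kappa -> site_bound nu Q a -> 0 <= a ->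
  (\prod_b (kappa * mpr nu m (A b))) * a ^+ #|` fset_set interstice| <=
  pr nu (cube n) (paving_event A Q) /\
  mean_alg (cube n) (paving_event A Q).
Proof.
move=> sA k0 hQ a0.
have fI : finite_set interstice by exact: finite_interstice.
pose U := \bigcup_b tile b.
have UE : U = \bigcup_(b in [set` enum {ffun 'I_d -> 'I_k}]) tile b.
  by apply/seteqP; split => z [b _ bz]; exists b => //=; rewrite mem_enum.
have Un : U `<=` cube n by apply: bigcup_sub => b _; exact: tile_sub.
have mU : mean_alg U (tiles_event A (enum {ffun 'I_d -> 'I_k})).
  by rewrite UE; exact: mean_alg_tiles_event.
have rU : [set` fset_set interstice] `<=` cube n `\` U by rewrite fset_setK.
have [h1 h2] := site_bound_seq hQ a0 (fset_uniq _) Un rU mU.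
have E : tiles_event A (enum {ffun 'I_d -> 'I_k}) `&`
    [set w | forall z, z \in fset_set interstice -> Q (w z)] = paving_event A Q.
  apply/seteqP; split => w [tw qw]; split.
  - by move=> b; apply: tw; rewrite mem_enum.
  - by move=> z iz; apply: qw; rewrite in_fset_set// inE.
  - by move=> b _; exact: tw.
  - by move=> z; rewrite in_fset_set// inE; exact: qw.
rewrite E in h1 h2; split; last first.
  by apply: mean_alg_mono h2; rewrite fset_setK// subUset; split => // z [].
apply: (le_trans _ h1); rewrite mulrC ler_wpM2l ?exprn_ge0//.
apply: (le_trans _ (prod_le_tiles_event sA k0 (enum_uniq _))).
by rewrite big_enum.
Qed.

End decoupling.

(** * Almost supermultiplicativity of the exponential integrals *)

Section convex_means.
Context {R : realType} {X : lmodType R}.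

Lemma convex_set_avg (A : set X) (I : Type) (s : seq I) (P : pred I) (x : I -> X) :
  convex_set A -> (forall i, P i -> A (x i)) -> (0 < count P s)%N ->
  A ((count P s)%:R^-1 *: \sum_(i <- s | P i) x i).
Proof.
move=> /convex_set_comb cA Ax; elim: s => [//|i s IH].
rewrite big_cons /=; case: ifPn => [Pi _|_]; last by rewrite add0n; exact: IH.
rewrite add1n; have [s0|s0] := posnP (count P s).
  have sP : [seq j <- s | P j] = [::] by apply/size0nil; rewrite size_filter.
  by rewrite s0 invr1 scale1r -big_filter sP big_nil addr0; exact: Ax.
have -> : x i + \sum_(j <- s | P j) x j =
    x i + (count P s)%:R *: ((count P s)%:R^-1 *: \sum_(j <- s | P j) x j).
  by rewrite scalerA divff ?scale1r// pnatr_eq0 -lt0n.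
rewrite scalerDr scalerA; apply: cA; [by []| | |exact: Ax|exact: IH].
- by rewrite mulr_ge0.
- by rewrite -[X in X + _]mulr1 -mulrDr -natr1 addrC mulVf// natr1 pnatr_eq0.
Qed.

Lemma convex_set_sum (A : set X) (I : Type) (s : seq I) (P : pred I) (x : I -> X) :
  convex_set A -> A !=set0 -> (forall i, P i -> A (x i)) ->
  exists2 y, A y & \sum_(i <- s | P i) x i = (count P s)%:R *: y.
Proof.
move=> cA [y0 Ay0] Ax; have [c0|c0] := posnP (count P s).
  exists y0 => //; rewrite c0 scale0r -big_filter.
  have -> : [seq i <- s | P i] = [::] by apply/size0nil; rewrite size_filter.
  by rewrite big_nil.
exists ((count P s)%:R^-1 *: \sum_(i <- s | P i) x i).
  exact: convex_set_avg.
by rewrite scalerA divff ?scale1r// pnatr_eq0 -lt0n.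
Qed.

Lemma convex_set_mean {d : nat} (A : set X) (L : set 'rV[int]_d) (w : 'rV[int]_d -> X) :
  convex_set A -> box L -> (forall z, L z -> A (w z)) -> A (mean L w).
Proof.
move=> cA bL Aw; have fL := box_finite bL; rewrite /mean fsbig_finite//.
rewrite /vol -(count_predT (fset_set L)).
have L0 : (0 < count predT (fset_set L))%N.
  rewrite count_predT cardfs_gt0; apply/fset0Pn.
  move: bL => [a [n [n0 LE]]]; exists a; rewrite in_fset_set// inE LE shift_setE.
  by rewrite subrr => j; rewrite mxE ltz_nat n0.
have -> : \sum_(z <- fset_set L) w z = \sum_(z <- fset_set L | z \in L) w z.
  rewrite big_seq [RHS]big_seq_cond; apply: eq_bigl => z.
  by rewrite in_fset_set// andbb.
have cL : count (fun z => z \in L) (fset_set L) = count predT (fset_set L).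
  by apply: eq_in_count => z; rewrite in_fset_set// => ->.
by rewrite -cL in L0 *; apply: convex_set_avg => // z; rewrite inE; exact: Aw.
Qed.

Lemma scaler_mean {d : nat} (L : set 'rV[int]_d) (w : 'rV[int]_d -> X) :
  box L -> (vol L : R) *: mean L w = \sum_(z \in L) w z.
Proof.
move=> bL; rewrite /mean scalerA divff ?scale1r//.
rewrite /vol pnatr_eq0 cardfs_eq0; apply/fset0Pn.
move: (bL) => [a [n [n0 LE]]]; exists a; rewrite in_fset_set ?inE; last exact: box_finite.
by rewrite LE shift_setE subrr => j; rewrite mxE ltz_nat n0.
Qed.

End convex_means.

Lemma sum_indic_le_integral {dT} {T : measurableType dT} {R : realType}
    (mu : {measure set T -> \bar R}) (Z : set T) (I : finType) (c : I -> R)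
    (A : I -> set T) (G : T -> R) :
  (forall B, measurable B -> B `&` Z = set0 -> mu B = 0%E) ->
  (forall i, 0 <= c i) -> (forall i, measurable (A i)) ->
  measurable_fun setT G -> (forall w, 0 <= G w) ->
  (forall w, Z w -> \sum_i c i * \1_(A i) w <= G w) ->
  (\sum_i ((c i)%:E * mu (A i)) <= \int[mu]_w (G w)%:E)%E.
Proof.
move=> muZ c0 mA mG G0 FG.
have mc i : measurable_fun setT (fun w => c i * \1_(A i) w).
  by apply: measurable_funM => //; exact: measurable_indic.
have -> : (\sum_i ((c i)%:E * mu (A i)) =
    \int[mu]_w (\sum_i c i * \1_(A i) w)%:E)%E.
  under [RHS]eq_integral do rewrite -sumEFin.
  rewrite ge0_integral_sum//; last 2 first.
  - by move=> i; apply/measurable_EFinP.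
  - by move=> i w _; rewrite lee_fin mulr_ge0.
  apply: eq_bigr => i _; rewrite (integralZl_indic _ (fun=> A i))//.
    by rewrite integral_indic// setIT.
  by move=> ci; have := c0 i; rewrite leNgt ci.
have mF : measurable_fun setT (fun w => \sum_i c i * \1_(A i) w).
  by apply: measurable_sum => i.
apply: ae_ge0_le_integral => //.
- by move=> w _; rewrite lee_fin sumr_ge0// => i _; rewrite mulr_ge0.
- exact/measurable_EFinP.
- by move=> w _; rewrite lee_fin.
- exact/measurable_EFinP.
have mlt : measurable [set w | G w < \sum_i c i * \1_(A i) w].
  have mG' : measurable_fun setT (EFin \o G) by exact/measurable_EFinP.
  have mF' : measurable_fun setT (EFin \o fun w => \sum_i c i * \1_(A i) w).
    exact/measurable_EFinP.
  have := measurable_lte measurableT mG' mF'; rewrite setTI.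
  by under eq_set do rewrite lte_fin.
exists [set w | G w < \sum_i c i * \1_(A i) w]; split => //.
- apply: muZ => //; apply/seteqP; split => // w [/= + /FG].
  by rewrite ltNge => /negP.
- by move=> w /= /not_implyP[_ /negP]; rewrite lee_fin -ltNge.
Qed.

Lemma scalarZ {R : realType} {X : lmodType R} (l : {scalar X}) (a : R) x :
  l (a *: x) = a * l x.
Proof. exact: linearZ. Qed.

Section supermultiplicativity.
Context {R : realType} {X : measTvsType R} {d : nat}.
Local Notation Zd := 'rV[int]_d.
Variable nu : forall L : set Zd, probability (confS X L) R.
Hypothesis nuP : is_scit nu.
Variable D : set X.
Hypotheses (cD : convex_set D).
Hypothesis nuD : carried (fun L => nu L) [set w | forall z, D (w z)].
Implicit Types (L : set Zd) (B : set (Zd -> X)) (Q V H : set X).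

Lemma carried_null L B : box L -> mean_alg L B ->
  B `&` [set w | forall z, D (w z)] = set0 -> nu L B = 0%E.
Proof.
move=> bL mB BD; rewrite -(measure0 (nu L)).
by apply: (nuD bL mB); [rewrite mean_algE; exact: measurable0|rewrite set0I].
Qed.

Lemma carried_meets m H : (0 < m)%N -> sigalg H -> 0 < mpr nu m H ->
  exists2 x, H x & D x.
Proof.
move=> m0 sH; apply: contraPP => /forall2NP HD; apply/negP; rewrite -leNgt.
have bm := @box_cube d m m0.
rewrite /mpr /pr carried_null//; first exact: mean_alg_mean.
apply/seteqP; split => // w [/= Hw Dw].
by have [] := HD (mean (cube m) w) => //; apply; exact: convex_set_mean.
Qed.

(** A measure structure on the n-th term of the Cramer sequence; it needs n > 0,
    because only boxes have measurable means. *)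
Definition cramer_measure n (n0 : (0 < n)%N) : {measure set (mspace X) -> \bar R} :=
  measure_function_pushforward__canonical__measure_function_Measure
    (nu (cube n)) (measurable_mean (box_cube n0)).

Lemma cramer_measureE n (n0 : (0 < n)%N) :
  cramer (fun L => nu L) n = cramer_measure n0 :> (set (mspace X) -> \bar R).
Proof. by []. Qed.

Lemma integral_cramer n V (f : mspace X -> R) : (0 < n)%N -> sigalg V ->
  measurable_fun [set: mspace X] f -> (forall x, 0 <= f x) ->
  (\int[cramer (fun L => nu L) n]_(x in V) (f x)%:E =
   \int[nu (cube n)]_w (f (mean (cube n) w) * \1_(mean (cube n) @^-1` V) w)%:E)%E.
Proof.
move=> n0 sV mf f0; rewrite /cramer ge0_integral_pushforward//.
- rewrite integral_mkcond; apply: eq_integral => w _ /=.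
  by rewrite patchE indicE; case: ifPn; rewrite ?mulr1 ?mulr0.
- exact: measurable_mean (box_cube n0).
- exact: measurable_funS (subsetT _) (iffRL (measurable_EFinP _ _) mf).
- by move=> x _; rewrite lee_fin.
Qed.

Variables (m : nat) (g kappa : R).
Hypotheses (m0 : (0 < m)%N) (dec : decoupled nu m g kappa).
Variables (p k n : nat).
Hypotheses (mp : (m <= p)%N) (pkn : (p * k <= n)%N) (n0 : (0 < n)%N).
Hypothesis gp : g < (p - m).+1%:R.
Local Notation tile := (@tile d m p k).
Local Notation interstice := (@interstice d m p k n).
Local Notation vm := (vol (cube m : set Zd) : R).
Local Notation vn := (vol (cube n : set Zd) : R).
Local Notation nI := #|` fset_set interstice|.

Lemma vol_gt0 j : (0 < j)%N -> 0 < vol (cube j : set Zd) :> R.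
Proof. by move=> j0; rewrite vol_cube ltr0n expn_gt0 j0. Qed.

Lemma sum_cube_tiles (w : Zd -> X) : vn *: mean (cube n) w =
  \sum_b vm *: mean (tile b) w + \sum_(z \in interstice) w z.
Proof.
rewrite scaler_mean; last exact: box_cube.
rewrite (sum_paving mp pkn); congr (_ + _); apply: eq_bigr => b _.
by rewrite -scaler_mean; [rewrite vol_shift//; exact: finite_cube|exact: box_tile].
Qed.

Import HBNNSimple.

Section simple.
Hypothesis kappa0 : 0 <= kappa.
Variables (h : {ffun 'I_d -> 'I_k} -> {nnsfun mspace X >-> R}) (r : {fset R}).
Hypotheses (hr : forall b x, h b x \in r) (r0 : forall y, y \in r -> 0 <= y).
Variables (l : {scalar X}) (Q V : set X) (a tau : R).
Hypotheses (ml : measurable_fun [set: mspace X] (l : mspace X -> R)).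
Hypothesis hl : forall b x, h b x <= expR (vm * l x).
Hypotheses (hQ : site_bound nu Q a) (a0 : 0 <= a).
Hypothesis Ql : forall q, Q q -> - tau <= l q.
Hypothesis sV : sigalg V.
Hypothesis hV : forall w, (forall z, D (w z)) ->
  (forall b, 0 < h b (mean (tile b) w)) -> (forall z, interstice z -> Q (w z)) ->
  V (mean (cube n) w).

Let level b (y : r) : set X := h b @^-1` [set val y].
Let ev (phi : {ffun {ffun 'I_d -> 'I_k} -> r}) :=
  paving_event m p n (fun b => level b (phi b)) Q.
Let coef (phi : {ffun {ffun 'I_d -> 'I_k} -> r}) : R :=
  (\prod_b val (phi b)) * expR (- (tau * nI%:R)).

Let level_sigalg b y : sigalg (level b y).
Proof.
have := @measurable_sfunP _ _ _ _ (h b) [set val y] (measurable_set1 _).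
by [].
Qed.

Let pointwise w : (forall z, D (w z)) ->
  \sum_phi coef phi * \1_(ev phi) w <=
  expR (vn * l (mean (cube n) w)) * \1_(mean (cube n) @^-1` V) w.
Proof.
move=> Dw.
have [Qw|nQ] := pselect (forall z, interstice z -> Q (w z)); last first.
  rewrite big1 ?mulr_ge0 ?expR_ge0// => phi _.
  by rewrite indicE memNset ?mulr0// => -[_].
pose phi0 : {ffun {ffun 'I_d -> 'I_k} -> r} := [ffun b => [` hr b (mean (tile b) w)]%fset].
rewrite (bigD1 phi0)//= big1 ?addr0 => [|phi phiN]; last first.
  rewrite indicE memNset ?mulr0// => -[hphi _]; move: phiN => /negP; apply.
  by apply/eqP/ffunP => b; apply/val_inj; rewrite ffunE/=; have := hphi b.
rewrite indicE mem_set ?mulr1; last by split => // b; rewrite /level /= ffunE.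
rewrite /coef; under eq_bigr do rewrite ffunE /=.
have [hpos|] := pselect (forall b, 0 < h b (mean (tile b) w)); last first.
  move=> /existsNP[b /negP]; rewrite -leNgt => hb.
  rewrite (bigD1 b)//= (_ : h b _ = 0) ?mul0r ?mulr_ge0 ?expR_ge0//.
  by apply/eqP; rewrite eq_le hb/=.
rewrite indicE mem_set ?mulr1; last exact: hV.
have -> : vn * l (mean (cube n) w) =
    \sum_b vm * l (mean (tile b) w) + \sum_(z \in interstice) l (w z).
  rewrite -(scalarZ l).
  rewrite sum_cube_tiles linearD linear_sum/=; congr (_ + _).
    by apply: eq_bigr => b _; rewrite -(scalarZ l).
  have fI : finite_set interstice by exact: finite_interstice.
  by rewrite !fsbig_finite// linear_sum.
rewrite expRD; apply: ler_pM; rewrite ?expR_ge0//.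
- by apply: prodr_ge0 => b _; exact: ltW.
- by rewrite expR_sum; apply: ler_prod => b _; rewrite hl ltW.
rewrite ler_expR.
have fI : finite_set interstice by exact: finite_interstice.
rewrite fsbig_finite//= -mulNr mulr_natr.
have -> : (- tau) *+ nI = \sum_(z <- fset_set interstice) - tau.
  by rewrite big_const_seq count_predT iter_addr_0.
rewrite big_seq [leRHS]big_seq; apply: ler_sum => z.
by rewrite in_fset_set// inE => /Qw /Ql.
Qed.

(** The integral on the right is at least that of the product over the tiles of
    the simple functions, times the indicator of the control on the remaining
    sites. Expanding the product over the level sets reduces its integral to
    probabilities of events described tile by tile. *)
Lemma supermult_simple :
  (((\prod_b (kappa * \sum_(y : r) val y * mpr nu m (level b y))) *
    a ^+ nI * expR (- (tau * nI%:R)))%:E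
  <= \int[cramer (fun L => nu L) n]_(x in V) (expR (vn * l x))%:E)%E.
Proof.
have mexp : measurable_fun [set: mspace X] (fun x : mspace X => expR (vn * l x)).
  by apply: measurableT_comp => //; exact: measurable_funM.
rewrite integral_cramer//.
have evP (phi : {ffun {ffun 'I_d -> 'I_k} -> r}) := paving_event_bound nuP m0 dec mp pkn n0 gp
  (fun b => level_sigalg b (phi b)) kappa0 hQ a0.
have coef0 phi : 0 <= coef phi.
  by rewrite mulr_ge0 ?expR_ge0//; apply: prodr_ge0 => b _; exact/r0/valP.
have mmean := @measurable_mean R X d _ (box_cube n0).
have mV : mean_alg (cube n : set Zd) (mean (cube n) @^-1` V).
  by apply: mean_alg_mean => //; exact: box_cube.
apply: le_trans (@sum_indic_le_integral _ (confS X (cube n)) R (nu (cube n))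
  [set w | forall z, D (w z)] _ coef ev _ _ coef0 _ _ _ pointwise); last 4 first.
- by move=> B mB; apply: carried_null => //; exact: box_cube.
- by move=> phi; have [] := evP phi.
- exact: (@measurable_funM _ (confS X (cube n)) R setT _ _
    (measurableT_comp mexp mmean) (@measurable_indic _ (confS X (cube n)) R setT _ mV)).
- by move=> w; rewrite mulr_ge0 ?expR_ge0.
have prev phi : nu (cube n) (ev phi) = (pr nu (cube n) (ev phi))%:E.
  by apply: prE; exact: (evP phi).2.
rewrite [leRHS](_ : _ = (\sum_phi coef phi * pr nu (cube n) (ev phi))%:E); last first.
  rewrite -sumEFin; apply: eq_bigr => phi _; rewrite [RHS]EFinM; congr mule.
  exact: prev.
rewrite lee_fin.
under eq_bigr => b _ do rewrite mulr_sumr.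
rewrite bigA_distr_bigA/= !mulr_suml; apply: ler_sum => phi _.
have -> : \prod_b (kappa * (val (phi b) * mpr nu m (level b (phi b)))) =
    (\prod_b val (phi b)) * \prod_b (kappa * mpr nu m (level b (phi b))).
  by rewrite -big_split/=; apply: eq_bigr => b _; rewrite mulrCA.
apply: le_trans (ler_wpM2l (coef0 phi) (evP phi).1).
rewrite le_eqVlt; apply/orP; left; apply/eqP; rewrite /coef.
by rewrite -!mulrA; congr (_ * _); rewrite [RHS]mulrC mulrA.
Qed.

End simple.

Lemma simple_below (mu : {measure set (mspace X) -> \bar R}) H
    (f : mspace X -> R) (c : R) : (forall x, 0 <= f x) ->
  (c%:E < \int[mu]_(x in H) (f x)%:E)%E ->
  exists h : {nnsfun mspace X >-> R}, [/\ forall x, h x <= f x,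
    forall x, 0 < h x -> H x &
    (c%:E < \sum_(y \in range h) y%:E * mu (h @^-1` [set y]))%E].
Proof.
move=> f0; rewrite ge0_integralE; last by move=> x _; rewrite lee_fin.
move=> /ereal_sup_gt[_ [h hf <-]]; rewrite sintegralE => ch.
exists h; split=> // x.
- have := hf x; rewrite patchE; case: ifPn => _; rewrite lee_fin// => /le_trans.
  by apply.
- move=> hx; have := hf x; rewrite patchE; case: ifPn => [/set_mem//|_].
  by rewrite lee_fin leNgt hx.
Qed.

Lemma sum_levels (h : {nnsfun mspace X >-> R}) (r : {fset R}) (c : R) :
  (forall x, h x \in r) ->
  (c%:E < \sum_(y \in range h) y%:E *
    cramer (fun L => nu L) m (h @^-1` [set y]))%E ->
  c < \sum_(y : r) val y * mpr nu m (h @^-1` [set val y]).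
Proof.
move=> hr.
rewrite (fsbig_widen _ [set` r]) /=; last 2 first.
- by move=> _ [x _ <-]; exact: hr.
- move=> y [/= _ yh]; rewrite (_ : h @^-1` [set y] = set0).
    by rewrite (cramer_measureE m0) measure0 mule0.
  by apply/seteqP; split => // x /= hxy; apply: yh; exists x.
rewrite -fsbig_seq ?fset_uniq// big_seq_fsetE/=.
rewrite [X in (_ < X)%E](_ : _ =
  (\sum_(y : r) val y * mpr nu m (h @^-1` [set val y]))%:E) ?lte_fin//.
rewrite -sumEFin; apply: eq_bigr => y _; rewrite [RHS]EFinM; congr (_ * _)%E.
apply: cramerE => //; exact: (@measurable_sfunP _ _ _ _ h _ (measurable_set1 _)).
Qed.

Section two_types.
Variables (N1 N2 : nat) (H1 H2 Q V : set X) (u1 u2 a tau : R).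
Hypothesis N12 : (N1 + N2 = k ^ d)%N.
Hypothesis sV : sigalg V.
Hypotheses (cH1 : convex_set (H1 `&` D)) (cH2 : convex_set (H2 `&` D))
           (cQ : convex_set (Q `&` D)).
Variable l : {scalar X}.
Hypothesis ml : measurable_fun [set: mspace X] (l : mspace X -> R).
Hypotheses (hQ : site_bound nu Q a) (a0 : 0 < a).
Hypothesis Ql : forall q, Q q -> - tau <= l q.
Hypothesis Hu1 : ((expR (vm * u1))%:E <
  \int[cramer (fun L => nu L) m]_(x in H1) (expR (vm * l x))%:E)%E.
Hypothesis Hu2 : ((expR (vm * u2))%:E <
  \int[cramer (fun L => nu L) m]_(x in H2) (expR (vm * l x))%:E)%E.
Hypothesis hV : forall x1 x2 q, (H1 `&` D) x1 -> (H2 `&` D) x2 -> (Q `&` D) q ->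
  V ((N1%:R * vm / vn) *: x1 + (N2%:R * vm / vn) *: x2 + (nI%:R / vn) *: q).

Hypothesis kappa_gt0 : 0 < kappa.

Let first (b : {ffun 'I_d -> 'I_k}) : bool := (enum_rank b < N1)%N.

Let card_first : #|first| = N1.
Proof.
have N1k : (N1 <= #|{ffun 'I_d -> 'I_k}|)%N.
  by rewrite card_ffun !card_ord -N12 leq_addr.
rewrite -sum1_card (reindex_onto enum_val enum_rank)/=; last first.
  by move=> b _; rewrite enum_rankK.
rewrite (eq_bigl (fun i : 'I_#|{ffun 'I_d -> 'I_k}| => (i < N1)%N)); last first.
  by move=> i; rewrite enum_valK eqxx andbT /in_mem/= /first enum_valK.
by rewrite (big_ord_narrow N1k) sum1_card card_ord.
Qed.

Let card_last : #|[predC first]| = N2.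
Proof.
have := cardC first; rewrite card_first card_ffun !card_ord -N12.
by move=> /addnI.
Qed.

Let count_card (P : pred {ffun 'I_d -> 'I_k}) : count P (index_enum _) = #|P|.
Proof. by rewrite -sum1_card -big_filter sum1_size size_filter. Qed.

Let site_nonempty : (Q `&` D) !=set0.
Proof.
have [sQ hQ'] := hQ.
have b1 : box (cube 1 : set Zd) by exact: box_cube.
have z1 : cube 1 (0 : Zd) by rewrite cube1.
have := hQ' _ _ _ b1 z1 (@mean_algT R X d _); rewrite prT mulr1 setIT => aQ.
have : 0 < mpr nu 1 Q.
  apply: (lt_le_trans a0); apply: (le_trans aQ); rewrite /mpr le_eqVlt; apply/orP; left.
  by apply/eqP; congr pr; apply/funext => w; rewrite /preimage/= cube1 mean1.
by move=> /carried_meets[]// x Qx Dx; exists x.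
Qed.

Let level_nonempty (h : {nnsfun mspace X >-> R}) (r : {fset R}) H c :
  0 <= c -> (forall x, 0 < h x -> H x) ->
  c < \sum_(y : r) val y * mpr nu m (h @^-1` [set val y]) -> (H `&` D) !=set0.
Proof.
move=> c0 hH; apply: contraPP => HD; apply/negP; rewrite -leNgt.
apply: le_trans c0; apply: sumr_le0 => y _.
have [y0|y0] := leP (val y) 0; first by rewrite mulr_le0_ge0// pr_ge0.
rewrite (_ : mpr _ _ _ = 0) ?mulr0//; apply/eqP.
rewrite eq_le pr_ge0 andbT leNgt; apply/negP => /carried_meets[]//.
  exact: (@measurable_sfunP _ _ _ _ h _ (measurable_set1 _)).
by move=> x hx Dx; apply: HD; exists x; split => //; apply: hH; rewrite hx.
Qed.

(** The tiles of rank less than N1 use H1 and the others H2. The mean over the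
    large cube is then a barycentre of a point of H1, a point of H2 and a point
    of Q, by convexity of these sets within D, and so lies in V. *)
Lemma supermult_two_types :
  ((expR (N1%:R * (ln kappa + vm * u1) + N2%:R * (ln kappa + vm * u2) +
          nI%:R * (ln a - tau)))%:E
  <= \int[cramer (fun L => nu L) n]_(x in V) (expR (vn * l x))%:E)%E.
Proof.
have [h1 [h1f h1H h1u]] := simple_below (mu := cramer_measure m0) (fun=> expR_ge0 _) Hu1.
have [h2 [h2f h2H h2u]] := simple_below (mu := cramer_measure m0) (fun=> expR_ge0 _) Hu2.
pose r := (fset_set (range h1) `|` fset_set (range h2))%fset.
have f1 : finite_set (range h1) by [].
have f2 : finite_set (range h2) by [].
have h1r x : h1 x \in r.
  by rewrite /r inE; apply/orP; left; rewrite in_fset_set// inE; exists x.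
have h2r x : h2 x \in r.
  by rewrite /r inE; apply/orP; right; rewrite in_fset_set// inE; exists x.
have r0 y : y \in r -> 0 <= y.
  by rewrite inE => /orP[]; rewrite in_fset_set// inE => -[x _ <-].
move/(sum_levels h1r) : h1u => h1u; move/(sum_levels h2r) : h2u => h2u.
have ne1 := level_nonempty (expR_ge0 _) h1H h1u.
have ne2 := level_nonempty (expR_ge0 _) h2H h2u.
pose h b := if first b then h1 else h2.
have hr b x : h b x \in r by rewrite /h; case: ifP.
have hl b x : h b x <= expR (vm * l x) by rewrite /h; case: ifP.
have kappa_ge0 := ltW kappa_gt0.
apply: le_trans (supermult_simple kappa_ge0 hr r0 ml hl hQ (ltW a0) Ql sV _).
  pose s1 := \sum_(y : r) val y * mpr nu m (h1 @^-1` [set val y]).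
  pose s2 := \sum_(y : r) val y * mpr nu m (h2 @^-1` [set val y]).
  rewrite (bigID first)/= (eq_bigr (fun=> kappa * s1)) => [|b fb]; last by rewrite /h fb.
  rewrite prodr_const card_first.
  rewrite (eq_bigr (fun=> kappa * s2)) => [|b fb]; last by rewrite /h (negbTE fb).
  rewrite (_ : \prod_(b | ~~ first b) (kappa * s2) = (kappa * s2) ^+ N2); last first.
    by rewrite prodr_const card_last.
  have x1y1 : kappa * expR (vm * u1) <= kappa * s1 by rewrite ler_wpM2l// ltW.
  have x2y2 : kappa * expR (vm * u2) <= kappa * s2 by rewrite ler_wpM2l// ltW.
  have x10 : 0 <= kappa * expR (vm * u1) by rewrite mulr_ge0 ?expR_ge0.
  have x20 : 0 <= kappa * expR (vm * u2) by rewrite mulr_ge0 ?expR_ge0.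
  have -> : N1%:R * (ln kappa + vm * u1) + N2%:R * (ln kappa + vm * u2) +
      nI%:R * (ln a - tau) = N1%:R * (ln kappa + vm * u1) +
      N2%:R * (ln kappa + vm * u2) + nI%:R * ln a + - (tau * nI%:R) by ring.
  rewrite lee_fin !expRD !expRM_natl !expRD !lnK ?posrE//.
  rewrite ler_wpM2r ?expR_ge0// ler_wpM2r ?exprn_ge0 ?(ltW a0)//.
  apply: ler_pM; rewrite ?exprn_ge0//.
  - by apply: lerXn2r; rewrite ?nnegrE// (le_trans x10).
  - by apply: lerXn2r; rewrite ?nnegrE// (le_trans x20).
move=> w Dw hpos Qw.
have wD b : D (mean (tile b) w).
  by apply: convex_set_mean => //; exact: box_tile.
have [|x1 x1P s1] := @convex_set_sum _ _ _ _ (index_enum _) first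
  (fun b => mean (tile b) w) cH1 ne1.
  by move=> b fb; split=> //; apply: h1H; have := hpos b; rewrite /h fb.
have [|x2 x2P s2] := @convex_set_sum _ _ _ _ (index_enum _) [predC first]
  (fun b => mean (tile b) w) cH2 ne2.
  move=> b fb; split=> //; apply: h2H.
  have fb' : first b = false by apply/negbTE.
  by have := hpos b; rewrite /h fb'.
have fI : finite_set interstice by exact: finite_interstice.
have [|q qP sq] := @convex_set_sum _ _ _ _ (fset_set interstice)
  (fun z => z \in fset_set interstice) w cQ site_nonempty.
  by move=> z; rewrite in_fset_set// inE => Iz; split => //; exact: Qw.
have -> : mean (cube n) w = vn^-1 *: (vn *: mean (cube n) w).
  by rewrite scalerA mulVf ?scale1r// gt_eqF// vol_gt0.
rewrite sum_cube_tiles -scaler_sumr (bigID first)/=.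
rewrite (_ : \sum_(b | ~~ first b) _ = N2%:R *: x2); last first.
  by rewrite s2 count_card card_last.
rewrite s1 count_card card_first.
rewrite (_ : \sum_(z \in interstice) w z = nI%:R *: q); last first.
  rewrite fsbig_finite// big_seq sq; congr (_%:R *: _).
  by apply/eqP; rewrite -all_count; apply/allP.
rewrite !scalerDr !scalerA.
have := hV x1P x2P qP.
by rewrite ![_ / vn]mulrC ![N1%:R * vm]mulrC ![N2%:R * vm]mulrC !mulrA.
Qed.

End two_types.

End supermultiplicativity.

Section asymptotics.
Context {R : realType} {X : measTvsType R} {d : nat}.
Hypothesis d0 : (0 < d)%N.
Local Notation Zd := 'rV[int]_d.
Variable nu : forall L : set Zd, probability (confS X L) R.
Hypothesis nuP : is_scit nu.
Variable D : set X.
Hypotheses (cD : convex_set D).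
Hypothesis nuD : carried (fun L => nu L) [set w | forall z, D (w z)].
Local Notation v n := (vol (cube n : set Zd) : R).

Lemma bernoulli_ineq (x : R) j : 0 <= x <= 1 -> 1 - j%:R * x <= (1 - x) ^+ j.
Proof.
move=> /andP[x0 x1]; elim: j => [|j IH]; first by rewrite mul0r subr0 expr0.
rewrite exprS; apply: le_trans (ler_wpM2l _ IH); last by rewrite subr_ge0.
have jx : 0 <= j%:R * (x * x) by rewrite !mulr_ge0.
rewrite -natr1; lra.
Qed.

(** The uncovered fraction is at most G/m, for the gaps, plus m/n, for the
    boundary, in each of the d directions; Bernoulli's inequality adds them
    up. *)
Lemma paving_density (m G n : nat) : (0 < m)%N -> (0 < n)%N ->
  1 - d%:R * (G%:R / m%:R + m%:R / n%:R) <=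
    ((n %/ (m + G)) ^ d)%:R * v m / v n <= 1.
Proof.
move=> m0 n0; pose p := (m + G)%N; rewrite -/p; set k := (n %/ p)%N.
have p0 : (0 < p)%N by rewrite /p addn_gt0 m0.
have pR : 0 < p%:R :> R by rewrite ltr0n.
have mR : 0 < m%:R :> R by rewrite ltr0n.
have nR : 0 < n%:R :> R by rewrite ltr0n.
have -> : (k ^ d)%:R * v m / v n = (k%:R * m%:R / n%:R) ^+ d :> R.
  by rewrite !vol_cube !natrX -exprMn -expr_div_n.
have kp : (k * p <= n)%N := leq_divM n p.
have km : k%:R * m%:R <= n%:R :> R.
  by rewrite -natrM ler_nat (leq_trans _ kp)// leq_mul2l leq_addr orbT.
have nk : n%:R <= (k%:R + 1) * p%:R :> R.
  by rewrite natr1 -natrM ler_nat; apply: ltnW; exact: ltn_ceil.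
set y := k%:R * m%:R / n%:R; have y1 : y <= 1 by rewrite ler_pdivrMr// mul1r.
have y0 : 0 <= y by rewrite divr_ge0// mulr_ge0.
apply/andP; split; last by rewrite exprn_ile1.
have -> : y = 1 - (1 - y) by ring.
apply: le_trans (bernoulli_ineq _ _); last by rewrite subr_ge0 y1 lerBlDr lerDl.
rewrite lerD2l lerN2 ler_wpM2l// lerBlDr.
rewrite -(ler_pM2r nR) !mulrDl mul1r /y !divfK ?gt_eqF//.
have hp : p%:R = m%:R + G%:R :> R by rewrite natrD.
apply: (@le_trans _ _ (G%:R / p%:R * n%:R + m%:R + k%:R * m%:R)); last first.
  rewrite -!addrA lerD2r ler_pM2r// ler_wpM2l// lef_pV2 ?posrE// hp lerDl//.
rewrite -(ler_pM2r pR).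
have -> : (G%:R / p%:R * n%:R + m%:R + k%:R * m%:R) * p%:R =
    G%:R * n%:R + m%:R * ((k%:R + 1) * p%:R) :> R by field; rewrite gt_eqF.
have h : m%:R * n%:R <= m%:R * ((k%:R + 1) * p%:R) :> R by rewrite ler_pM2l.
by rewrite {1}hp; lra.
Qed.

(** The arithmetic of supermult_asym: rho is the density of the tiles in the
    large cube, n1 the proportion of tiles that use H1, cc the cost of the
    decoupling per site, and L the cost of controlling an interstitial site. *)
Lemma mixture_rates (t e rho n1 cc u1 u2 L : R) :
  let eta := e * (3 * `|u1| + 3 * `|u2| + 2 * `|L| + 4) in
  0 <= t <= 1 -> 0 <= e -> 1 - 2 * e <= rho <= 1 -> 0 <= rho ->
  0 <= n1 -> t - e <= n1 <= t -> 0 <= cc <= e ->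
  [/\ `|n1 * rho - t| <= eta, `|(1 - n1) * rho - (1 - t)| <= eta,
     1 - rho <= eta &
     t * u1 + (1 - t) * u2 - eta <=
     n1 * rho * (u1 - cc) + (1 - n1) * rho * (u2 - cc) + (1 - rho) * L].
Proof.
move=> eta /andP[t0 t1] e0 /andP[r1 r2] rho0 n0 /andP[n1t n1t'] /andP[c0 c1].
have e_eta : 4 * e <= eta.
  by rewrite /eta mulrC ler_wpM2l// lerDr !addr_ge0// mulr_ge0.
have h1 : `|n1 * rho - t| <= 3 * e by rewrite ler_norml; apply/andP; split; nra.
have h2 : `|(1 - n1) * rho - (1 - t)| <= 3 * e.
  by rewrite ler_norml; apply/andP; split; nra.
have h3 : `|1 - rho| <= 2 * e by rewrite ler_norml; apply/andP; split; lra.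
split; [lra|lra|lra|].
have k1 : - (3 * e * `|u1|) <= (n1 * rho - t) * u1.
  by rewrite lerNl -mulNr (le_trans (ler_norm _))// normrM normrN ler_wpM2r.
have k2 : - (3 * e * `|u2|) <= ((1 - n1) * rho - (1 - t)) * u2.
  by rewrite lerNl -mulNr (le_trans (ler_norm _))// normrM normrN ler_wpM2r.
have k3 : - (2 * e * `|L|) <= (1 - rho) * L.
  by rewrite lerNl -mulNr (le_trans (ler_norm _))// normrM normrN ler_wpM2r.
have k4 : rho * cc <= e by rewrite -[leRHS]mul1r ler_pM.
rewrite /eta; lra.
Qed.

Hypothesis nuadi : adi (fun L => nu L).

(** Along large cubes the exponential integrals are almost supermultiplicative:
    a proportion close to t of the tiles is used with H1, the others with H2,
    and the control Q on the few remaining sites costs little. *)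
Lemma supermult_asym (l : {scalar X}) (Q : set X) (a tau u1 u2 t eta : R) :
  measurable_fun [set: mspace X] (l : mspace X -> R) ->
  site_bound nu Q a -> 0 < a -> convex_set (Q `&` D) ->
  (forall q, Q q -> - tau <= l q) -> 0 <= t <= 1 -> 0 < eta ->
  \forall m \near \oo, forall H1 H2,
    convex_set (H1 `&` D) -> convex_set (H2 `&` D) ->
    ((expR (v m * u1))%:E <
     \int[cramer (fun L => nu L) m]_(x in H1) (expR (v m * l x))%:E)%E ->
    ((expR (v m * u2))%:E <
     \int[cramer (fun L => nu L) m]_(x in H2) (expR (v m * l x))%:E)%E ->
  \forall n \near \oo, exists t1 t2 t3 : R,
    [/\ [/\ 0 <= t1, 0 <= t2, 0 <= t3 & t1 + t2 + t3 = 1],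
       [/\ `|t1 - t| <= eta, `|t2 - (1 - t)| <= eta & t3 <= eta] &
       forall V, sigalg V ->
       (forall x1 x2 q, (H1 `&` D) x1 -> (H2 `&` D) x2 -> (Q `&` D) q ->
          V (t1 *: x1 + t2 *: x2 + t3 *: q)) ->
       ((expR (v n * (t * u1 + (1 - t) * u2 - eta)))%:E <=
        \int[cramer (fun L => nu L) n]_(x in V) (expR (v n * l x))%:E)%E].
Proof.
move=> ml hQ a0 cQ Ql t01 eta0.
have [g [c [gc0 gm cm dec]]] := nuadi.
pose K := 3 * `|u1| + 3 * `|u2| + 2 * `|ln a - tau| + 4.
have K0 : 0 < K by rewrite ltr_wpDl// !addr_ge0// mulr_ge0.
pose e := eta / K.
have e0 : 0 < e by rewrite divr_gt0.
have etaE : e * K = eta by rewrite divfK// gt_eqF.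
have dR : 0 < d%:R :> R by rewrite ltr0n.
near=> m.
have m0 : (0 < m)%N by near: m; exact: nbhs_infty_gt.
have mR : 0 < m%:R :> R by rewrite ltr0n.
have [g0 c0] := gc0 _ m0.
have gme : g m / m%:R <= e / d%:R.
  apply: (le_trans (ler_norm _)); near: m.
  by apply: cvgr0_norm_le => //; exact: divr_gt0.
have cme : c m / v m <= e.
  apply: (le_trans (ler_norm _)); near: m.
  exact: cvgr0_norm_le.
move=> H1 H2 cH1 cH2 Hu1 Hu2.
pose G := Num.truncn (g m).
pose p := (m + G)%N.
have p0 : (0 < p)%N by rewrite addn_gt0 m0.
have pR : 0 < p%:R :> R by rewrite ltr0n.
near=> n.
have n0 : (0 < n)%N by near: n; exact: nbhs_infty_gt.
have nR : 0 < n%:R :> R by rewrite ltr0n.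
have nm : m%:R / n%:R <= e / d%:R.
  rewrite ler_pdivrMr// mulrC -ler_pdivrMr ?divr_gt0//.
  by near: n; exact: nbhs_infty_ger.
pose k := (n %/ p)%N.
have kR : e^-1 <= k%:R.
  have : (e^-1 + 1) * p%:R <= n%:R by near: n; exact: nbhs_infty_ger.
  have : n%:R <= (k%:R + 1) * p%:R :> R.
    by rewrite natr1 -natrM ler_nat; apply: ltnW; exact: ltn_ceil.
  by move=> /[swap] /le_trans /[apply]; rewrite ler_pM2r// lerD2r.
have k0 : (0 < k)%N by rewrite -(ltr0n R) (lt_le_trans _ kR)// invr_gt0.
pose N := (k ^ d)%N.
have N0 : 0 < N%:R :> R by rewrite ltr0n expn_gt0 k0.
have NR : N%:R^-1 <= e.
  rewrite -[e]invrK lef_pV2 ?posrE ?invr_gt0// (le_trans kR)// ler_nat.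
  by rewrite /N -{1}(expn1 k) leq_pexp2l.
pose rho := N%:R * v m / v n.
have vm0 : 0 < v m by exact: vol_gt0.
have vn0 : 0 < v n by exact: vol_gt0.
have /andP[rho1 rho2] : 1 - 2 * e <= rho <= 1.
  have /andP[h1 h2] := paving_density G m0 n0.
  apply/andP; split; last exact: h2.
  have Gm : G%:R / m%:R <= e / d%:R.
    by apply: (le_trans _ gme); rewrite ler_wpM2r ?invr_ge0 ?(ltW mR)// /G truncn_le.
  apply: (le_trans _ h1); rewrite lerD2l lerN2.
  apply: (le_trans (ler_wpM2l (ltW dR) (lerD Gm nm))).
  by rewrite mulrDr mulrC divfK ?gt_eqF//; lra.
have rho0 : 0 <= rho by rewrite divr_ge0// ?mulr_ge0// ltW.
pose N1 := Num.truncn (t * N%:R).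
have [t0 t1] := andP t01.
have tN0 : 0 <= t * N%:R by rewrite mulr_ge0// ltW.
have N1N : N1%:R <= t * N%:R by rewrite /N1 truncn_le.
have N1le : (N1 <= N)%N.
  by rewrite -(ler_nat R) (le_trans N1N)// ler_piMl// ltW.
have cc0 : 0 <= c m / v m by rewrite divr_ge0// ltW.
have n1t : t - e <= N1%:R / N%:R <= t.
  apply/andP; split; last by rewrite ler_pdivrMr.
  have : t * N%:R < N1%:R + 1 by rewrite natr1 truncnS_gt.
  rewrite -ltr_pdivlMr// mulrDl mul1r => h; rewrite lerBlDr ltW// (lt_le_trans h)//.
  by rewrite lerD2l.
have [b1 b2 b3 b4] := @mixture_rates t e rho (N1%:R / N%:R) (c m / v m) u1 u2
  (ln a - tau) t01 (ltW e0) (introT andP (conj rho1 rho2)) rho0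
  (divr_ge0 (ler0n _ _) (ltW N0)) n1t (introT andP (conj cc0 cme)).
rewrite -/K etaE in b1 b2 b3 b4.
exists (N1%:R / N%:R * rho), ((1 - N1%:R / N%:R) * rho), (1 - rho); split.
- split; last by ring.
  + by rewrite mulr_ge0// divr_ge0// ltW.
  + by rewrite mulr_ge0// subr_ge0; case/andP: n1t => _ /le_trans; apply.
  + by rewrite subr_ge0.
- by [].
move=> V sV hV.
have pkn : (p * k <= n)%N by rewrite mulnC leq_divM.
have mp : (m <= p)%N by rewrite leq_addr.
have decm : decoupled nu m (g m) (expR (- c m)).
  by move=> S A B fS mA mB gS L bL mL SL; exact: (dec _ _ _ _ m0 fS mA mB gS).
have gp : g m < (p - m).+1%:R by rewrite /p addKn truncnS_gt.
have N12 : (N1 + (N - N1) = k ^ d)%N by rewrite subnKC.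
pose I := #|` fset_set (@interstice d m p k n)|.
have NmI : v n = N%:R * v m + I%:R.
  have := @vol_paving d m p k n mp pkn R; rewrite -vol_cube => ->.
  by rewrite natrM vol_cube.
have t1E : N1%:R / N%:R * rho = N1%:R * v m / v n.
  by rewrite /rho; field; rewrite !gt_eqF.
have N2R : (N - N1)%:R = N%:R - N1%:R :> R by rewrite natrB.
have t2E : (1 - N1%:R / N%:R) * rho = (N - N1)%:R * v m / v n.
  by rewrite /rho N2R; field; rewrite !gt_eqF.
have t3E : 1 - rho = I%:R / v n.
  have -> : I%:R = v n - N%:R * v m by rewrite NmI addrC addKr.
  by rewrite /rho; field; rewrite gt_eqF.
apply: le_trans (supermult_two_types nuP cD nuD m0 decm mp pkn n0 gp N12 sV cH1 cH2
  cQ ml hQ a0 Ql Hu1 Hu2 _ (expR_gt0 _)).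
  rewrite lee_fin ler_expR expRK.
  have -> : N1%:R * (- c m + v m * u1) + (N - N1)%:R * (- c m + v m * u2) +
      I%:R * (ln a - tau) =
      v n * (N1%:R / N%:R * rho * (u1 - c m / v m) +
        (1 - N1%:R / N%:R) * rho * (u2 - c m / v m) + (1 - rho) * (ln a - tau)).
    by rewrite t1E t2E t3E; field; rewrite !gt_eqF.
  by rewrite ler_pM2l.
move=> x1 x2 q Hx1 Hx2 Hq; have := hV x1 x2 q Hx1 Hx2 Hq.
by rewrite t1E t2E t3E.
Unshelve. all: by end_near.
Qed.

End asymptotics.

(** * Exponential rates and compactness *)

Section rates.
Context {R : realType}.
Implicit Types (f : (\bar R)^nat) (u : \bar R) (v r : R).

Lemma limn_esup_le_near f u : (\forall n \near \oo, (f n <= u)%E) ->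
  (limn_esup f <= u)%E.
Proof.
move=> fu; rewrite /limn_esup limf_esupE.
apply: (@le_trans _ _ (ereal_sup (f @` [set n | (f n <= u)%E]))).
  by apply: ereal_inf_lbound; exists [set n | (f n <= u)%E].
by apply: ge_ereal_sup => _ [n fn <-].
Qed.

Lemma limn_esup_gt_frequently f u (P : set nat) : (u < limn_esup f)%E ->
  (\forall n \near \oo, P n) -> exists2 n, P n & (u < f n)%E.
Proof.
move=> uf nP; have : (u < ereal_sup (f @` P))%E.
  apply: (lt_le_trans uf); rewrite /limn_esup limf_esupE.
  by apply: ereal_inf_lbound; exists P.
by move=> /ereal_sup_gt[_ [n Pn <-] ufn]; exists n.
Qed.

Lemma limn_einf_ge_near f u : (\forall n \near \oo, (u <= f n)%E) ->
  (u <= limn_einf f)%E.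
Proof.
move=> uf; rewrite /limn_einf leeNr; apply: limn_esup_le_near.
by apply: filterS uf => n; rewrite /= leeN2.
Qed.

Lemma limn_einf_gt_near f u : (u < limn_einf f)%E ->
  \forall n \near \oo, (u < f n)%E.
Proof.
rewrite /limn_einf lteNr /limn_esup limf_esupE => /ereal_inf_lt[_ [V nV <-] Vu].
apply: filterS nV => n Vn; rewrite -lteN2; apply: le_lt_trans Vu.
by apply: ereal_sup_ubound; exists n.
Qed.

Lemma limn_esup_lt_near f u : (limn_esup f < u)%E ->
  \forall n \near \oo, (f n < u)%E.
Proof.
rewrite /limn_esup limf_esupE => /ereal_inf_lt[_ [V nV <-] Vu].
apply: filterS nV => n Vn; apply: le_lt_trans Vu.
by apply: ereal_sup_ubound; exists n.
Qed.

Lemma cvg_limn_esup f : (limn_esup f <= limn_einf f)%E ->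
  f n @[n --> \oo] --> limn_esup f.
Proof.
move=> fle; have fE : limn_einf f = limn_esup f.
  by apply/eqP; rewrite eq_le fle limn_einf_sup.
apply: (@squeeze_cvge _ _ _ _ (einfs f) _ (esups f)).
- apply: nearW => n; apply/andP; split.
    by apply: ereal_inf_lbound; exists n => /=.
  by apply: ereal_sup_ubound; exists n => /=.
- by rewrite -fE limn_einf_lim; exact: is_cvg_einfs.
- by rewrite limn_esup_lim; exact: is_cvg_esups.
Qed.

Lemma lee_real_lt (x y : \bar R) : (forall r : R, (r%:E < x)%E -> (r%:E <= y)%E) ->
  (x <= y)%E.
Proof.
move=> h; rewrite leNgt; apply/negP => yx.
have [r yr rx] : exists2 r : R, (y < r%:E)%E & (r%:E < x)%E.
  move: x y yx {h} => [x| |] [y| |]//=.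
  - by rewrite lte_fin => yx; exists ((x + y) / 2); rewrite lte_fin; lra.
  - by move=> _; exists (x - 1); rewrite ?ltNyr// lte_fin; lra.
  - by move=> _; exists (y + 1); rewrite ?ltry// lte_fin; lra.
  - by move=> _; exists 0; rewrite ?ltNyr ?ltry.
by have := h r rx; rewrite leNgt yr.
Qed.

Lemma le_limn_esup_near (g h : (\bar R)^nat) :
  (\forall n \near \oo, (g n <= h n)%E) -> (limn_esup g <= limn_esup h)%E.
Proof.
move=> gh; apply: lee_real_lt => r rg; rewrite leNgt; apply/negP => /limn_esup_lt_near hr.
have [n [ghn hn]] := limn_esup_gt_frequently rg (filterI gh hr).
by rewrite ltNge (ltW (le_lt_trans ghn hn)).
Qed.

Lemma limn_esup_near (g h : (\bar R)^nat) :
  (\forall n \near \oo, g n = h n) -> limn_esup g = limn_esup h.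
Proof.
move=> gh; apply/eqP; rewrite eq_le; apply/andP; split; apply: le_limn_esup_near;
  by apply: filterS gh => n ->.
Qed.

Lemma limn_einf_near (g h : (\bar R)^nat) :
  (\forall n \near \oo, g n = h n) -> limn_einf g = limn_einf h.
Proof.
move=> gh; rewrite /limn_einf; congr (- _)%E; apply: limn_esup_near.
by apply: filterS gh => n /= ->.
Qed.

Lemma lt_rateE v r (y : \bar R) : 0 < v -> (0 <= y)%E ->
  (r%:E < v^-1%:E * lne y)%E = ((expR (v * r))%:E < y)%E.
Proof.
move=> v0 y0; rewrite lte_pdivlMl// -EFinM -[X in (X%:E < lne _)%E](expRK (v * r)).
by rewrite -lne_EFin ?expR_gt0// lte_lne// in_itv/= ?leey ?andbT.
Qed.

Lemma le_rateE v r (y : \bar R) : 0 < v -> (0 <= y)%E ->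
  (r%:E <= v^-1%:E * lne y)%E = ((expR (v * r))%:E <= y)%E.
Proof.
move=> v0 y0; rewrite lee_pdivlMl// -EFinM -[X in (X%:E <= lne _)%E](expRK (v * r)).
by rewrite -lne_EFin ?expR_gt0// lee_lne// in_itv/= ?leey ?andbT.
Qed.

Lemma rate_leE v r (y : \bar R) : 0 < v -> (0 <= y)%E ->
  (v^-1%:E * lne y <= r%:E)%E = (y <= (expR (v * r))%:E)%E.
Proof. by move=> v0 y0; rewrite leNgt lt_rateE// leNgt. Qed.

End rates.

(** Otherwise the sets whose complement in K is good form a proper filter, and
    a good neighbourhood of one of its cluster points contradicts clustering. *)
Lemma compact_induction {T : topologicalType} (P : set T -> Prop) (K : set T) :
  P set0 -> (forall A B, P A -> P B -> P (A `|` B)) ->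
  (forall A B, A `<=` B -> P B -> P A) ->
  compact K -> (forall x, K x -> exists2 U, nbhs x U & P U) -> P K.
Proof.
move=> P0 PU PS cK KP; apply: contrapT => nPK.
pose F : set_system T := [set A | P (K `\` A)].
have FF : ProperFilter F.
  split; first by rewrite /F /= setD0.
  split.
  - by rewrite /F /= setDT.
  - move=> A B FA FB; rewrite /F /= setDIr; exact: PU.
  - move=> A B AB; rewrite /F /=; apply: PS => x [Kx nBx].
    by split=> // /AB.
have [|x [Kx clx]] := cK F FF; first by rewrite /F /= setDv.
have [U nU PUx] := KP x Kx.
have [|y [nUy Uy]] := clx (~` U) U _ nU; last exact: nUy.
by rewrite /F /= setDE setCK; apply: PS PUx => y [].
Qed.

(** * Internal convex sets and local control *)

Section dilates.
Context {R : realType} {X : lmodType R}.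
Implicit Types (C A B : set X) (x y : X) (r s t : R).

Lemma convex_set_intro A : (forall x y s t, 0 <= s -> 0 <= t -> s + t = 1 ->
  A x -> A y -> A (s *: x + t *: y)) -> convex_set A.
Proof.
move=> h; apply/convex_setW => x y /set_mem Ax /set_mem Ay k k0 k1.
apply/mem_set; rewrite /conv/= /unstable.onem.
by apply: h => //; rewrite ?subr_ge0 ?(ltW k0) ?(ltW k1)// addrC subrK.
Qed.

Lemma convex_setI A B : convex_set A -> convex_set B -> convex_set (A `&` B).
Proof.
move=> /convex_set_comb cA /convex_set_comb cB; apply: convex_set_intro.
by move=> x y s t s0 t0 st [Ax Bx] [Ay By]; split; [exact: cA|exact: cB].
Qed.

Lemma convex_dilate t C : convex_set C -> convex_set (dilate t C).
Proof.
move=> /convex_set_comb cC; apply: convex_set_intro => x y s u s0 u0 su.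
move=> [x' Cx <-] [y' Cy <-]; exists (s *: x' + u *: y'); first exact: cC.
by rewrite scalerDr !scalerA ![t * _]mulrC.
Qed.

Lemma convex_translate x C : convex_set C -> convex_set (translate x C).
Proof.
move=> /convex_set_comb cC; apply: convex_set_intro => y z s u s0 u0 su.
move=> [y' Cy <-] [z' Cz <-]; exists (s *: y' + u *: z'); first exact: cC.
by rewrite !scalerDr addrACA -scalerDl su scale1r.
Qed.

Lemma dilateP t C x : t != 0 -> dilate t C x <-> C (t^-1 *: x).
Proof.
move=> t0; split=> [[y Cy <-]|Cx]; first by rewrite scalerA mulVf// scale1r.
by exists (t^-1 *: x); rewrite // scalerA divff// scale1r.
Qed.

Lemma translateP x C y : translate x C y <-> C (y - x).
Proof.
split=> [[z Cz <-]|Cy]; first by rewrite addrAC subrr add0r.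
by exists (y - x); rewrite // addrC subrK.
Qed.

Section internal_set.
Variable C : set X.
Hypothesis iC : internal C.

Lemma internal_convex : convex_set C. Proof. by case: iC. Qed.

Lemma internal_gauge x : exists2 t, 0 <= t & dilate t C x.
Proof.
have [_ /(_ x) + _] := iC; move=> /ereal_inf_lt[_ [t [t0 Cx] <-] _].
by exists t.
Qed.

Lemma internal0 : C 0.
Proof.
have [t _ [y Cy _]] := internal_gauge 0.
have [_ _ ->] := iC; rewrite /= (@le_lt_trans _ _ 0%E)//.
apply: ereal_inf_lbound; exists 0 => //; split=> //.
by exists y => //; rewrite scale0r.
Qed.

Lemma internal_absorbing x : exists2 r, 0 < r & C (r^-1 *: x).
Proof.
have [t t0 Cx] := internal_gauge x; move: t0; rewrite le_eqVlt => /predU1P[t0|t0].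
  exists 1 => //; move: Cx => [y _]; rewrite -t0 scale0r => <-.
  by rewrite scaler0; exact: internal0.
by exists t => //; apply/dilateP => //; rewrite gt_eqF.
Qed.

Lemma dilateD r s x y : 0 <= r -> 0 <= s -> dilate r C x -> dilate s C y ->
  dilate (r + s) C (x + y).
Proof.
move=> r0 s0 [x' Cx <-] [y' Cy <-].
have [rs|rs] := eqVneq (r + s) 0.
  have /andP[/eqP -> /eqP ->] : (r == 0) && (s == 0) by rewrite -paddr_eq0// rs.
  by exists 0; [exact: internal0|rewrite scaler0 !scale0r addr0].
have rs0 : 0 < r + s by rewrite lt_neqAle eq_sym rs addr_ge0.
exists ((r / (r + s)) *: x' + (s / (r + s)) *: y').
  apply: (convex_set_comb internal_convex) => //; rewrite ?divr_ge0 ?(ltW rs0)//.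
  by rewrite -mulrDl divff.
by rewrite scalerDr !scalerA ![(r + s) * _]mulrC !divfK.
Qed.

Lemma dilate_sub1 r x : 0 <= r <= 1 -> dilate r C x -> C x.
Proof.
move=> /andP[r0 r1] [y Cy <-].
have := convex_set_comb internal_convex (t := 1 - r) r0 _ _ Cy (internal0).
by rewrite scaler0 addr0; apply; [rewrite subr_ge0|rewrite addrC subrK].
Qed.

Lemma dilateZ (a r : R) x : symmetric_set C -> dilate r C x ->
  dilate (`|a| * r) C (a *: x).
Proof.
move=> sC [y Cy <-]; have [a0|a0] := ger0P a.
  by exists y => //; rewrite scalerA.
by exists (- y); [exact: sC|rewrite scalerN scalerA mulNr scaleNr opprK].
Qed.

Lemma internal_dilate a : 0 < a -> internal (dilate a C).
Proof.
move=> a0; have aE t x : dilate t (dilate a C) x <-> dilate t C (a^-1 *: x).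
  split=> [[_ [y Cy <-] <-]|[y Cy yx]].
    by exists y => //; rewrite !scalerA mulrCA mulVf ?mulr1 ?gt_eqF.
  exists (a *: y); first by exists y.
  rewrite scalerA mulrC -scalerA yx scalerA divff ?scale1r// gt_eqF//.
have gE x : gauge (dilate a C) x = gauge C (a^-1 *: x).
  rewrite /gauge; congr ereal_inf; congr (_ @` _).
  by apply/seteqP; split => t [t0 /aE].
have [_ fC CE] := iC; split.
- exact: convex_dilate internal_convex.
- by move=> x; rewrite gE.
- have CP y : C y <-> (gauge C y < 1)%E by rewrite {1}CE.
  have an0 : a != 0 by rewrite gt_eqF.
  by apply/seteqP; split => x /=; rewrite gE; [move=> /(dilateP _ _ an0)/CP|
    move=> /CP/(dilateP _ _ an0)].
Qed.

End internal_set.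

End dilates.

Section local_control.
Context {R : realType} {X : measTvsType R} {d : nat}.
Local Notation Zd := 'rV[int]_d.

(** The open symmetric elements of C_0(F): for a projective limit, their
    preimages under the maps f_i are the fundamental neighbourhoods of 0. *)
Definition open_internal : set (set X) :=
  [set C | [/\ meas_internal C, symmetric_set C & open C]].

Lemma scale_fun_continuous (E : tvsType R) (a : R) : continuous (fun x : E => a *: x).
Proof.
move=> x U Ux; have [/= [B1 B2] [/= B1a B2x] BU] := @scale_continuous R E (a, x) U Ux.
apply: filterS B2x => y B2y; apply: (BU (a, y)); split => //=.
exact: nbhs_singleton.
Qed.

Hypothesis stX : dil_trans_stable X.

Lemma meas_internal_dilate (a : R) (C : set X) : 0 < a -> meas_internal C ->
  meas_internal (dilate a C).
Proof.
move=> a0 [sC iC]; split; last exact: internal_dilate.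
by apply: stX.1 => //; rewrite gt_eqF.
Qed.

Lemma open_internal_dilate (a : R) (C : set X) : 0 < a -> open_internal C ->
  open_internal (dilate a C).
Proof.
move=> a0 [mC sC oC]; split; first exact: meas_internal_dilate.
  by move=> _ [y Cy <-]; exists (- y); [exact: sC|rewrite scalerN].
have -> : dilate a C = (fun x => a^-1 *: x) @^-1` C.
  by apply/seteqP; split => x /(@dilateP _ _ _ _ _ (negbT (gt_eqF a0))).
by apply: open_comp => // x _; exact: scale_fun_continuous.
Qed.

Variable nu : forall L : set Zd, probability (confS X L) R.
Hypothesis nuP : is_scit nu.

Lemma cl_site_bound (C : set X) : cl (fun L => nu L) -> meas_internal C ->
  exists s a, [/\ 0 < s, 0 < a & site_bound nu (dilate s C) a].
Proof.
move=> [t [alpha h]] mC; have [t0 a0 hC] := h C mC.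
exists (t C), (alpha C); split => //; apply: cond_prob_site_bound => //.
- by apply: stX.1; [rewrite gt_eqF|case: mC].
- exact: ltW.
- by move=> L bL _; exact: hC.
Qed.

Lemma ctl_site_bound (D : set X) (gamma : R) : ctl (fun L => nu L) D ->
  0 < gamma < 1 -> exists K, [/\ convex_set (K `&` D),
    compact (closure (K `&` D)) & site_bound nu K (1 - gamma)].
Proof.
move=> h /andP[g0 g1]; have [K [sK cK kK hK]] := h gamma g0.
exists K; split => //; apply: cond_prob_site_bound => //.
by rewrite subr_ge0 ltW.
Qed.

Lemma site_boundI (Q Q' : set X) (a gamma : R) : site_bound nu Q a ->
  site_bound nu Q' (1 - gamma) -> site_bound nu (Q `&` Q') (a - gamma).
Proof.
move=> [sQ hQ] [sQ' hQ']; split.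
  by have := @measurableI _ (mspace X) Q Q' sQ sQ'.
move=> L z B bL Lz mB; have h1 := hQ L z B bL Lz mB; have h2 := hQ' L z B bL Lz mB.
have mBL : mean_alg L B by apply: mean_alg_mono mB; exact: subDsetl.
have mQ : mean_alg L [set w | Q (w z)] by exact: mean_alg_site.
have mQ' : mean_alg L [set w | Q' (w z)] by exact: mean_alg_site.
have e1 := pr_setID nu mQ' mBL.
have e2 := pr_setID nu mQ' (mean_algI mQ mBL).
have h3 : pr nu L (~` [set w | Q' (w z)] `&` ([set w | Q (w z)] `&` B)) <=
    pr nu L (~` [set w | Q' (w z)] `&` B).
  apply: pr_le; [| |by move=> w [? [? ?]]].
  - by apply: mean_algI; [exact: mean_algC|exact: mean_algI].
  - by apply: mean_algI => //; exact: mean_algC.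
have -> : [set w | (Q `&` Q') (w z)] `&` B =
    [set w | Q' (w z)] `&` ([set w | Q (w z)] `&` B).
  by apply/seteqP; split => w /= [] => [[]|? []].
by lra.
Qed.

End local_control.

(** * Entropy and pressure on one space *)

Section one_space.
Context {R : realType} {X : measTvsType R} {d : nat}.
Hypothesis d0 : (0 < d)%N.
Local Notation Zd := 'rV[int]_d.
Variable C0 : set (set X).
Hypothesis hX : is_evlcm C0.

Let stX : dil_trans_stable X := evlcm_stable hX.

Lemma sigalg_translate x (A : set X) : sigalg A -> sigalg (translate x A).
Proof. exact: stX.2. Qed.

(** A point x of C lies in tC for some t < 1, and then x + (1 - t)C is in C. *)
Lemma evlcm_open (C : set X) : C0 C -> open C.
Proof.
move=> CC; have [sC iC] := evlcm_sub hX CC.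
rewrite openE => x Cx; rewrite /interior.
have [t [[t0 tx] t1]] : exists t : R, (0 <= t /\ dilate t C x) /\ t < 1.
  have : (gauge C x < 1)%E by have [_ _ CE] := iC; move: Cx; rewrite {1}CE.
  by move=> /ereal_inf_lt[_ [t tP <-] t1]; exists t.
have t1' : 0 < 1 - t by rewrite subr_gt0.
have nC : nbhs 0 (dilate (1 - t) C).
  apply/(evlcm_nbhs0 hX); exists (dilate (1 - t) C) => //.
  by apply: (evlcm_dil hX) => //; rewrite gt_eqF.
apply: filterS (nbhsT x nC) => _ [y yC <-].
have := dilateD iC t0 (ltW t1') tx yC; rewrite addrC subrK => -[z Cz <-].
by rewrite scale1r.
Qed.

Lemma nbhs0_open_internal (A : set X) : nbhs 0 A ->
  exists2 C, open_internal C & C `<=` A.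
Proof.
move=> /(evlcm_nbhs0 hX)[C CC CA]; exists C => //; split.
- exact: (evlcm_sub hX).
- exact: (evlcm_sym hX).
- exact: evlcm_open.
Qed.

Lemma nbhs_translate x (C : set X) : open_internal C -> nbhs x (translate x C).
Proof.
move=> [[_ iC] _ oC]; apply: nbhsT; apply: open_nbhs_nbhs; split => //.
exact: internal0.
Qed.

Lemma dual_small (l : {scalar X}) (e : R) : continuous (l : X -> R) -> 0 < e ->
  exists2 C, open_internal C & forall x, C x -> `|l x| <= e.
Proof.
move=> cl e0; apply: nbhs0_open_internal.
have l0 : l 0 = 0 := linear0 l.
by have := cl 0; rewrite /continuous_at l0 => /cvgr0_norm_le /(_ e e0).
Qed.

Lemma bounded_dual (l : {scalar X}) (M : R) (U : set X) : nbhs 0 U ->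
  (forall x, U x -> `|l x| <= M) -> continuous (l : X -> R).
Proof.
move=> nU lM x; apply/(@cvgrPdist_le _ R) => e e0.
have M0 : 0 < `|M| + 1 by rewrite ltr_wpDl.
have r0 : e / (`|M| + 1) != 0 by rewrite gt_eqF// divr_gt0.
apply: filterS (nbhsT x (nbhs0Z r0 nU)) => _ [_ [y Uy <-] <-].
rewrite distrC linearD addrAC subrr add0r scalarZ normrM gtr0_norm ?divr_gt0//.
rewrite mulrAC ler_pdivrMr// ler_pM2l// (le_trans (lM _ Uy))//.
by rewrite (le_trans (ler_norm _))// lerDl.
Qed.

Lemma dual_measurable (l : {scalar X}) : continuous (l : X -> R) ->
  measurable_fun [set: mspace X] (l : mspace X -> R).
Proof. exact: (evlcm_dual hX). Qed.

Variable nu : forall L : set Zd, probability (confS X L) R.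
Hypothesis nuP : is_scit nu.
Hypothesis nuadi : adi (fun L => nu L).
Hypothesis nucl : cl (fun L => nu L).
Local Notation v n := (vol (cube n : set Zd) : R).
Local Notation mu_ := (cramer (fun L => nu L)).
Local Notation N := (neighborhoods (@open_internal R X)).
Local Notation s := (entropy d N mu_).

Lemma cramer_ge0 n A : (0 <= mu_ n A)%E.
Proof. by rewrite /cramer /pushforward; exact: measure_ge0. Qed.

Lemma cramer_le1 n A : (0 < n)%N -> sigalg A -> (mu_ n A <= 1)%E.
Proof.
move=> n0 sA; rewrite /cramer /pushforward; apply: probability_le1.
have bn : box (cube n : set Zd) by exact: box_cube.
exact: mean_alg_mean.
Qed.

Lemma integral_exp0 n V : (0 < n)%N -> sigalg V ->
  (\int[mu_ n]_(x in V) (expR (v n * (\0 : {scalar X}) x))%:E = mu_ n V)%E.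
Proof.
move=> n0 sV; rewrite (cramer_measureE nu n0).
under eq_integral do rewrite /= mulr0 expR0.
by rewrite integral_cst// mul1e.
Qed.

Lemma integral_exp_ge0 n V (l : X -> R) : (0 < n)%N ->
  (0 <= \int[mu_ n]_(x in V) (expR (v n * l x))%:E)%E.
Proof.
move=> n0; rewrite (cramer_measureE nu n0); apply: integral_ge0 => x _.
by rewrite lee_fin expR_ge0.
Qed.

Let carriedT : carried (fun L => nu L) [set w | forall z, [set: X] (w z)].
Proof.
move=> L A B _ _ _; rewrite (_ : [set w | _] = setT); last by apply/seteqP; split.
by rewrite !setIT => ->.
Qed.

Let convexT : convex_set [set: X].
Proof. by apply: convex_set_intro. Qed.

(** If the Cramer sequence charges the neighbourhoods of x1 and x2 at rates u1
    and u2 at one large scale, then it charges the neighbourhood of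
    t x1 + (1 - t) x2 at a rate of almost t u1 + (1 - t) u2 from some scale on;
    passing from half of C to C absorbs the interstitial sites and the rounding
    of proportions. *)
Lemma mix_nbhds (C : set X) x1 x2 (t u1 u2 eta : R) : open_internal C ->
  0 <= t <= 1 -> 0 < eta ->
  \forall m \near \oo,
    ((expR (v m * u1))%:E < mu_ m (translate x1 (dilate (2^-1 : R) C)))%E ->
    ((expR (v m * u2))%:E < mu_ m (translate x2 (dilate (2^-1 : R) C)))%E ->
  \forall n \near \oo, ((expR (v n * (t * u1 + (1 - t) * u2 - eta)))%:E <=
    mu_ n (translate (t *: x1 + (1 - t) *: x2) C))%E.
Proof.
move=> oC t01 eta0; have [mC sC _] := oC; have [sigC iC] := mC.
have [r [a [r0 a0 Qa]]] := cl_site_bound stX nuP nucl mC.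
have [r1 r10 Cx1] := internal_absorbing iC x1.
have [r2 r20 Cx2] := internal_absorbing iC x2.
have {}Cx1 : dilate r1 C x1 by apply/dilateP; rewrite // gt_eqF.
have {}Cx2 : dilate r2 C x2 by apply/dilateP; rewrite // gt_eqF.
have h0 : 0 < 2^-1 :> R by rewrite invr_gt0.
have sH x : sigalg (translate x (dilate (2^-1 : R) C)).
  by apply: sigalg_translate; have [] := meas_internal_dilate stX h0 mC.
have cC := internal_convex iC.
have cH x : convex_set (translate x (dilate (2^-1 : R) C) `&` setT).
  by rewrite setIT; apply: convex_translate; exact: convex_dilate.
(* the drift of the barycentre, at most de (r1 + r2 + r) in the gauge of C,
   must fit in the remaining half of C *)
pose de := Num.min eta (2 * (r1 + r2 + r))^-1.
have rr0 : 0 < r1 + r2 + r by rewrite !addr_gt0.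
have de0 : 0 < de by rewrite lt_min eta0 invr_gt0 mulr_gt0.
have measurable0 : measurable_fun [set: mspace X]
    ((\0 : {scalar X}) : mspace X -> R) by exact: measurable_cst.
have := @supermult_asym R X d d0 nu nuP setT convexT carriedT nuadi \0 (dilate r C)
  a 0 u1 u2 t de measurable0 Qa a0 _ _ t01 de0.
have -> : dilate r C `&` setT = dilate r C by rewrite setIT.
move=> /(_ (convex_dilate cC)).
have l0 q : dilate r C q -> - 0 <= (\0 : {scalar X}) q by rewrite oppr0.
move=> /(_ l0) {l0}; move=> [M _ hM]; exists (maxn M 1) => // m /=.
rewrite geq_max => /andP[Mm m0] hm1 hm2.
have [||n1 _ hn1] := hM m Mm _ _ (cH x1) (cH x2); [by rewrite integral_exp0..|].
exists (maxn n1 1) => // n /=; rewrite geq_max => /andP[n1n n0].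
have [t1 [t2 [t3 [[t10 t20 t30 t123] [d1 d2 d3] hV]]]] := hn1 n n1n.
have := hV (translate (t *: x1 + (1 - t) *: x2) C).
rewrite integral_exp0//; last exact: sigalg_translate.
move=> /(_ (sigalg_translate _ sigC)) h.
apply: (le_trans _ (h _)).
  rewrite lee_fin ler_expR ler_pM2l ?vol_gt0// lerD2l lerN2.
  by rewrite /de ge_min lexx.
move=> _ _ q [[c1 C1 <-] _] [[c2 C2 <-] _] Cq; apply/translateP.
have -> : t1 *: (x1 + c1) + t2 *: (x2 + c2) + t3 *: q -
    (t *: x1 + (1 - t) *: x2) =
    ((t1 - t) *: x1 + (t2 - (1 - t)) *: x2) + (t1 *: c1 + t2 *: c2) + t3 *: q.
  rewrite !scalerDr [(t1 - t) *: _]scalerBl [(t2 - _) *: _]scalerBl opprD.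
  rewrite !addrA.
  by rewrite [LHS](ACl (1*6*3*7*2*4*5))/=.
have d10 := normr_ge0 (t1 - t); have d20 := normr_ge0 (t2 - (1 - t)).
have k1 := dilateD iC (mulr_ge0 d10 (ltW r10)) (mulr_ge0 d20 (ltW r20))
  (dilateZ (t1 - t) sC Cx1) (dilateZ (t2 - (1 - t)) sC Cx2).
have {C1 C2}k2 := dilateD iC (mulr_ge0 (normr_ge0 t1) (ltW h0))
  (mulr_ge0 (normr_ge0 t2) (ltW h0)) (dilateZ t1 sC C1) (dilateZ t2 sC C2).
have k3 := dilateZ t3 sC Cq.
rewrite !ger0_norm// in k2 k3.
have p1 : 0 <= `|t1 - t| * r1 + `|t2 - (1 - t)| * r2.
  by rewrite addr_ge0// mulr_ge0// ltW.
have p2 : 0 <= t1 / 2 + t2 / 2 by rewrite addr_ge0// divr_ge0.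
have p3 : 0 <= t3 * r by rewrite mulr_ge0// ltW.
have := dilateD iC (addr_ge0 p1 p2) p3 (dilateD iC p1 p2 k1 k2) k3.
apply: (dilate_sub1 iC); apply/andP; split; first exact: addr_ge0 (addr_ge0 p1 p2) p3.
have de2 : de * (r1 + r2 + r) <= 2^-1.
  rewrite -ler_pdivlMr// -invfM /de ge_min; apply/orP; right.
  by rewrite mulrC.
have q1 : `|t1 - t| * r1 <= de * r1 by rewrite ler_wpM2r// ltW.
have q2 : `|t2 - (1 - t)| * r2 <= de * r2 by rewrite ler_wpM2r// ltW.
have q3 : t3 * r <= de * r by rewrite ler_wpM2r// ltW.
have q4 : t1 / 2 + t2 / 2 <= 2^-1.
  by rewrite -mulrDl ler_piMl// -t123 lerDl.
lra.
Qed.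

(** A good rate at one large scale persists from some scale on: this is mix_nbhds
    with x1 = x2. *)
Lemma limsup_half_le_liminf (C : set X) x : open_internal C ->
  (limn_esup (log_rate d mu_ (translate x (dilate (2^-1 : R) C))) <=
   limn_einf (log_rate d mu_ (translate x C)))%E.
Proof.
move=> oC; apply: lee_real_lt => u ult; apply/lee_addgt0Pr => eta eta0.
rewrite -leeBlDr// -EFinB; have := mix_nbhds x x u u oC
  (introT andP (conj ler01 (lexx 1))) eta0.
rewrite subrr scale0r addr0 scale1r mul1r mul0r addr0 => mix.
have [m [hm m0] um] := limn_esup_gt_frequently ult
  (filterI mix (nbhs_infty_gt 0)).
rewrite lt_rateE ?vol_gt0 ?cramer_ge0// in um.
have := hm um um; move=> hn; apply: limn_einf_ge_near.
apply: filterS2 (nbhs_infty_gt 0) hn => n n0 hn.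
by rewrite le_rateE ?vol_gt0 ?cramer_ge0.
Qed.

Lemma entropy_le (C : set X) y : open_internal C ->
  (s y <= limn_einf (log_rate d mu_ (translate y C)))%E.
Proof. by move=> oC; apply: ereal_inf_lbound; exists (translate y C) => //; exists C. Qed.

Lemma entropy_lt (a : \bar R) y : (s y < a)%E -> exists2 C, open_internal C &
  (limn_einf (log_rate d mu_ (translate y C)) < a)%E.
Proof. by move=> /ereal_inf_lt[_ [_ [C oC <-] <-] Ca]; exists C. Qed.

Lemma log_rate_le0 n A : (0 < n)%N -> sigalg A -> (log_rate d mu_ A n <= 0)%E.
Proof.
move=> n0 sA; rewrite rate_leE ?vol_gt0 ?cramer_ge0// mulr0 expR0.
exact: cramer_le1.
Qed.

Lemma liminf_le0 A : sigalg A -> (limn_einf (log_rate d mu_ A) <= 0)%E.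
Proof.
move=> sA; apply: (le_trans (limn_einf_sup _)); apply: limn_esup_le_near.
by apply: filterS (nbhs_infty_gt 0) => n n0; exact: log_rate_le0.
Qed.

Lemma entropy_concave (t u1 u2 : R) x1 x2 : 0 <= t <= 1 ->
  (u1%:E <= s x1)%E -> (u2%:E <= s x2)%E ->
  ((t * u1 + (1 - t) * u2)%:E <= s (t *: x1 + (1 - t) *: x2)%R)%E.
Proof.
move=> t01 us1 us2; apply: le_ereal_inf_tmp => _ [_ [C oC <-] <-].
apply/lee_addgt0Pr => eta eta0; rewrite -leeBlDr// -EFinB.
have e0 : 0 < eta / 2 by rewrite divr_gt0.
have h0 : 0 < 2^-1 :> R by rewrite invr_gt0.
have oC2 := open_internal_dilate stX h0 oC.
have near x u : (u%:E <= s x)%E -> \forall m \near \oo,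
    ((expR (v m * (u - eta / 2)))%:E < mu_ m (translate x (dilate (2^-1 : R) C)))%E.
  move=> us; have : ((u - eta / 2)%:E <
      limn_einf (log_rate d mu_ (translate x (dilate (2^-1 : R) C))))%E.
    apply: lt_le_trans (le_trans us (entropy_le x oC2)).
    by rewrite lte_fin ltrBlDr ltrDl.
  move=> /limn_einf_gt_near; apply: filterS2 (nbhs_infty_gt 0) => n n0.
  by rewrite lt_rateE ?vol_gt0 ?cramer_ge0.
have mix := mix_nbhds x1 x2 (u1 - eta / 2) (u2 - eta / 2) oC t01 e0.
have [m [[hm h1] h2]] := filter_ex (filterI (filterI mix (near _ _ us1)) (near _ _ us2)).
have hn := hm h1 h2; apply: limn_einf_ge_near.
apply: filterS2 (nbhs_infty_gt 0) hn => n n0 hn.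
rewrite le_rateE ?vol_gt0 ?cramer_ge0//; apply: le_trans hn.
by rewrite lee_fin ler_expR ler_pM2l ?vol_gt0//; lra.
Qed.

(** The limit of the normalized log-Laplace transforms exists because their
    values at large scales are almost supermultiplicative. *)
Lemma pressure_liminf (l : {scalar X}) : continuous (l : X -> R) ->
  (pressure (fun L => nu L) l <= limn_einf (log_laplace (fun L => nu L) l))%E.
Proof.
move=> cl; apply: lee_real_lt => u ult; apply/lee_addgt0Pr => eta eta0.
rewrite -leeBlDr// -EFinB.
have [C [mC sC oC] lC] := dual_small cl ltr01.
have [r [a [r0 a0 Qa]]] := cl_site_bound stX nuP nucl mC.
have ml := dual_measurable cl.
have Ql q : dilate r C q -> - r <= l q.
  move=> [y Cy <-]; rewrite scalarZ; have /ler_normlP[ly _] := lC y Cy; nra.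
have := @supermult_asym R X d d0 nu nuP setT convexT carriedT nuadi l (dilate r C)
  a r u u 1 eta ml Qa a0 _ Ql (introT andP (conj ler01 (lexx 1))) eta0.
rewrite setIT subrr mul1r mul0r addr0.
move=> /(_ (convex_dilate (internal_convex mC.2))) sup.
have [m [hm m0] um] := limn_esup_gt_frequently ult (filterI sup (nbhs_infty_gt 0)).
rewrite /log_laplace lt_rateE ?vol_gt0 ?integral_exp_ge0// in um.
have cT : convex_set ([set: X] `&` setT) by rewrite setIT.
have hn := hm setT setT cT cT um um; apply: limn_einf_ge_near.
apply: filterS2 (nbhs_infty_gt 0) hn => n n0 [t1 [t2 [t3 [_ _ hV]]]].
rewrite /log_laplace le_rateE ?vol_gt0 ?integral_exp_ge0//.
by apply: hV => //; exact: (@measurableT _ (mspace X)).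
Qed.

Lemma pressure_cvg (l : {scalar X}) : continuous (l : X -> R) ->
  log_laplace (fun L => nu L) l n @[n --> \oo] --> pressure (fun L => nu L) l.
Proof. by move=> cl; apply: cvg_limn_esup; exact: pressure_liminf. Qed.

Section carrier.
Variable D : set X.
Hypothesis nuD : carried (fun L => nu L) [set w | forall z, D (w z)].

(** With probability at least a ^ (n ^ d) every site of the cube lies in Q, and
    then almost surely so does their mean, because Q is convex within D. *)
Lemma site_bound_cube (Q : set X) (a : R) n : (0 < n)%N -> 0 <= a ->
  site_bound nu Q a -> convex_set (Q `&` D) -> a ^+ (n ^ d) <= mpr nu n Q.
Proof.
move=> n0 a0 hQ cQ; have [sQ _] := hQ.
have bn : box (cube n : set Zd) by exact: box_cube.
have fn := @finite_cube d n.
pose F := [set w : Zd -> X | forall z, cube n z -> Q (w z)].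
have FE : setT `&` [set w : Zd -> X | forall z, z \in fset_set (cube n : set Zd) -> Q (w z)] = F.
  rewrite setTI; apply/seteqP; split => w Fw z zn; apply: Fw.
    by rewrite in_fset_set// inE.
  by move: zn; rewrite in_fset_set// inE.
have rn : [set` fset_set (cube n : set Zd)] `<=` cube n `\` set0.
  by rewrite setD0 fset_setK.
have [] := site_bound_seq (nu := nu) n0 hQ a0 (fset_uniq _) (@sub0set _ _) rn
  (@mean_algT R X d set0).
rewrite FE prT mulr1 set0U fset_setK// => h mF.
have -> : (n ^ d)%N = size (fset_set (cube n : set Zd)).
  by apply/eqP; rewrite -(eqr_nat R) -vol_cube.
apply: (le_trans h); have mQ : mean_alg (cube n : set Zd) (mean (cube n) @^-1` Q).
  exact: mean_alg_mean.
rewrite (pr_setID nu mQ mF) [X in _ + X](_ : _ = 0) ?addr0.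
  by apply: pr_le => //; exact: mean_algI.
rewrite /pr (carried_null nuD)//; first by apply: mean_algI => //; exact: mean_algC.
apply/seteqP; split => // w [[/= nQ Fw] Dw]; apply: nQ.
by have [] : (Q `&` D) (mean (cube n) w) by apply: convex_set_mean => // z /Fw.
Qed.

End carrier.

(** Local control puts enough mass on a dilate of a neighbourhood of 0 on which
    l is bounded below. *)
Lemma pressure_gtNy (l : {scalar X}) : continuous (l : X -> R) ->
  (-oo < pressure (fun L => nu L) l)%E.
Proof.
move=> cl; have [C [mC sC oC] lC] := dual_small cl ltr01.
have [r [a [r0 a0 Qa]]] := cl_site_bound stX nuP nucl mC.
have ml := dual_measurable cl.
have cQ : convex_set (dilate r C `&` setT).
  by rewrite setIT; exact: convex_dilate (internal_convex mC.2).
have Ql q : dilate r C q -> - r <= l q.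
  move=> [y Cy <-]; rewrite scalarZ; have /ler_normlP[ly _] := lC y Cy; nra.
have sQ : sigalg (dilate r C) by case: Qa.
apply: (@lt_le_trans _ _ (ln a - r)%:E); first exact: ltNyr.
apply: (le_trans _ (limn_einf_sup _)); apply: limn_einf_ge_near.
apply: filterS (nbhs_infty_gt 0) => n n0.
rewrite /log_laplace le_rateE ?vol_gt0 ?integral_exp_ge0// (cramer_measureE nu n0).
have mexp : measurable_fun [set: mspace X] (fun x : mspace X => (expR (v n * l x))%:E).
  apply/measurable_EFinP; apply: measurableT_comp => //; exact: measurable_funM.
have mQ : measurable (dilate r C : set (mspace X)) by [].
apply: (@le_trans _ _ (\int[cramer_measure nu n0]_(x in dilate r C) (expR (v n * - r))%:E)%E).
  rewrite integral_cst// -(cramer_measureE nu n0) cramerE// -EFinM lee_fin mulrBr expRD -mulrN mulrC.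
  rewrite ler_wpM2l ?expR_ge0//.
  rewrite vol_cube expRM_natl lnK ?posrE//.
  exact: (site_bound_cube carriedT n0 (ltW a0) Qa cQ).
apply: (@le_trans _ _ (\int[cramer_measure nu n0]_(x in dilate r C) (expR (v n * l x))%:E)%E).
  apply: ge0_le_integral => //.
  - exact: measurable_funS mexp.
  - by move=> x Cx; rewrite lee_fin ler_expR ler_pM2l ?vol_gt0//; exact: Ql.
by apply: ge0_subset_integral.
Qed.

(** Chebyshev's lower bound on a small neighbourhood of x. *)
Lemma entropy_add_le_pressure (l : {scalar X}) x : continuous (l : X -> R) ->
  (s x + (l x)%:E <= pressure (fun L => nu L) l)%E.
Proof.
move=> cl; rewrite -leeBrDr//; apply: lee_real_lt => u us.
rewrite leeBrDr// -EFinD; apply/lee_addgt0Pr => e e0.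
rewrite -leeBlDr// -EFinB.
have [C oC lC] := dual_small cl e0; have [[sC _] _ _] := oC.
have ml := dual_measurable cl.
apply: (le_trans _ (limn_einf_sup _)); apply: limn_einf_ge_near.
have := lt_le_trans us (entropy_le x oC).
move=> /limn_einf_gt_near; apply: filterS2 (nbhs_infty_gt 0) => n n0.
rewrite lt_rateE ?vol_gt0 ?cramer_ge0// => /ltW un.
rewrite /log_laplace le_rateE ?vol_gt0 ?integral_exp_ge0// (cramer_measureE nu n0).
have mexp : measurable_fun [set: mspace X] (fun x : mspace X => (expR (v n * l x))%:E).
  apply/measurable_EFinP; apply: measurableT_comp => //; exact: measurable_funM.
have mC : measurable (translate x C : set (mspace X)) by exact: sigalg_translate.
apply: (@le_trans _ _ (\int[cramer_measure nu n0]_(y in translate x C)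
    (expR (v n * (l x - e)))%:E)%E).
  rewrite integral_cst// -(cramer_measureE nu n0).
  have -> : v n * (u + l x - e) = v n * (l x - e) + v n * u by ring.
  rewrite expRD EFinM.
  by apply: lee_wpmul2l => //; rewrite lee_fin expR_ge0.
apply: (@le_trans _ _ (\int[cramer_measure nu n0]_(y in translate x C)
    (expR (v n * l y))%:E)%E).
  apply: ge0_le_integral => //.
  - exact: measurable_funS mexp.
  - move=> _ [y Cy <-]; rewrite lee_fin ler_expR ler_pM2l ?vol_gt0//.
    rewrite linearD lerD2l; have /ler_normlP[ly _] := lC y Cy.
    by rewrite lerNl.
by apply: ge0_subset_integral.
Qed.

Import HBNNSimple.

Section carrier.
Variable D : set X.
Hypotheses (cD : convex_set D).
Hypothesis nuD : carried (fun L => nu L) [set w | forall z, D (w z)].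

(** The image of [0, 1] x A x B under a continuous map. *)
Lemma compact_join (A B : set X) : compact A -> compact B ->
  compact [set p : X | exists t x y, [/\ 0 <= t <= 1, A x, B y &
    p = t *: x + (1 - t) *: y]].
Proof.
move=> cA cB.
have cI : compact (`[0, 1]%classic : set R^o) by exact: segment_compact.
pose h (z : R^o * (X * X)) : X := z.1 *: z.2.1 + (1 - z.1 : R^o) *: z.2.2.
have ch : continuous h.
  move=> z; apply: (@continuous2_cvg _ _ _ _ _ _ _ _ (fun a b : X => a + b)).
  - exact: (@add_continuous X (z.1 *: z.2.1, (1 - z.1 : R^o) *: z.2.2)).
  - apply: (@continuous2_cvg _ _ _ _ _ _ _ _ (fun (a : R^o) (b : X) => a *: b)).
    + exact: (@scale_continuous R X (z.1, z.2.1)).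
    + exact: cvg_fst.
    + by apply: (@cvg_comp _ _ _ snd fst _ _ _ cvg_snd); exact: cvg_fst.
  - apply: (@continuous2_cvg _ _ _ _ _ _ _ _ (fun (a : R^o) (b : X) => a *: b)).
    + exact: (@scale_continuous R X ((1 - z.1 : R^o), z.2.2)).
    + apply: cvgB; [exact: cvg_cst|exact: cvg_fst].
    + by apply: (@cvg_comp _ _ _ snd snd _ _ _ cvg_snd); exact: cvg_snd.
have := continuous_compact (continuous_subspaceT ch)
  (compact_setX cI (compact_setX cA cB)).
rewrite [X in compact X -> _](_ : _ = [set p : X | exists t x y,
  [/\ 0 <= t <= 1, A x, B y & p = t *: x + (1 - t) *: y]])//.
apply/seteqP; split => [_ [[t [x y]] [/= t01 [Ax By]] <-]|].
  by exists t, x, y; split => //; move: t01; rewrite in_itv.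
by move=> p [t [x [y [t01 Ax By ->]]]]; exists (t, (x, y)).
Qed.

(** Integrals of nonnegative functions are almost carried by any set of measure
    close to 1, because they are approximated by bounded functions. *)
Lemma integral_tight m (m0 : (0 < m)%N) (f : mspace X -> R) (c : R) :
  measurable_fun [set: mspace X] f -> (forall x, 0 <= f x) ->
  (c%:E < \int[mu_ m]_x (f x)%:E)%E ->
  exists2 de : R, 0 < de & forall H, sigalg H -> 1 - de <= mpr nu m H ->
    (c%:E < \int[mu_ m]_(x in H) (f x)%:E)%E.
Proof.
move=> mf f0; rewrite (cramer_measureE nu m0).
move=> /(simple_below f0)[h [hf _]]; rewrite -sintegralE -integralT_nnsfun => ch.
pose M := \sum_(y <- fset_set (range h)) y.
have fr : finite_set (range h) by [].
have hM x : h x <= M.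
  rewrite /M (big_fsetD1 (h x))/=; last by rewrite in_fset_set// inE; exists x.
  rewrite lerDl big_seq; apply: sumr_ge0 => y.
  by rewrite !inE => /andP[_]; rewrite in_fset_set// inE => -[z _ <-].
have h0 x : 0 <= h x by exact: fun_ge0.
have M0 : 0 <= M := le_trans (h0 point) (hM point).
have mh : measurable_fun [set: mspace X] (fun x => (h x)%:E) by exact/measurable_EFinP.
have IM H : sigalg H -> (\int[cramer_measure nu m0]_(x in H) (h x)%:E <=
    (M * mpr nu m H)%:E)%E.
  move=> sH; have mH : measurable (H : set (mspace X)) by [].
  apply: (@le_trans _ _ (\int[cramer_measure nu m0]_(x in H) M%:E)%E).
    apply: ge0_le_integral => //; last by move=> x _; rewrite lee_fin.
      by move=> x _; rewrite lee_fin h0.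
    exact: measurable_funS mh.
  by rewrite integral_cst// -(cramer_measureE nu m0) cramerE.
pose I := fine (\int[cramer_measure nu m0]_x (h x)%:E)%E.
have IE : (\int[cramer_measure nu m0]_x (h x)%:E)%E = I%:E.
  rewrite fineK// ge0_fin_numE; last by apply: integral_ge0 => x _; rewrite lee_fin h0.
  by apply: (le_lt_trans (IM setT _)); [exact: (@measurableT _ (mspace X))|exact: ltry].
rewrite IE lte_fin in ch.
have M1 : 0 < M + 1 by rewrite ltr_wpDl.
exists ((I - c) / (M + 1)); first by rewrite divr_gt0// subr_gt0.
move=> H sH Hde; have mH : measurable (H : set (mspace X)) by [].
have mHC : measurable (~` H : set (mspace X)) by exact: measurableC.
have sHC : sigalg (~` H) by [].
have eI : I%:E = (\int[cramer_measure nu m0]_(x in H) (h x)%:E +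
    \int[cramer_measure nu m0]_(x in ~` H) (h x)%:E)%E.
  rewrite -IE -ge0_integral_setU ?setUv//; first by move=> x _; rewrite lee_fin h0.
  by apply/disj_setPS; rewrite setICr.
have bn : box (cube m : set Zd) by exact: box_cube.
have prHC : mpr nu m (~` H) = 1 - mpr nu m H.
  by rewrite /mpr preimage_setC prC//; exact: mean_alg_mean.
have Hfin : (\int[cramer_measure nu m0]_(x in H) (h x)%:E)%E \is a fin_num.
  rewrite ge0_fin_numE; last by apply: integral_ge0 => x _; rewrite lee_fin h0.
  by apply: (le_lt_trans (IM H _)) => //; exact: ltry.
have HCfin : (\int[cramer_measure nu m0]_(x in ~` H) (h x)%:E)%E \is a fin_num.
  rewrite ge0_fin_numE; last by apply: integral_ge0 => x _; rewrite lee_fin h0.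
  by apply: (le_lt_trans (IM (~` H) _)) => //; exact: ltry.
apply: (@lt_le_trans _ _ (\int[cramer_measure nu m0]_(x in H) (h x)%:E)%E); last first.
  apply: ge0_le_integral => //.
  - by move=> x _; rewrite lee_fin h0.
  - exact: measurable_funS mh.
  - by apply/measurable_EFinP; exact: measurable_funS mf.
  - by move=> x _; rewrite lee_fin.
have := IM _ sHC; rewrite prHC.
move: eI Hfin HCfin.
set A := (\int[cramer_measure nu m0]_(x in H) (h x)%:E)%E.
set B := (\int[cramer_measure nu m0]_(x in ~` H) (h x)%:E)%E.
move: A B => [i| |]// [j| |]//.
rewrite -EFinD => -[iE] _ _; rewrite lee_fin lte_fin => jM.
have : M * (1 - mpr nu m H) < I - c; last by lra.
have d1 : 1 - mpr nu m H <= (I - c) / (M + 1) by lra.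
apply: (le_lt_trans (ler_wpM2l M0 d1)).
rewrite mulrA ltr_pdivrMr// mulrC ltr_pM2l ?subr_gt0// ltrDl.
by [].
Qed.

Lemma integral_exp_setU n (n0 : (0 < n)%N) (l : {scalar X}) V V' :
  continuous (l : X -> R) -> sigalg V -> sigalg V' ->
  (\int[mu_ n]_(x in V `|` V') (expR (v n * l x))%:E <=
   \int[mu_ n]_(x in V) (expR (v n * l x))%:E +
   \int[mu_ n]_(x in V') (expR (v n * l x))%:E)%E.
Proof.
move=> cl sV sV'; rewrite (cramer_measureE nu n0).
have ml := dual_measurable cl.
have mexp : measurable_fun [set: mspace X] (fun x : mspace X => (expR (v n * l x))%:E).
  apply/measurable_EFinP; apply: measurableT_comp => //; exact: measurable_funM.
have mV : measurable (V : set (mspace X)) by [].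
have mV' : measurable (V' : set (mspace X)) by [].
have mD : measurable (V' `\` V : set (mspace X)) by exact: measurableD.
have -> : (V `|` V' : set (mspace X)) = V `|` (V' `\` V).
  by rewrite setDE setUIr setUv setIT.
rewrite ge0_integral_setU//; last 2 first.
- exact: measurable_funS mexp.
- by apply/disj_setPS => x [Vx [_ /(_ Vx)]].
apply: leeD => //; apply: ge0_subset_integral => //.
exact: measurable_funS mexp.
Qed.

(** Near y the integrand is almost constant, and the mass of a small
    neighbourhood of y is governed by the entropy at y. *)
Lemma local_exp_bound (l : {scalar X}) y (b eta : R) : continuous (l : X -> R) ->
  0 < eta -> (s y + (l y)%:E <= b%:E)%E ->
  exists2 V, nbhs y V & sigalg V /\ \forall n \near \oo,
    (\int[mu_ n]_(x in V) (expR (v n * l x))%:E <=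
     (expR (v n * (b + 2 * eta)))%:E)%E.
Proof.
move=> cl eta0 sb; have ml := dual_measurable cl.
have h0 : 0 < 2^-1 :> R by rewrite invr_gt0.
have : (s y < (b - l y + eta)%:E)%E.
  rewrite EFinD EFinB; apply: (@le_lt_trans _ _ (b%:E - (l y)%:E)%E).
    by rewrite leeBrDr.
  by rewrite lteDl.
move=> /entropy_lt[C1 oC1 C1b]; have oC1' := open_internal_dilate stX h0 oC1.
have [C2 oC2 lC2] := dual_small cl eta0.
have sV1 : sigalg (translate y (dilate (2^-1 : R) C1)).
  by apply: sigalg_translate; have [[]] := oC1'.
have sV2 : sigalg (translate y C2).
  by apply: sigalg_translate; have [[]] := oC2.
pose V := translate y (dilate (2^-1 : R) C1) `&` translate y C2.
have sV : sigalg V by have := @measurableI _ (mspace X) _ _ sV1 sV2.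
exists V; first by apply: filterI; exact: nbhs_translate.
split=> //.
have := le_lt_trans (limsup_half_le_liminf y oC1) C1b.
move=> /limn_esup_lt_near; apply: filterS2 (nbhs_infty_gt 0) => n n0.
move=> /ltW; rewrite rate_leE ?vol_gt0 ?cramer_ge0// => hn.
rewrite (cramer_measureE nu n0) in hn *.
have mV : measurable (V : set (mspace X)) by [].
have mexp : measurable_fun [set: mspace X] (fun x : mspace X => (expR (v n * l x))%:E).
  apply/measurable_EFinP; apply: measurableT_comp => //; exact: measurable_funM.
apply: (@le_trans _ _ (\int[cramer_measure nu n0]_(x in V)
    (expR (v n * (l y + eta)))%:E)%E).
  apply: ge0_le_integral => //.
  - exact: measurable_funS mexp.
  - move=> _ [_ [z Cz <-]]; rewrite lee_fin ler_expR ler_pM2l ?vol_gt0//.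
    by rewrite linearD lerD2l; have /ler_normlP[_] := lC2 z Cz.
rewrite integral_cst//.
have -> : v n * (b + 2 * eta) = v n * (l y + eta) + v n * (b - l y + eta) by ring.
rewrite [X in (_ <= X%:E)%E]expRD EFinM; apply: lee_wpmul2l.
  by rewrite lee_fin expR_ge0.
apply: (le_trans _ hn); apply: le_measure; rewrite ?inE//.
exact: subIsetl.
Qed.

(** The truncation to a compact convex set must be taken at a fixed scale m,
    where almost all the mass of the exponential integral sits on a tight set
    K. Supermultiplicativity then confines the integrals at larger scales to
    the join of K with a second tight set that controls the remaining sites,
    and there the local bounds apply. *)
Lemma pressure_le_entropy (l : {scalar X}) (b : R) : continuous (l : X -> R) ->
  ctl (fun L => nu L) D -> (forall y, (s y + (l y)%:E <= b%:E)%E) ->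
  (pressure (fun L => nu L) l <= b%:E)%E.
Proof.
move=> cl tight sb; apply: lee_real_lt => u ult; rewrite lee_fin leNgt.
apply/negP => bu.
(* one eta is lost by supermultiplicativity, two by the local bounds, and the
   last one absorbs the number of sets in the covering *)
pose eta := (u - b) / 4.
have eta0 : 0 < eta by rewrite divr_gt0// subr_gt0.
have ml := dual_measurable cl.
have [C [mC sC oC] lC] := dual_small cl ltr01.
have [r [a [r0 a0 Qa]]] := cl_site_bound stX nuP nucl mC.
have Ql q : dilate r C q -> - r <= l q.
  move=> [y Cy <-]; rewrite scalarZ; have /ler_normlP[ly _] := lC y Cy; nra.
(* small enough for the dilate of C and K0 to be met simultaneously *)
pose gamma0 := Num.min (a / 2) 2^-1.
have gamma01 : 0 < gamma0 < 1.
  by rewrite lt_min divr_gt0//= invr_gt0 ltr0n/= gt_min invf_lt1 ?ltr1n ?orbT.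
have [K0 [cK0 kK0 bK0]] := ctl_site_bound nuP tight gamma01.
have Qb := site_boundI Qa bK0.
have a'0 : 0 < a - gamma0.
  have : gamma0 <= a / 2 by rewrite ge_min lexx.
  by lra.
have cQ : convex_set ((dilate r C `&` K0) `&` D).
  rewrite -setIA; apply: convex_setI => //.
  by apply: convex_dilate; exact: internal_convex mC.2.
have := @supermult_asym R X d d0 nu nuP D cD nuD nuadi l (dilate r C `&` K0)
  (a - gamma0) r u u 1 eta ml Qb a'0 cQ (fun q Qq => Ql q Qq.1)
  (introT andP (conj ler01 (lexx 1))) eta0.
rewrite subrr mul1r mul0r addr0 => sup.
have [m [hm m0] um] := limn_esup_gt_frequently ult (filterI sup (nbhs_infty_gt 0)).
rewrite /log_laplace lt_rateE ?vol_gt0 ?integral_exp_ge0// in um.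
have mexp : measurable_fun [set: mspace X] (fun x : mspace X => expR (v m * l x)).
  apply: measurableT_comp => //; exact: measurable_funM.
have [de de0 hde] := integral_tight m0 mexp (fun=> expR_ge0 _) um.
have md0 : 0 < (m ^ d)%:R :> R by rewrite ltr0n expn_gt0 m0.
(* small enough for the m ^ d sites to lie in K together with probability at
   least 1 - de *)
pose gamma := Num.min 2^-1 (de / (m ^ d)%:R).
have gamma1 : 0 < gamma < 1.
  by rewrite lt_min invr_gt0 ltr0n divr_gt0//= gt_min invf_lt1 ?ltr1n.
have [K [cK kK bK]] := ctl_site_bound nuP tight gamma1.
have {um}um : ((expR (v m * u))%:E < \int[mu_ m]_(x in K) (expR (v m * l x))%:E)%E.
  have /andP[g0 g1] := gamma1; have [sK _] := bK.
  apply: hde => //; have g2 : 0 <= 1 - gamma by rewrite subr_ge0 ltW.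
  apply: (le_trans _ (site_bound_cube nuD m0 g2 bK cK)).
  apply: (le_trans _ (bernoulli_ineq _ _)); last by rewrite !ltW.
  rewrite lerD2l lerN2 mulrC -ler_pdivlMr// ge_min lexx orbT//.
have hn := hm K K cK cK um um.
pose J := [set p : X | exists t x y, [/\ 0 <= t <= 1, closure (K `&` D) x,
  closure (K0 `&` D) y & p = t *: x + (1 - t) *: y]].
have kJ : compact J := compact_join kK kK0.
pose P (A : set X) := exists V, [/\ sigalg V, A `<=` V & exists M : nat,
  \forall n \near \oo, (\int[mu_ n]_(x in V) (expR (v n * l x))%:E <=
    (M%:R * expR (v n * (b + 2 * eta)))%:E)%E].
have [V [sV JV [M hM]]] : P J.
  apply: compact_induction kJ _.
  - exists set0; split => //; first exact: (@measurable0 _ (mspace X)).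
    exists 0%N; apply: filterS (nbhs_infty_gt 0) => n n0.
    by rewrite (cramer_measureE nu n0) integral_set0 mul0r.
  - move=> A B [V [sV AV [M hM]]] [V' [sV' BV' [M' hM']]].
    exists (V `|` V'); split.
    + by have := @measurableU _ (mspace X) _ _ sV sV'.
    + exact: setUSS.
    exists (M + M')%N; apply: filterS3 (nbhs_infty_gt 0) hM hM' => n n0 h h'.
    apply: (le_trans (integral_exp_setU n0 cl sV sV')).
    by rewrite natrD mulrDl EFinD; exact: leeD.
  - move=> A B AB [V [sV BV h]]; exists V; split => //.
    exact: subset_trans BV.
  - move=> y _; have [V nV [sV h]] := local_exp_bound cl eta0 (sb y).
    exists V => //; exists V; split => //; exists 1%N.
    by apply: filterS h => n; rewrite mul1r.
have [n [[[[t1 [t2 [t3 [[t10 t20 t30 t123] _ hV]]]] hMn] n0] nM]] := filter_ex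
  (filterI (filterI (filterI hn hM) (nbhs_infty_gt 0)) (nbhs_infty_ger (M%:R / eta))).
have {}hV := hV V sV.
have : ((expR (v n * (u - eta)))%:E <=
    \int[mu_ n]_(x in V) (expR (v n * l x))%:E)%E.
  apply: hV => x1 x2 q Kx1 Kx2 [[_ K0q] Dq]; apply: JV.
  have t3E : t3 = 1 - (t1 + t2) by rewrite -t123 addrAC subrr add0r.
  exists (t1 + t2); have [T0|T0] := eqVneq (t1 + t2) 0.
    exists x1, q; split; [by rewrite T0 lexx ler01|exact: subset_closure|
      exact: subset_closure|].
    move: (T0) => /eqP; rewrite paddr_eq0// => /andP[/eqP t1E /eqP t2E].
    by rewrite -t3E t1E t2E addr0 !scale0r addr0.
  have T1 : 0 < t1 + t2 by rewrite lt_neqAle eq_sym T0 addr_ge0.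
  exists ((t1 / (t1 + t2)) *: x1 + (t2 / (t1 + t2)) *: x2), q; split.
  - by rewrite (ltW T1)/= -t123 lerDl.
  - apply: subset_closure; apply: (convex_set_comb cK) => //; rewrite ?divr_ge0 ?(ltW T1)//.
    by rewrite -mulrDl divff.
  - exact: subset_closure.
  - rewrite scalerDr !scalerA ![(t1 + t2) * _]mulrC !divfK//.
    by rewrite -t3E.
move=> /le_trans /(_ hMn); rewrite lee_fin.
have -> : v n * (u - eta) = v n * eta + v n * (b + 2 * eta) by rewrite /eta; field.
rewrite expRD ler_pM2r ?expR_gt0// leNgt => /negP; apply.
apply: (@le_lt_trans _ _ (n%:R * eta)); first by rewrite -ler_pdivrMr.
apply: (@le_lt_trans _ _ (v n * eta)).
  rewrite ler_pM2r// vol_cube ler_nat -{1}(expn1 n) leq_pexp2l//.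
by apply: (lt_le_trans _ (expR_ge1Dx _)); rewrite ltrDr.
Qed.

Lemma log_rate_mono n (A B : set X) : (0 < n)%N -> sigalg A -> sigalg B ->
  A `<=` B -> (log_rate d mu_ A n <= log_rate d mu_ B n)%E.
Proof.
move=> n0 sA sB AB; apply: lee_wpmul2l; first by rewrite lee_fin invr_ge0 ltW// vol_gt0.
have AB' : (mu_ n A <= mu_ n B)%E.
  rewrite (cramer_measureE nu n0); apply: le_measure => //; rewrite inE; [exact: sA|exact: sB].
by rewrite lee_lne// in_itv/= ?leey ?andbT; exact: cramer_ge0.
Qed.

Lemma entropy_le0 y : (s y <= 0)%E.
Proof.
have [C oC _] := @nbhs0_open_internal setT filterT; have [[sC _] _ _] := oC.
apply: (le_trans (entropy_le y oC)); apply: liminf_le0; exact: sigalg_translate.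
Qed.

(** Separation of the point (x0, a) from the graph of s. The function
    z |-> a - s (x0 + z) is convex because s is concave; it is positive near 0
    because s stays below a near x0, and at least a everywhere because s is at
    most 0. Hence it is bounded below by - |a| times the gauge of a
    neighbourhood of 0, and its linear minorant l satisfies s + l <= a + l x0. *)
Lemma exists_dual_form (x0 : X) (a : R) : ctl (fun L => nu L) D ->
  (s x0 < a%:E)%E -> exists2 l : {scalar X}, continuous (l : X -> R) &
  (pressure (fun L => nu L) l <= (a + l x0)%:E)%E.
Proof.
move=> tight /entropy_lt[C oC Ca].
have h0 : 0 < 2^-1 :> R by rewrite invr_gt0.
have oC' := open_internal_dilate stX h0 oC.
set C' := dilate _ _ in oC'; have [[sC' iC'] symC' _] := oC'.
have [[sC iC] symC _] := oC.
have sa z : C' z -> (s (x0 + z)%R < a%:E)%E.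
  move=> Cz; apply: le_lt_trans (entropy_le _ oC') _; apply: le_lt_trans Ca.
  apply: lee_real_lt => u /limn_einf_gt_near un; apply: limn_einf_ge_near.
  apply: filterS2 (nbhs_infty_gt 0) un => n n0 /ltW /le_trans; apply.
  apply: log_rate_mono => //; [exact: sigalg_translate|exact: sigalg_translate|].
  move=> _ [y Cy <-]; rewrite -addrA; exists (z + y) => //.
  have e1 : 2^-1 + 2^-1 = 1 :> R by field.
  have := dilateD iC (ltW h0) (ltW h0) Cz Cy.
  by rewrite e1 => -[w Cw <-]; rewrite scale1r.
pose G := [set zb : X * R | ((a - zb.2)%:E <= s (x0 + zb.1)%R)%E].
have [||||z b z' b' t u t0 u0 tu /= Gz Gz'|z b r /= Gz r0 Cz|l [lC lG]] :=
  @convex_gauge_minorant R X C' G `|a|.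
- exact: internal_convex iC'.
- exact: symC'.
- exact: internal_absorbing iC'.
- exact: normr_ge0.
- have uE : u = 1 - t by rewrite -tu addrAC subrr add0r.
  have t01 : 0 <= t <= 1 by rewrite t0 -tu lerDl.
  have := entropy_concave t01 Gz Gz'; rewrite /G /= -uE.
  congr (_ <= _)%E; first by congr EFin; rewrite uE; ring.
  by congr s; rewrite !scalerDr addrACA -scalerDl tu scale1r.
- have [r1|r1] := leP r 1.
    have Cz' : C' z.
      apply: (dilate_sub1 iC' (r := r)); first by rewrite ltW.
      by apply/dilateP => //; rewrite gt_eqF.
    have := le_lt_trans Gz (sa z Cz'); rewrite lte_fin/= => ab.
    have b0 : 0 <= b by lra.
    by rewrite addr_ge0// mulr_ge0// ltW.
  have := le_trans Gz (entropy_le0 _); rewrite lee_fin/= => ab.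
  have := ler_norm (- a); rewrite normrN => na.
  have ar : `|a| <= `|a| * r by rewrite ler_peMr// ltW.
  lra.
have nC' : nbhs 0 C' by apply: open_nbhs_nbhs; split; [case: oC'|exact: internal0].
exists l.
  apply: (bounded_dual (M := `|a|) nC') => x Cx; rewrite ler_norml lC// andbT lerNl.
  by rewrite -raddfN; apply: lC; exact: symC'.
apply: pressure_le_entropy => //.
  apply: (bounded_dual (M := `|a|) nC') => x Cx; rewrite ler_norml lC// andbT lerNl.
  by rewrite -raddfN; apply: lC; exact: symC'.
move=> y; have := entropy_le0 y; case E : (s y) => [e| |] //; last first.
  by move=> _; rewrite addNye leNye.
rewrite lee_fin => _; have : G (y - x0, a - e).
  by rewrite /G /= [x0 + _]addrC subrK E lee_fin; lra.
by move=> /lG; rewrite linearB -EFinD lee_fin/= => ?; lra.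
Qed.

End carrier.
End one_space.

(** * Image systems *)

Section image_system.
Context {R : realType} {X E : measTvsType R} {d : nat}.
Local Notation Zd := 'rV[int]_d.
Variable f : {linear X -> E}.
Hypothesis mf : measurable_fun [set: mspace X] (f : mspace X -> mspace E).
Variable mu : forall L : set Zd, probability (confS X L) R.

Lemma sigalg_preimage (B : set E) : sigalg B -> sigalg (f @^-1` B).
Proof. by move=> sB; have := mf measurableT sB; rewrite setTI. Qed.

Lemma mean_conf_map (L : set Zd) (w : Zd -> X) : finite_set L ->
  mean L (conf_map f w) = f (mean L w).
Proof.
move=> fL; rewrite /mean linearZ; congr (_ *: _).
by rewrite !fsbig_finite// linear_sum.
Qed.

Lemma mean_alg_conf_map (S : set Zd) (A : set (Zd -> E)) : mean_alg S A ->
  mean_alg S (conf_map f @^-1` A).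
Proof.
apply: mean_alg_preimage => L B bL LS sB.
rewrite [X in mean_alg _ X](_ : _ = mean L @^-1` (f @^-1` B)).
  by apply: mean_alg_mean => //; exact: sigalg_preimage.
by apply/funext => w; rewrite /preimage /= mean_conf_map//; exact: box_finite.
Qed.

Lemma measurable_conf_map (L : set Zd) :
  measurable_fun [set: confS X L] (conf_map f : confS X L -> confS E L).
Proof. by move=> _ A mA; rewrite setTI; exact: mean_alg_conf_map. Qed.

Definition conf_mfun (L : set Zd) : {mfun confS X L >-> confS E L} :=
  HB.pack (conf_map f : confS X L -> confS E L)
    (isMeasurableFun.Build _ _ _ _ _ (@measurable_conf_map L)).

(** push_system, with its structure of probability: the results on one space
    apply to it. *)
Definition image_system (L : set Zd) : probability (confS E L) R :=
  distribution (mu L) (conf_mfun L).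

Lemma image_systemE (L : set Zd) (A : set (Zd -> E)) :
  image_system L A = mu L (conf_map f @^-1` A).
Proof. by []. Qed.

Lemma image_scit : is_scit mu -> is_scit image_system.
Proof.
move=> [comp shift]; split.
- move=> L1 L2 A b1 b2 L12 mA; rewrite !image_systemE.
  by apply: comp => //; exact: mean_alg_conf_map.
- move=> L z A bL mA; rewrite !image_systemE.
  rewrite -(shift L z (conf_map f @^-1` A))//; last exact: mean_alg_conf_map.
  by rewrite !shift_confE.
Qed.

Lemma image_carried (D : set X) :
  carried (fun L => mu L) [set w | forall z, D (w z)] ->
  carried (fun L => image_system L) [set w | forall z, (f @` D) (w z)].
Proof.
move=> muD L A B bL mA mB AB; rewrite !image_systemE.
apply: muD => //; [exact: mean_alg_conf_map|exact: mean_alg_conf_map|].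
have H w : (forall z, D (w z)) -> A (conf_map f w) <-> B (conf_map f w).
  move=> Dw; have fD z : (f @` D) (conf_map f w z) by exists (w z).
  have := congr1 (fun C : set (Zd -> E) => C (conf_map f w)) AB.
  rewrite /setI /= => ABw; split=> ABfw.
    by have [] : B (conf_map f w) /\ (forall z, (f @` D) (conf_map f w z))
      by rewrite -ABw.
  by have [] : A (conf_map f w) /\ (forall z, (f @` D) (conf_map f w z))
    by rewrite ABw.
by apply/seteqP; split => w [Aw Dw]; split => //; apply/(H w Dw).
Qed.

Lemma cramer_image n (A : set E) :
  cramer (fun L => image_system L) n A = cramer (fun L => mu L) n (f @^-1` A).
Proof.
rewrite /cramer /pushforward image_systemE; congr (mu _ _).
apply/funext => w; rewrite /preimage /= mean_conf_map//; exact: finite_cube.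
Qed.

Lemma log_rate_image n (A : set E) :
  log_rate d (cramer (fun L => image_system L)) A n =
  log_rate d (cramer (fun L => mu L)) (f @^-1` A) n.
Proof. by rewrite /log_rate cramer_image. Qed.

Lemma log_laplace_image n (l : {scalar E}) (l' : {scalar X}) : (0 < n)%N ->
  measurable_fun [set: mspace E] (l : mspace E -> R) ->
  (forall x, l' x = l (f x)) ->
  log_laplace (fun L => mu L) l' n = log_laplace (fun L => image_system L) l n.
Proof.
move=> n0 ml ll'; rewrite /log_laplace; congr (_ * lne _)%E.
set v : R := vol (cube n : set Zd).
have mexp : measurable_fun [set: mspace E] (fun y : mspace E => (expR (v * l y))%:E).
  apply/measurable_EFinP; apply: measurableT_comp => //; exact: measurable_funM.
have E1 : cramer (fun L => image_system L) n =
    pushforward (cramer_measure mu n0) (f : mspace X -> mspace E).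
  by apply/funext => A; rewrite cramer_image.
transitivity (\int[pushforward (cramer_measure mu n0)
    (f : mspace X -> mspace E)]_y (expR (v * l y))%:E)%E; last first.
  by congr (integral _ _ _).
rewrite [RHS]ge0_integral_pushforward//.
by rewrite preimage_setT; apply: eq_integral => x _ /=; rewrite ll'.
Qed.

Lemma translate_preimage x (C : set E) :
  translate x (f @^-1` C) = f @^-1` (translate (f x) C).
Proof.
apply/seteqP; split => y.
  by move=> [z Cz <-]; exists (f z) => //; rewrite linearD.
move=> /translateP h; apply/translateP; by rewrite /preimage /= linearB.
Qed.

Lemma convex_set_image (D : set X) : convex_set D -> convex_set (f @` D).
Proof.
move=> /convex_set_comb cD; apply: convex_set_intro => _ _ s t s0 t0 st [x Dx <-] [y Dy <-].
exists (s *: x + t *: y); first exact: cD.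
by rewrite linearD !linearZ.
Qed.

End image_system.

(** * The upper bound on compact sets *)

Section exponential_bounds.
Context {R : realType} {X : measTvsType R} {d : nat}.
Local Notation Zd := 'rV[int]_d.
Hypothesis d0 : (0 < d)%N.
Variable mu : forall L : set Zd, probability (confS X L) R.
Variable D : set X.
Hypothesis cD : convex_set D.
Hypothesis muD : carried (fun L => mu L) [set w | forall z, D (w z)].
Local Notation mu_ := (cramer (fun L => mu L)).
Local Notation v n := (vol (cube n : set Zd) : R).

Lemma cramer_carried n (A B : set X) : (0 < n)%N -> sigalg A -> sigalg B ->
  A `&` D = B `&` D -> mu_ n A = mu_ n B.
Proof.
move=> n0 sA sB AB; apply: muD; first exact: box_cube.
- by apply: mean_alg_mean => //; exact: box_cube.
- by apply: mean_alg_mean => //; exact: box_cube.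
- have H w : (forall z, D (w z)) ->
      (A (mean (cube n : set Zd) w)) = (B (mean (cube n : set Zd) w)).
    move=> Dw; have Dm : D (mean (cube n : set Zd) w).
      by apply: (convex_set_mean cD) => //; exact: box_cube.
    apply/propext; split => h.
      by have [] : (B `&` D) (mean (cube n : set Zd) w) by rewrite -AB.
    by have [] : (A `&` D) (mean (cube n : set Zd) w) by rewrite AB.
  by apply/seteqP; split => w [Aw Dw]; split => //; move: Aw;
    rewrite /preimage /= H.
Qed.

Lemma near_le_vol (B : R) : \forall n \near \oo, B <= v n.
Proof.
exists (Num.truncn B).+1 => // n /= Bn; rewrite vol_cube.
have n0 : (0 < n)%N by exact: leq_trans Bn.
apply: (@le_trans _ _ n%:R); last by rewrite ler_nat -{1}(expn1 n) leq_pexp2l.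
apply: ltW; apply: (lt_le_trans (truncnS_gt B)); by rewrite ler_nat.
Qed.

(** A finite union of sets of rate at most u again has rate at most u, so an
    exponential bound on a neighbourhood of each point of a compact set extends
    to the whole of it. Only the part in D of a set counts, because D is convex
    and thus contains the means of the configurations that carry the system. *)
Lemma compact_rate_bound (u : R) (A K : set X) : sigalg A -> compact K ->
  A `&` D `<=` K ->
  (forall x, K x -> exists2 V, nbhs x V /\ sigalg V &
     \forall n \near \oo, (mu_ n V <= (expR (v n * u))%:E)%E) ->
  (limn_esup (log_rate d mu_ A) <= u%:E)%E.
Proof.
move=> sA cK AK Kloc.
have [V [sV KV [M M0 HV]]] : exists V, [/\ sigalg V, K `<=` V &
    exists2 M : R, 0 < M &
      \forall n \near \oo, (mu_ n V <= (M * expR (v n * u))%:E)%E].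
  apply: (compact_induction (P := fun B => exists V, [/\ sigalg V, B `<=` V &
    exists2 M : R, 0 < M &
      \forall n \near \oo, (mu_ n V <= (M * expR (v n * u))%:E)%E])) cK _.
  - exists set0; split => //; first exact: (@measurable0 _ (mspace X)).
    exists 1 => //; apply: filterS (nbhs_infty_gt 0) => n n0.
    by rewrite (cramer_measureE mu n0) measure0 lee_fin mul1r expR_ge0.
  - move=> B1 B2 [V1 [sV1 BV1 [M1 M10 H1]]] [V2 [sV2 BV2 [M2 M20 H2]]].
    exists (V1 `|` V2); split; first exact: (@measurableU _ (mspace X)).
      exact: setUSS.
    exists (M1 + M2); first exact: addr_gt0.
    near=> n; have n0 : (0 < n)%N by near: n; exact: nbhs_infty_gt.
    have le1 : (mu_ n V1 <= (M1 * expR (v n * u))%:E)%E by near: n.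
    have le2 : (mu_ n V2 <= (M2 * expR (v n * u))%:E)%E by near: n.
    rewrite (cramer_measureE mu n0) mulrDl EFinD.
    by apply: le_trans (leeD le1 le2); exact: measureU2.
  - by move=> B1 B2 B12 [V [sV BV HV]]; exists V; split => //; exact: subset_trans BV.
  - move=> x /Kloc[V [nV sV] HV]; exists V => //; exists V; split => //.
    by exists 1 => //; apply: filterS HV => n; rewrite mul1r.
apply/lee_addgt0Pr => e e0; rewrite -EFinD; apply: limn_esup_le_near.
near=> n; have n0 : (0 < n)%N by near: n; exact: nbhs_infty_gt.
have v0 : 0 < v n by exact: vol_gt0.
have mAV : sigalg (A `&` V) by exact: (@measurableI _ (mspace X)).
rewrite /log_rate rate_leE//; last exact: cramer_ge0.
rewrite (cramer_carried n0 sA mAV); last first.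
  by rewrite -setIA (setIC V) setIA; apply/esym/setIidPl => x Ax; exact/KV/AK.
apply: (@le_trans _ _ (mu_ n V)).
  by rewrite (cramer_measureE mu n0); apply: le_measure; rewrite ?inE.
apply: (@le_trans _ _ (M * expR (v n * u))%:E); first by near: n.
rewrite lee_fin mulrDr [in leRHS]expRD mulrC ler_pM2l ?expR_gt0//.
apply: le_trans (expR_ge1Dx _).
have : e^-1 * M <= v n by near: n; exact: near_le_vol.
rewrite ler_pdivrMl// mulrC => h; apply: (le_trans h); lra.
Unshelve. all: by end_near.
Qed.

End exponential_bounds.

(** * Projective limits *)

Section projective_limit.
Context {R : realType} {dJ : Order.disp_t} {J : preorderType dJ}.
Context {X : measTvsType R} {Xi : J -> measTvsType R}.
Variable C0i : forall i : J, set (set (Xi i)).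
Context {f : forall i : J, {linear X -> Xi i}}.
Context {fij : forall i j : J, {linear Xi j -> Xi i}}.
Hypotheses (hsys : is_proj_system C0i f fij) (hlim : is_proj_limit f).
Context {d : nat}.
Hypothesis d0 : (0 < d)%N.
Local Notation Zd := 'rV[int]_d.
Variable D : set X.
Hypothesis cD : convex_set D.
Variable mu : forall L : set Zd, probability (confS X L) R.
Hypothesis muP : is_scit mu.
Hypothesis muD : carried (fun L => mu L) [set w | forall z, D (w z)].
Hypothesis muadi : forall i, adi (push_system (f i) (fun L => mu L)).
Hypothesis mucl : forall i, cl (push_system (f i) (fun L => mu L)).

Let fM i : measurable_fun [set: mspace X] (f i : mspace X -> mspace (Xi i)).
Proof. exact: ps_meas hsys i. Qed.
Let hX i : is_evlcm (@C0i i) := ps_evlcm hsys i.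
Definition coordinate_system i := image_system (@fM i) mu.
Local Notation nu i := (coordinate_system i).
Local Notation mu_ := (cramer (fun L => mu L)).
Local Notation N := (neighborhoods (limit_C0 f)).
Local Notation s := (entropy d N mu_).
Local Notation S i :=
  (entropy d (neighborhoods (@open_internal R (Xi i))) (cramer (fun L => nu i L))).
Local Notation p := (pressure (fun L => mu L)).
Local Notation v n := (vol (cube n : set Zd) : R).

Let nuP i : is_scit (nu i) := image_scit (@fM i) muP.
Let nuadi i : adi (fun L => nu i L) := muadi i.
Let nucl i : cl (fun L => nu i L) := mucl i.

Lemma limit_nbhs i x (C : set (Xi i)) : open_internal C ->
  nbhs x (f i @^-1` translate (f i x) C).
Proof.
move=> [mC sC oC]; rewrite -translate_preimage; apply: nbhsT.
by apply/(pl_nbhs0 hlim); exists (f i @^-1` C) => //; exists i, C.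
Qed.

Lemma limit_sigalg i x (C : set (Xi i)) : open_internal C ->
  sigalg (f i @^-1` translate x C).
Proof.
move=> [[sC _] _ _]; apply: (sigalg_preimage (@fM i)).
exact: (evlcm_stable (hX i)).2.
Qed.

Lemma limit_entropy_le i x : (s x <= S i (f i x))%E.
Proof.
apply: le_ereal_inf => _ [_ [C oC <-] <-].
exists (translate x (f i @^-1` C)); first by exists (f i @^-1` C) => //; exists i, C; case: oC.
by rewrite translate_preimage; congr limn_einf; apply/funext => n; rewrite log_rate_image.
Qed.

Lemma limit_entropy_lt x (a : \bar R) : (s x < a)%E -> exists i, (S i (f i x) < a)%E.
Proof.
move=> /ereal_inf_lt[_ [_ [_ [i [C [mC sC oC ->]]] <-] <-] Ca]; exists i.
apply: le_lt_trans Ca; apply: le_trans (entropy_le _ (f i x) (And3 mC sC oC)) _.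
rewrite translate_preimage le_eqVlt; apply/orP; left; apply/eqP.
by congr limn_einf; apply/funext => n; rewrite log_rate_image.
Qed.

(** A point of small entropy has a neighbourhood of small lower rate, hence by
    limsup_half_le_liminf on some X_i a neighbourhood of small upper rate, and
    compactness does the rest. *)
Lemma limit_upper_bound (A K : set X) : sigalg A -> compact K -> A `&` D `<=` K ->
  (limn_esup (log_rate d mu_ A) <= ereal_sup [set s x | x in K])%E.
Proof.
move=> sA cK AK; apply: lee_real_lt => r rA; rewrite leNgt; apply/negP => Kr.
suff : (limn_esup (log_rate d mu_ A) <= r%:E)%E by rewrite leNgt rA.
apply: (compact_rate_bound d0 cD muD sA cK AK) => x Kx.
have : (s x < r%:E)%E.
  by apply: le_lt_trans Kr; apply: ereal_sup_ubound; exists x.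
move=> /limit_entropy_lt[i /entropy_lt[C oC Cr]].
have oC2 : open_internal (dilate (2^-1 : R) C).
  by apply: (open_internal_dilate (evlcm_stable (hX i))) => //; rewrite invr_gt0.
exists (f i @^-1` translate (f i x) (dilate (2^-1 : R) C)).
  by split; [exact: limit_nbhs|exact: limit_sigalg].
have := le_lt_trans (limsup_half_le_liminf d0 (hX i) (nuP i) (nuadi i) (nucl i)
  (f i x) oC) Cr.
move=> /limn_esup_lt_near; apply: filterS2 (nbhs_infty_gt 0) => n n0.
rewrite log_rate_image => /ltW; rewrite rate_leE//; first exact: vol_gt0.
exact: cramer_ge0.
Qed.

(** l is bounded by 1 on some f_i^-1(C). Hence the values l x, prescribed at the
    points f_i x, are dominated by the gauge of C, and extend to a linear form
    on X_i with the same domination. *)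
Lemma dual_factor (l : {scalar X}) : continuous (l : X -> R) ->
  exists i (li : {scalar Xi i}), continuous (li : Xi i -> R) /\
    forall x, l x = li (f i x).
Proof.
move=> cl.
have l0 : l 0 = 0 := linear0 l.
have : nbhs (0 : X) [set x | `|l x| <= 1].
  have := cl 0 [set y : R | `|y| <= 1]; rewrite l0; apply.
  apply/nbhs_ballP; exists 1 => //= y; rewrite /ball/= sub0r normrN; exact: ltW.
move=> /(pl_nbhs0 hlim)[_ [i [C [mC sC oC ->]]] Cl].
have [sgC iC] := mC.
have lin (a b : R) x y : l (a *: x + b *: y) = a * l x + b * l y.
  by rewrite linearD !scalarZ.
have [|||||li [liC lil]] := @convex_gauge_minorant R (Xi i) C
    [set q | exists x, q = (f i x, l x)] 1 _ sC.
- exact: internal_convex iC.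
- exact: internal_absorbing iC.
- exact: ler01.
- move=> _ _ _ _ a b a0 b0 ab [x [-> ->]] [y [-> ->]]; exists (a *: x + b *: y).
  by rewrite linearD !linearZ lin.
- move=> _ _ r [x [-> ->]] r0 Cx; have : `|l (r^-1 *: x)| <= 1.
    by apply: Cl; rewrite /preimage /= linearZ.
  rewrite scalarZ normrM gtr0_norm ?invr_gt0// ler_pdivrMl// mulr1 ler_norml.
  by move=> /andP[h _]; lra.
exists i, li; split.
  apply: (@bounded_dual _ _ li 1 C).
    by apply: open_nbhs_nbhs; split => //; exact: internal0.
  move=> x Cx; rewrite ler_norml liC// andbT lerNl.
  have := liC _ (sC _ Cx); by rewrite linearN.
move=> x; apply/eqP; rewrite eq_le; apply/andP; split.
  have := lil (f i (- x)) (l (- x)) (ex_intro _ (- x) erefl).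
  by rewrite !linearN lerN2.
by have := lil (f i x) (l x) (ex_intro _ x erefl).
Qed.

Lemma near_log_laplace i (l : {scalar X}) (li : {scalar Xi i}) :
  continuous (li : Xi i -> R) -> (forall x, l x = li (f i x)) ->
  \forall n \near \oo, log_laplace (fun L => mu L) l n = log_laplace (fun L => nu i L) li n.
Proof.
move=> cli lE; apply: filterS (nbhs_infty_gt 0) => n n0.
by apply: log_laplace_image => //; exact: dual_measurable (hX i) _ cli.
Qed.

Lemma pressure_factor i (l : {scalar X}) (li : {scalar Xi i}) :
  continuous (li : Xi i -> R) -> (forall x, l x = li (f i x)) ->
  p l = pressure (fun L => nu i L) li.
Proof. by move=> cli lE; apply: limn_esup_near; exact: near_log_laplace. Qed.

Lemma limit_pressure_cvg (l : {scalar X}) : continuous (l : X -> R) ->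
  log_laplace (fun L => mu L) l n @[n --> \oo] --> p l.
Proof.
move=> /dual_factor[i [li [cli lE]]]; rewrite (pressure_factor cli lE).
apply: cvg_trans (pressure_cvg d0 (hX i) (nuP i) (nuadi i) (nucl i) cli).
apply: near_eq_cvg; apply: filterS (near_log_laplace cli lE) => n ->//.
Qed.

(** Proved on the X_i through which l factors. There the pressure is not -oo,
    which settles the points where s is -oo. *)
Lemma limit_young (l : {scalar X}) x : continuous (l : X -> R) ->
  ((l x)%:E <= p l - s x)%E.
Proof.
move=> /dual_factor[i [li [cli lE]]]; rewrite (pressure_factor cli lE) lE.
have pNy := pressure_gtNy (hX i) (nuP i) (nucl i) cli.
have H := entropy_add_le_pressure (hX i) (nu i) (f i x) cli.
have sS := limit_entropy_le i x.
have S0 := entropy_le0 (hX i) (nu i) (f i x).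
have : (s x + (li (f i x))%:E <= pressure (fun L => nu i L) li)%E.
  by apply: le_trans H; rewrite leeD2r.
have : (s x <= 0)%E := le_trans sS S0.
case: (s x) => [r| |] //.
- by move=> _; rewrite leeBrDr// addeC.
- by move=> _ _; rewrite [(- -oo)%E]/= addey ?leey// gt_eqF.
Qed.

(** A real above s x is above the entropy at f_i x for some i, because s is the
    infimum of these entropies. The linear form that exists_dual_form gives on
    X_i, composed with f_i, has the same pressure. *)
Lemma limit_entropy_dual (x : X) :
  (forall i, ctl (push_system (f i) (fun L => mu L)) (f i @` D)) ->
  s x = ereal_inf [set (p l - (l x)%:E)%E |
                   l in [set l : {scalar X} | continuous (l : X -> R)]].
Proof.
move=> muctl; apply/eqP; rewrite eq_le; apply/andP; split.
  apply: le_ereal_inf_tmp => _ [l cl <-].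
  have [i [li [cli lE]]] := dual_factor cl.
  rewrite leeBrDr// (pressure_factor cli lE) lE.
  apply: le_trans (entropy_add_le_pressure (hX i) (nu i) (f i x) cli).
  by rewrite leeD2r// limit_entropy_le.
apply: lee_real_lt => a ainf; rewrite leNgt; apply/negP => sa.
have [i Sia] := limit_entropy_lt sa.
have [li cli pli] := exists_dual_form d0 (hX i) (nuP i) (nuadi i) (nucl i)
  (convex_set_image cD) (image_carried (@fM i) muD) (muctl i) Sia.
pose l0 : X -> R := fun y => li (f i y).
have ll0 : linear l0 by move=> r y z; rewrite /l0 !linearP.
pose l : {scalar X} := HB.pack l0 (GRing.isLinear.Build R X R _ l0 ll0).
have lE y : l y = li (f i y) by [].
have cl : continuous (l : X -> R).
  have [C oC Cl] := dual_small (hX i) cli ltr01.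
  apply: (@bounded_dual _ _ l 1 (f i @^-1` C)); last by move=> y Cy; rewrite lE Cl.
  apply/(pl_nbhs0 hlim); exists (f i @^-1` C) => //; by exists i, C; case: oC.
have : (ereal_inf [set (p l - (l x)%:E)%E |
    l in [set l : {scalar X} | continuous (l : X -> R)]] <= p l - (l x)%:E)%E.
  by apply: ereal_inf_lbound; exists l.
move=> /(lt_le_trans ainf); rewrite lteBrDr// (pressure_factor cli lE) lE.
by rewrite ltNge -EFinD pli.
Qed.

(** A compact subset of D is compact in X, so the bound in X applies to it; and
    the measure of an event is that of its trace, because D carries the
    means. *)
Lemma limit_trace_ldp :
  weak_ldp d (trace_alg D) (trace_neighborhoods D N) (fun n => trace_meas D (mu_ n)).
Proof.
move=> _ [A sA <-] cK.
have traceE B : sigalg B -> \forall n \near \oo,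
    log_rate d mu_ B n =
    log_rate d (fun n => trace_meas D (mu_ n)) (set_val @^-1` B : set D) n.
  move=> sB; apply: filterS (nbhs_infty_gt 0) => n n0; rewrite /log_rate trace_measE//.
  by move=> A1 A2 s1 s2; exact: (cramer_carried cD muD).
have cval : continuous (set_val : D -> X) by exact: initial_continuous.
rewrite -(limn_esup_near (traceE A sA)).
have cK1 := continuous_compact (continuous_subspaceT cval) cK.
have AK1 : A `&` D `<=` set_val @` closure (set_val @^-1` A : set D).
  move=> x [Ax Dx]; exists (exist _ x (mem_set Dx)) => //.
  exact: subset_closure.
apply: le_trans (limit_upper_bound sA cK1 AK1) _.
apply: ge_ereal_sup => _ [_ [y yK <-] <-].
apply: le_trans (ereal_sup_ubound _); last by exists y.
apply: le_ereal_inf_tmp => _ [_ [C NC <-] <-].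
have sC : sigalg C.
  move: NC => [_ [i [B [mB sB oB ->]]] <-]; rewrite translate_preimage.
  exact: limit_sigalg.
by rewrite -(limn_einf_near (traceE C sC)); apply: ereal_inf_lbound; exists C.
Qed.

End projective_limit.

Theorem mainTheorem2
    (R : realType) (dJ : Order.disp_t) (J : preorderType dJ)
    (X : measTvsType R)
    (Xi : J -> measTvsType R)
    (C0i : forall i : J, set (set (Xi i)))
    (f : forall i : J, {linear X -> Xi i})
    (fij : forall i j : J, {linear Xi j -> Xi i})
    (hsys : is_proj_system C0i f fij) (hlim : is_proj_limit f)
    (d : nat) (hd : (0 < d)%N)
    (D : set X) (hD : convex_set D)
    (mu : forall L : set 'rV[int]_d, probability (confS X L) R)
    (hmu : is_scit mu)
    (hcar : carried (fun L => mu L) [set w | forall z, D (w z)])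
    (hadi : forall i : J, adi (push_system (f i) (fun L => mu L)))
    (hcl : forall i : J, cl (push_system (f i) (fun L => mu L))) :
  let mu_ := cramer (fun L => mu L) in
  let N := neighborhoods (limit_C0 f) in
  let s := entropy d N mu_ in
  let p := fun l : {scalar X} => pressure (fun L => mu L) l in
  [/\ [/\ forall K : set X, sigalg K -> compact (closure (K `&` D)) ->
            (limn_esup (log_rate d mu_ K)
               <= ereal_sup [set s x | x in closure K])%E,
          weak_ldp d sigalg N mu_ &
          weak_ldp d (trace_alg D) (trace_neighborhoods D N)
            (fun n => trace_meas D (mu_ n))],
      (forall l : {scalar X}, continuous (l : X -> R) ->
         log_laplace (fun L => mu L) l n @[n --> \oo] --> p l) /\
      (forall (l : {scalar X}) (x : X), continuous (l : X -> R) ->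
         ((l x)%:E <= p l - s x)%E) &
      (forall i : J, ctl (push_system (f i) (fun L => mu L)) (f i @` D)) ->
      forall x : X,
        s x = ereal_inf [set (p l - (l x)%:E)%E |
                         l in [set l : {scalar X} | continuous (l : X -> R)]]].
Proof.
move=> mu_ N s p.
have upper K : sigalg K -> compact (closure (K `&` D)) ->
    (limn_esup (log_rate d mu_ K) <= ereal_sup [set s x | x in closure K])%E.
  move=> sK cK; apply: le_trans
    (limit_upper_bound hsys hlim hd hD hmu hcar hadi hcl sK cK (@subset_closure _ _)) _.
  by apply: ereal_sup_le; apply: image_subset; apply: closure_subset => x [].
split; [split| |].
- exact: upper.
- move=> K sK cK; apply: upper => //; apply: (subclosed_compact _ cK).
    exact: closed_closure.
  by apply: closure_subset => x [].
- exact: (limit_trace_ldp hsys hlim hd hD hmu hcar hadi hcl).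
- split=> [l cl|l x cl].
    exact: (limit_pressure_cvg hsys hlim hd hmu hadi hcl cl).
  exact: (limit_young hsys hlim hmu hcl x cl).
- by move=> muctl x; exact: (limit_entropy_dual hsys hlim hd hD hmu hcar hadi hcl x muctl).
Qed.
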